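(* For every true sentence $\varphi$ of first-order arithmetic there exists a well-founded $\mathsf{PA}$-verifiable computable linear order $\mathcal L$ such that $$\mathsf{RFN}^{\mathcal L}(\mathsf{PA})\vdash\varphi .$$
   Context: $\mathsf{PA}$ is first-order Peano arithmetic; ''true'' means true in the standard model $\mathbb N$. Computable linear orders. A linear order $\mathcal L$ is a set $L\subseteq\mathbb N$ with a binary relation $\preceq^{\mathcal L}$ (coded as a set of numbers via a standard pairing function) satisfying the axioms of (non-strict) linear orders; $L=\{x: x\preceq^{\mathcal L}x\}$. Inside first-order arithmetic a computable linear order is represented by a natural number coding a pair consisting of an index of a $\Pi_1$-set and an index of a $\Sigma_1$-set which define the same set $\preceq^{\mathcal L}$, this set being a linear order. $\mathsf{LO}(\mathcal L)$ is the first-order arithmetical formula expressing that $\mathcal L$ is a computable linear order in this sense. $\mathcal L$ is a $\mathsf{PA}$-verifiable (computable) linear order if $\mathsf{PA}\vdash\mathsf{LO}(\mathcal L)$. Uniform reflection. Let $T$ be a c.e. axiomatizable arithmetical theory given by a $\Sigma_1$-formula $\mathsf{Ax}_T(x)$ saying that $x$ is the Gödel number of an axiom of $T$, and let $\mathsf{Prv}_T(x)$ be the natural provability predicate (there is a first-order proof of $x$ from premises satisfying $\mathsf{Ax}_T$). $\mathsf{RFN}(T)$ is the extension of $T$ by all sentences $\forall x\,(\mathsf{Prv}_T(\ulcorner\varphi(\dot x)\urcorner)\to\varphi(x))$, for $\varphi(x)$ an arbitrary arithmetical formula ($\dot x$ denotes substitution of the numeral of $x$). Iteration. For a $\mathsf{PA}$-verifiable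 computable linear order $\mathcal L$ and $a\in L$, $$\mathsf{RFN}^{(\mathcal L,a)}(T)=T+\bigcup_{b\prec^{\mathcal L}a}\mathsf{RFN}(\mathsf{RFN}^{(\mathcal L,b)}(T)),\qquad \mathsf{RFN}^{\mathcal L}(T)=T+\bigcup_{a\in L}\mathsf{RFN}(\mathsf{RFN}^{(\mathcal L,a)}(T)).$$ Formally, the axioms of $\mathsf{RFN}^{(\mathcal L,a)}(T)$ are recognized by the $\Sigma_1$-formula $\mathsf{Ax}_T^{\mathcal L}(\underline a,y)$, where $\mathsf{Ax}_T^{\mathcal L}(x,y)$ is obtained by the Diagonal Lemma so as to be $\mathsf{PA}$-provably equivalent to: ''$x\in\mathcal L$, and either $y$ is an axiom of $T$ or for some $z\prec^{\mathcal L}x$, $y$ is an instance of the uniform reflection scheme for the theory whose axioms are defined by $\mathsf{Ax}_T^{\mathcal L}(\underline z,\cdot)$''. *)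

(* Defs.v *)
From Stdlib Require Import Arith List.
Import ListNotations.

(** * First-order arithmetic: language 0, S, +, *, =, <, with de Bruijn variables *)

Inductive term : Type :=
| Var (i : nat)
| Zero
| Succ (t : term)
| Add (t u : term)
| Mul (t u : term).

Inductive form : Type :=
| Equ (t u : term)
| Less (t u : term)
| Bot
| Imp (f g : form)
| All (f : form).

Definition Neg (f : form) : form := Imp f Bot.
Definition And (f g : form) : form := Neg (Imp f (Neg g)).
Definition Or (f g : form) : form := Imp (Neg f) g.
Definition Iff (f g : form) : form := And (Imp f g) (Imp g f).
Definition Ex (f : form) : form := Neg (All (Neg f)).

Fixpoint closed_term (n : nat) (t : term) : Prop :=
  match t with
  | Var i => i < n
  | Zero => True
  | Succ t => closed_term n t
  | Add t u | Mul t u => closed_term n t /\ closed_term n u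
  end.

(* All free variables of [f] are among #0, ..., #(n-1). *)
Fixpoint closed_form (n : nat) (f : form) : Prop :=
  match f with
  | Equ t u | Less t u => closed_term n t /\ closed_term n u
  | Bot => True
  | Imp f g => closed_form n f /\ closed_form n g
  | All f => closed_form (S n) f
  end.

Definition sentence (f : form) : Prop := closed_form 0 f.

(* The standard model. *)
Fixpoint eval (rho : nat -> nat) (t : term) : nat :=
  match t with
  | Var i => rho i
  | Zero => 0
  | Succ t => S (eval rho t)
  | Add t u => eval rho t + eval rho u
  | Mul t u => eval rho t * eval rho u
  end.

Definition scons (n : nat) (rho : nat -> nat) (i : nat) : nat :=
  match i with 0 => n | S i => rho i end.

Fixpoint sat (rho : nat -> nat) (f : form) : Prop :=
  match f with
  | Equ t u => eval rho t = eval rho u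
  | Less t u => eval rho t < eval rho u
  | Bot => False
  | Imp f g => sat rho f -> sat rho g
  | All f => forall n, sat (scons n rho) f
  end.

Definition true_in_N (f : form) : Prop := forall rho, sat rho f.

(* Simultaneous replacement of variables.  In [map_form v k f], [v k i] is the
   term put for the variable #i at an occurrence under k binders. *)
Fixpoint map_term (v : nat -> term) (t : term) : term :=
  match t with
  | Var i => v i
  | Zero => Zero
  | Succ t => Succ (map_term v t)
  | Add t u => Add (map_term v t) (map_term v u)
  | Mul t u => Mul (map_term v t) (map_term v u)
  end.

Fixpoint map_form (v : nat -> nat -> term) (k : nat) (f : form) : form :=
  match f with
  | Equ t u => Equ (map_term (v k) t) (map_term (v k) u)
  | Less t u => Less (map_term (v k) t) (map_term (v k) u)
  | Bot => Bot
  | Imp f g => Imp (map_form v k f) (map_form v k g)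
  | All f => All (map_form v (S k) f)
  end.

Definition shift_term (k : nat) (t : term) : term :=
  map_term (fun i => Var (k + i)) t.

(* [shift f] adds 1 to the free variables; [inst s f] is f[s/#0], the other
   free variables being decremented; [step f] is f[S #0/#0], the other free
   variables being unchanged. *)
Definition shift_var (k i : nat) : term := Var (if i <? k then i else S i).
Definition inst_var (s : term) (k i : nat) : term :=
  if i <? k then Var i else if i =? k then shift_term k s else Var (pred i).
Definition step_var (k i : nat) : term := if i =? k then Succ (Var k) else Var i.

Definition shift (f : form) : form := map_form shift_var 0 f.
Definition inst (s : term) (f : form) : form := map_form (inst_var s) 0 f.
Definition step (f : form) : form := map_form step_var 0 f.

(* Hilbert-style calculus with equality.  Because of generalization, a
   non-logical axiom with free variables amounts to its universal closure. *)
Inductive logical_axiom : form -> Prop :=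
| ax_K f g : logical_axiom (Imp f (Imp g f))
| ax_S f g h :
    logical_axiom (Imp (Imp f (Imp g h)) (Imp (Imp f g) (Imp f h)))
| ax_DN f : logical_axiom (Imp (Neg (Neg f)) f)
| ax_inst s f : logical_axiom (Imp (All f) (inst s f))
| ax_dist f g : logical_axiom (Imp (All (Imp f g)) (Imp (All f) (All g)))
| ax_vac f : logical_axiom (Imp f (All (shift f)))
| ax_refl s : logical_axiom (Equ s s)
| ax_leibniz s t f :
    logical_axiom (Imp (Equ s t) (Imp (inst s f) (inst t f))).

Inductive provable (T : form -> Prop) : form -> Prop :=
| pr_logic f : logical_axiom f -> provable T f
| pr_axiom f : T f -> provable T f
| pr_mp f g : provable T f -> provable T (Imp f g) -> provable T g
| pr_gen f : provable T f -> provable T (All f).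

Definition PA_base : list form :=
  [ Neg (Equ (Succ (Var 0)) Zero);
    Imp (Equ (Succ (Var 0)) (Succ (Var 1))) (Equ (Var 0) (Var 1));
    Equ (Add (Var 0) Zero) (Var 0);
    Equ (Add (Var 0) (Succ (Var 1))) (Succ (Add (Var 0) (Var 1)));
    Equ (Mul (Var 0) Zero) Zero;
    Equ (Mul (Var 0) (Succ (Var 1))) (Add (Mul (Var 0) (Var 1)) (Var 0));
    Iff (Less (Var 0) (Var 1)) (Ex (Equ (Add (Var 1) (Succ (Var 0))) (Var 2))) ].

Definition induction (f : form) : form :=
  Imp (inst Zero f) (Imp (All (Imp f (step f))) (All f)).

Inductive PA : form -> Prop :=
| PA_of_base f : In f PA_base -> PA f
| PA_induction f : PA (induction f).

(** * Numerals and Gödel numbers *)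

Fixpoint num (n : nat) : term :=
  match n with 0 => Zero | S n => Succ (num n) end.

(* An injective pairing function that is a polynomial, hence a term of the
   language; it is not surjective. *)
Definition pair (x y : nat) : nat := (x + y) * (x + y) + x.

Fixpoint gn_term (t : term) : nat :=
  match t with
  | Var i => pair 0 i
  | Zero => pair 1 0
  | Succ t => pair 2 (gn_term t)
  | Add t u => pair 3 (pair (gn_term t) (gn_term u))
  | Mul t u => pair 4 (pair (gn_term t) (gn_term u))
  end.

Fixpoint gn (f : form) : nat :=
  match f with
  | Equ t u => pair 5 (pair (gn_term t) (gn_term u))
  | Less t u => pair 6 (pair (gn_term t) (gn_term u))
  | Bot => pair 7 0
  | Imp f g => pair 8 (pair (gn f) (gn g))
  | All f => pair 9 (gn f)
  end.

(** * Writing arithmetical formulas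

    A [tm] or [fm] is a term or formula given as a function of the number d of
    variables in scope.  The variable bound at level l (counted from outside)
    is #(d - 1 - l) in scope d, so quantifiers may be written with Rocq
    functions and no explicit de Bruijn index. *)

Definition tm : Type := nat -> term.
Definition fm : Type := nat -> form.

Definition level (l : nat) : tm := fun d => Var (d - S l).
Definition hnum (n : nat) : tm := fun _ => num n.
Definition hsucc (t : tm) : tm := fun d => Succ (t d).
Definition hadd (t u : tm) : tm := fun d => Add (t d) (u d).
Definition hmul (t u : tm) : tm := fun d => Mul (t d) (u d).
Definition hpair (t u : tm) : tm := hadd (hmul (hadd t u) (hadd t u)) t.

Definition hequ (t u : tm) : fm := fun d => Equ (t d) (u d).
Definition hless (t u : tm) : fm := fun d => Less (t d) (u d).
Definition hbot : fm := fun _ => Bot.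
Definition himp (f g : fm) : fm := fun d => Imp (f d) (g d).
Definition hneg (f : fm) : fm := fun d => Neg (f d).
Definition hand (f g : fm) : fm := fun d => And (f d) (g d).
Definition hor (f g : fm) : fm := fun d => Or (f d) (g d).
Definition hiff (f g : fm) : fm := fun d => Iff (f d) (g d).
Definition hall (f : tm -> fm) : fm := fun d => All (f (level d) (S d)).
Definition hex (f : tm -> fm) : fm := fun d => Ex (f (level d) (S d)).

Declare Scope fm_scope.
Delimit Scope fm_scope with fm.
Bind Scope fm_scope with fm.
Bind Scope fm_scope with tm.
Notation "t ⊕ u" := (hadd t u) (at level 50, left associativity) : fm_scope.
Notation "t ⊗ u" := (hmul t u) (at level 40, left associativity) : fm_scope.
Notation "⟨ t , .. , u , v ⟩" :=
  (hpair t .. (hpair u v) ..) (at level 0) : fm_scope.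
Notation "t ≐ u" := (hequ t u) (at level 70, no associativity) : fm_scope.
Notation "t ⋖ u" := (hless t u) (at level 70, no associativity) : fm_scope.
Notation "¬ f" := (hneg f) (at level 75, right associativity) : fm_scope.
Notation "f ∧ g" := (hand f g) (at level 80, right associativity) : fm_scope.
Notation "f ∨ g" := (hor f g) (at level 85, right associativity) : fm_scope.
Notation "f ⇒ g" := (himp f g) (at level 90, right associativity) : fm_scope.
Notation "f ⇔ g" := (hiff f g) (at level 95, no associativity) : fm_scope.
Notation "∃ x .. y , f" := (hex (fun x => .. (hex (fun y => f)) ..))
  (at level 200, x binder, y binder, right associativity) : fm_scope.
Notation "∀ x .. y , f" := (hall (fun x => .. (hall (fun y => f)) ..))
  (at level 200, x binder, y binder, right associativity) : fm_scope.
Local Open Scope fm_scope.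

(* Truth in the standard model of an [fm] without free variables. *)
Definition holds (f : fm) : Prop := true_in_N (f 0).

(** * Arithmetization of syntax *)

(* Gödel's β function: [y] is the remainder of [a] modulo 1 + (i + 1) b. *)
Definition aBeta (a b i y : tm) : fm :=
  let m := hsucc (hsucc i ⊗ b) in y ⋖ m ∧ ∃ q, a ≐ q ⊗ m ⊕ y.

(* Σ₁-form of the least set closed under [rule]: there is a finite sequence
   ending with [x], each entry y of which satisfies [rule y D], where D is the
   set of the preceding entries. *)
Definition aDer (rule : tm -> (tm -> fm) -> fm) (x : tm) : fm :=
  ∃ a b n, aBeta a b n x ∧
    ∀ i, i ⋖ hsucc n ⇒
      ∃ y, aBeta a b i y ∧ rule y (fun z => ∃ j, j ⋖ i ∧ aBeta a b j z).

(* Codes of compound expressions from the codes of their parts. *)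
Definition cVar (i : tm) : tm := ⟨hnum 0, i⟩.
Definition cZero : tm := ⟨hnum 1, hnum 0⟩.
Definition cSucc (t : tm) : tm := ⟨hnum 2, t⟩.
Definition cAdd (t u : tm) : tm := ⟨hnum 3, t, u⟩.
Definition cMul (t u : tm) : tm := ⟨hnum 4, t, u⟩.
Definition cEqu (t u : tm) : tm := ⟨hnum 5, t, u⟩.
Definition cLess (t u : tm) : tm := ⟨hnum 6, t, u⟩.
Definition cBot : tm := ⟨hnum 7, hnum 0⟩.
Definition cImp (f g : tm) : tm := ⟨hnum 8, f, g⟩.
Definition cAll (f : tm) : tm := ⟨hnum 9, f⟩.
Definition cNeg (f : tm) : tm := cImp f cBot.

(* [closed_term] and [closed_form] *)
Definition aTerm (n t : tm) : fm :=
  aDer (fun t D =>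
    (∃ i, i ⋖ n ∧ t ≐ cVar i)
    ∨ t ≐ cZero
    ∨ (∃ u, D u ∧ t ≐ cSucc u)
    ∨ (∃ u v, D u ∧ D v ∧ (t ≐ cAdd u v ∨ t ≐ cMul u v))) t.

Definition aForm (n f : tm) : fm :=
  aDer (fun y D => ∃ n f, y ≐ ⟨n, f⟩ ∧
    ((∃ t u, aTerm n t ∧ aTerm n u ∧ (f ≐ cEqu t u ∨ f ≐ cLess t u))
     ∨ f ≐ cBot
     ∨ (∃ g h, D ⟨n, g⟩ ∧ D ⟨n, h⟩ ∧ f ≐ cImp g h)
     ∨ (∃ g, D ⟨hsucc n, g⟩ ∧ f ≐ cAll g))) ⟨n, f⟩.

Definition aIsTerm (t : tm) : fm := ∃ n, aTerm n t.
Definition aIsForm (f : tm) : fm := ∃ n, aForm n f.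

(* Graphs of [map_term] and [map_form], the graph of [v] being given. *)
Definition aMapTerm (v : tm -> tm -> fm) (t t' : tm) : fm :=
  aDer (fun y D =>
    (∃ i u, v i u ∧ y ≐ ⟨cVar i, u⟩)
    ∨ y ≐ ⟨cZero, cZero⟩
    ∨ (∃ u u', D ⟨u, u'⟩ ∧ y ≐ ⟨cSucc u, cSucc u'⟩)
    ∨ (∃ u u' w w', D ⟨u, u'⟩ ∧ D ⟨w, w'⟩ ∧
         (y ≐ ⟨cAdd u w, cAdd u' w'⟩ ∨ y ≐ ⟨cMul u w, cMul u' w'⟩)))
    ⟨t, t'⟩.

Definition aMapForm (v : tm -> tm -> tm -> fm) (k f f' : tm) : fm :=
  aDer (fun y D => ∃ k,
    (∃ t t' u u', aMapTerm (v k) t t' ∧ aMapTerm (v k) u u' ∧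
       (y ≐ ⟨k, cEqu t u, cEqu t' u'⟩ ∨ y ≐ ⟨k, cLess t u, cLess t' u'⟩))
    ∨ y ≐ ⟨k, cBot, cBot⟩
    ∨ (∃ g g' h h', D ⟨k, g, g'⟩ ∧ D ⟨k, h, h'⟩ ∧
         y ≐ ⟨k, cImp g h, cImp g' h'⟩)
    ∨ (∃ g g', D ⟨hsucc k, g, g'⟩ ∧ y ≐ ⟨k, cAll g, cAll g'⟩))
    ⟨k, f, f'⟩.

Definition aShiftTerm (k t t' : tm) : fm :=
  aMapTerm (fun i u => u ≐ cVar (k ⊕ i)) t t'.

Definition aShiftVar (k i u : tm) : fm :=
  (i ⋖ k ∧ u ≐ cVar i) ∨ (¬ i ⋖ k ∧ u ≐ cVar (hsucc i)).
Definition aInstVar (s k i u : tm) : fm :=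
  (i ⋖ k ∧ u ≐ cVar i) ∨ (i ≐ k ∧ aShiftTerm k s u)
  ∨ (∃ j, k ⋖ i ∧ i ≐ hsucc j ∧ u ≐ cVar j).
Definition aStepVar (k i u : tm) : fm :=
  (i ≐ k ∧ u ≐ cSucc (cVar k)) ∨ (¬ i ≐ k ∧ u ≐ cVar i).

Definition aShift (f g : tm) : fm := aMapForm aShiftVar (hnum 0) f g.
Definition aInst (s f g : tm) : fm := aMapForm (aInstVar s) (hnum 0) f g.
Definition aStep (f g : tm) : fm := aMapForm aStepVar (hnum 0) f g.

(* [t] is the code of the [n]-th numeral. *)
Definition aNum (n t : tm) : fm :=
  aDer (fun y D =>
    y ≐ ⟨hnum 0, cZero⟩
    ∨ (∃ m u, D ⟨m, u⟩ ∧ y ≐ ⟨hsucc m, cSucc u⟩)) ⟨n, t⟩.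

(* [g] is the code of f(n), the [n]-th numeral being put for #0 (and the other
   variables decremented). *)
Definition aInstNum (f n g : tm) : fm := ∃ t, aNum n t ∧ aInst t f g.

Definition aLogicalAxiom (y : tm) : fm :=
  (∃ f g, aIsForm f ∧ aIsForm g ∧ y ≐ cImp f (cImp g f))
  ∨ (∃ f g h, aIsForm f ∧ aIsForm g ∧ aIsForm h ∧
       y ≐ cImp (cImp f (cImp g h)) (cImp (cImp f g) (cImp f h)))
  ∨ (∃ f, aIsForm f ∧ y ≐ cImp (cNeg (cNeg f)) f)
  ∨ (∃ s f g, aIsTerm s ∧ aIsForm f ∧ aInst s f g ∧ y ≐ cImp (cAll f) g)
  ∨ (∃ f g, aIsForm f ∧ aIsForm g ∧
       y ≐ cImp (cAll (cImp f g)) (cImp (cAll f) (cAll g)))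
  ∨ (∃ f g, aIsForm f ∧ aShift f g ∧ y ≐ cImp f (cAll g))
  ∨ (∃ s, aIsTerm s ∧ y ≐ cEqu s s)
  ∨ (∃ s t f g h, aIsTerm s ∧ aIsTerm t ∧ aIsForm f ∧
       aInst s f g ∧ aInst t f h ∧ y ≐ cImp (cEqu s t) (cImp g h)).

(* The provability predicate of the theory whose axioms are defined by [ax]. *)
Definition aPrv (ax : tm -> fm) (x : tm) : fm :=
  aDer (fun y D =>
    aLogicalAxiom y
    ∨ ax y
    ∨ (∃ f, D f ∧ D (cImp f y))
    ∨ (∃ f, D f ∧ y ≐ cAll f)) x.

Definition aAxPA (y : tm) : fm :=
  fold_right (fun f F => y ≐ hnum (gn f) ∨ F)
    (∃ f g h, aIsForm f ∧ aInst cZero f g ∧ aStep f h ∧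
       y ≐ cImp g (cImp (cAll (cImp f h)) (cAll f)))
    PA_base.

(** * Computable linear orders *)

(* [n] is the value of the closed term coded by [t]. *)
Definition aVal (t n : tm) : fm :=
  aDer (fun y D =>
    y ≐ ⟨cZero, hnum 0⟩
    ∨ (∃ u m, D ⟨u, m⟩ ∧ y ≐ ⟨cSucc u, hsucc m⟩)
    ∨ (∃ u m w p, D ⟨u, m⟩ ∧ D ⟨w, p⟩ ∧
         (y ≐ ⟨cAdd u w, m ⊕ p⟩ ∨ y ≐ ⟨cMul u w, m ⊗ p⟩))) ⟨t, n⟩.

(* Verification ([b] = 1) and refutation ([b] = 0) of the sentence coded by [s].
   Only bounded universal quantifiers ∀x (x < t → f) can be verified, whereas
   a universal sentence is refuted by any instance.  Hence verification of a
   Σ₁-sentence is equivalent to its truth, and refutation of a Π₁-sentence to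
   its falsity, a bounded ∃x<t f being written ¬∀x (x < t → ¬f).  In the clause for bounded quantifiers, t has a value and is
   therefore closed, so it agrees with its shift. *)
Definition aDecided (b s : tm) : fm :=
  aDer (fun y D =>
    (∃ t u m n, aVal t m ∧ aVal u n ∧
       ((m ≐ n ∧ y ≐ ⟨hnum 1, cEqu t u⟩)
        ∨ (¬ m ≐ n ∧ y ≐ ⟨hnum 0, cEqu t u⟩)
        ∨ (m ⋖ n ∧ y ≐ ⟨hnum 1, cLess t u⟩)
        ∨ (¬ m ⋖ n ∧ y ≐ ⟨hnum 0, cLess t u⟩)))
    ∨ y ≐ ⟨hnum 0, cBot⟩
    ∨ (∃ f g, (D ⟨hnum 0, f⟩ ∨ D ⟨hnum 1, g⟩) ∧ y ≐ ⟨hnum 1, cImp f g⟩)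
    ∨ (∃ f g, D ⟨hnum 1, f⟩ ∧ D ⟨hnum 0, g⟩ ∧ y ≐ ⟨hnum 0, cImp f g⟩)
    ∨ (∃ t n f, aVal t n ∧
         (∀ m, m ⋖ n ⇒ ∃ g, aInstNum f m g ∧ D ⟨hnum 1, g⟩) ∧
         y ≐ ⟨hnum 1, cAll (cImp (cLess (cVar (hnum 0)) t) f)⟩)
    ∨ (∃ f n g, aInstNum f n g ∧ D ⟨hnum 0, g⟩ ∧ y ≐ ⟨hnum 0, cAll f⟩))
    ⟨b, s⟩.

(* An index of a Σ₁-set (Π₁-set) is a Gödel number of a Σ₁-formula
   (Π₁-formula) with free variable #0.  Other numbers are harmless: they index
   Σ₁-sets (Π₁-sets) too. *)
Definition aInSigma (e x : tm) : fm := ∃ s, aInstNum e x s ∧ aDecided (hnum 1) s.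
Definition aInPi (e x : tm) : fm := ¬ ∃ s, aInstNum e x s ∧ aDecided (hnum 0) s.

(* The order coded by [l] = ⟨Π₁-index, Σ₁-index⟩; [aLe], [aDom] and [aLt] use
   the Σ₁-index. *)
Definition aLe (l x y : tm) : fm := ∃ p e, l ≐ ⟨p, e⟩ ∧ aInSigma e ⟨x, y⟩.
Definition aDom (l x : tm) : fm := aLe l x x.
Definition aLt (l x y : tm) : fm := aLe l x y ∧ ¬ x ≐ y.

Definition aLO (l : tm) : fm :=
  (∃ p e, l ≐ ⟨p, e⟩ ∧
     (∀ n, aInPi p n ⇔ aInSigma e n) ∧
     (∀ n, aInSigma e n ⇒ ∃ x y, n ≐ ⟨x, y⟩))
  ∧ (∀ x y, aLe l x y ⇒ aDom l x ∧ aDom l y)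
  ∧ (∀ x y z, aLe l x y ∧ aLe l y z ⇒ aLe l x z)
  ∧ (∀ x y, aLe l x y ∧ aLe l y x ⇒ x ≐ y)
  ∧ (∀ x y, aDom l x ∧ aDom l y ⇒ aLe l x y ∨ aLe l y x).

Definition PA_verifiable_LO (l : nat) : Prop := provable PA (aLO (hnum l) 0).

(* The actual order on natural numbers coded by [l]. *)
Definition order_dom (l x : nat) : Prop := holds (aDom (hnum l) (hnum x)).
Definition order_lt (l x y : nat) : Prop :=
  holds (aLt (hnum l) (hnum x) (hnum y)).

(** * Uniform reflection and its iteration *)

(* Prv(⌜f(ẋ)⌝), where [f] is (a term for) the code of a formula. *)
Definition aPrvDot (ax : tm -> fm) (f x : tm) : fm :=
  ∃ s, aInstNum f x s ∧ aPrv ax s.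

(* ∀x (Prv(⌜f(ẋ)⌝) → f(x)) for the theory with axioms defined by [ax]. *)
Definition reflection (ax : tm -> fm) (f : form) : form :=
  All (Imp (aPrvDot ax (hnum (gn f)) (level 0) 1) f).

(* The axiom formula of the iterated reflection theories is obtained by
   diagonalization.  With a parameter [v],
     [aAxOpen axT l v x y] says that x is in the order l, and y is an axiom of T
     or, for some z below x and some f(#0), y codes ∀x (g(x) → f(x)) with
       g = the formula coded by v, at v, z and f;
     [antecedent axT l] is Prv(⌜f(ẋ)⌝) for the axioms [aAxOpen axT l v z],
       with free variables v = #0, z = #1, f = #2, x = #3.
   Taking for [v] the code of [antecedent axT l] itself, the sentence coded by
   y becomes, literally, the reflection instance of f for the axioms
   [aAxIter axT l z]. *)
Definition aAxOpen (axT : tm -> fm) (l v x y : tm) : fm :=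
  aDom l x ∧
  (axT y
   ∨ ∃ z f, aLt l z x ∧ aForm (hnum 1) f ∧
       ∃ g1 g2 g, aInstNum v v g1 ∧ aInstNum g1 z g2 ∧ aInstNum g2 f g ∧
         y ≐ cAll (cImp g f)).

Definition antecedent (axT : tm -> fm) (l : nat) : form :=
  let x := level 0 in let f := level 1 in let z := level 2 in let v := level 3 in
  aPrvDot (aAxOpen axT (hnum l) v z) f x 4.

Definition aAxIter (axT : tm -> fm) (l : nat) (x y : tm) : fm :=
  aAxOpen axT (hnum l) (hnum (gn (antecedent axT l))) x y.

(* The axioms of RFN^L(T), where [axT] is the formula defining the axioms of
   T.  The axioms of RFN^(L,a)(T) need not be added for a in L: they are axioms
   of T or reflection instances for some b in L below a. *)
Definition RFN_iter (T : form -> Prop) (axT : tm -> fm) (l : nat) (y : form)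
  : Prop :=
  T y \/
  exists a f, order_dom l a /\ closed_form 1 f /\
    y = reflection (aAxIter axT l (hnum a)) f.

(* Main.v *)
From Stdlib Require Import Arith List Lia Ring Classical ClassicalEpsilon
  FunctionalExtensionality PropExtensionality ProofIrrelevance.
Require Import Defs.
Import ListNotations.
Set Implicit Arguments.
Unset Strict Implicit.

(** Why the theorem holds.

    The order.  A refutation of a sentence φ can be tabulated as an infinite
    sequence, which tells for every subformula of φ and all values of its
    variables whether it holds, and which gives a counterexample when a
    universal subformula fails.  Such a table is correct when each entry agrees
    with the entries for the immediate subformulas; these conditions are local,
    so the finite sequences that satisfy them form a tree, and the tree and its
    Kleene-Brouwer order are given by bounded formulas.  For bounded formulas PA
    proves that verification and refutation agree with truth ([Dec_bounded]),
    whence one formula is both a Σ-index and a Π-index of the order, and PA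
    proves that the order is linear ([order_verified]).  If φ is true, the tree
    has no infinite branch, and the order is well-founded ([order_lt_wf]).  If φ
    fails, be it in a nonstandard model of PA, the finite sequences all of whose
    entries are right form a class D without a least element
    ([true_codes_down]); it is arithmetical, because truth is for the finitely
    many subformulas of φ.

    Reflection.  Let T_z be the theory attached to the element z of the order.
    By diagonalization there is a formula Y such that Y(z) says: φ fails, z is in
    D, and T_c proves ¬Y(e) for all e < c ≤ z.  Reflection for T_z refutes Y(z):
    if Y(z) holds, there is e < z in D, T_z proves ¬Y(e), and by reflection Y(e)
    fails; but Y(e) only asks for a part of what Y(z) provides.  This argument is
    made in PA ([step_provable]).  Every T_b with z < b therefore proves ¬Y(z),
    since reflection for T_z is one of its axioms; and PA proves that all of them
    do so ([refuted_below]).  Now assume that φ fails.  The empty sequence t is in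
    D; let z be an element of D below it.  All the provability claims of Y(z)
    hold, so Y(z) holds, while T_t proves ¬Y(z), and reflection for T_t yields
    ¬Y(z).  Hence reflection for T_t proves φ ([reflection_proves]).

    The method.  Derivations in the calculus are obtained from Gödel's
    completeness theorem ([completeness]): a formula is proved by an argument in
    an arbitrary model of PA.  There, the arithmetized notions become relations
    between elements of the model ([means]), which are studied by induction for
    definable predicates ([ind]).  The β function ([sequence_coded]) makes the
    sets generated by finite derivations closed under their rules
    ([Der_close]), which gives the substitution calculus on codes with numerals
    of arbitrary elements ([InstNum_code]) and the first derivability condition
    ([provable_Prv]). *)

(** * Simultaneous substitution *)

Definition push {A : Type} (x : A) (r : nat -> A) (i : nat) : A :=
  match i with 0 => x | S i => r i end.
Notation "x .: r" := (push x r) (at level 55, right associativity).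

Definition up (s : nat -> term) : nat -> term :=
  Var 0 .: fun i => map_term (fun j => Var (S j)) (s i).

Fixpoint sub (s : nat -> term) (f : form) : form :=
  match f with
  | Equ t u => Equ (map_term s t) (map_term s u)
  | Less t u => Less (map_term s t) (map_term s u)
  | Bot => Bot
  | Imp f g => Imp (sub s f) (sub s g)
  | All f => All (sub (up s) f)
  end.

Lemma map_term_comp s r t :
  map_term s (map_term r t) = map_term (fun i => map_term s (r i)) t.
Proof. induction t; simpl; congruence. Qed.

Lemma map_term_num s n : map_term s (num n) = num n.
Proof. induction n; simpl; congruence. Qed.

Lemma map_term_id t : map_term Var t = t.
Proof. induction t; simpl; congruence. Qed.

Lemma up_id : up Var = Var.
Proof. extensionality i; destruct i; reflexivity. Qed.

Lemma sub_id f : sub Var f = f.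
Proof. induction f; simpl; rewrite ?map_term_id, ?up_id; congruence. Qed.

Lemma up_comp s r :
  (fun i => map_term (up s) (up r i)) = up (fun i => map_term s (r i)).
Proof.
  extensionality i; destruct i; simpl; [reflexivity|].
  now rewrite !map_term_comp.
Qed.

Lemma sub_comp f : forall s r,
  sub s (sub r f) = sub (fun i => map_term s (r i)) f.
Proof.
  induction f; intros; simpl; rewrite ?map_term_comp, ?IHf, ?IHf1, ?IHf2, ?up_comp;
    reflexivity.
Qed.

(** The replacement of variables under binders is a substitution as soon as its
    action under one more binder is the lifted one. *)
Lemma map_form_sub v f : (forall k, v (S k) = up (v k)) ->
  forall k, map_form v k f = sub (v k) f.
Proof.
  intros Hv; induction f; intros; simpl; rewrite ?IHf, ?IHf1, ?IHf2, ?Hv; reflexivity.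
Qed.

Lemma shift_sub f : shift f = sub (fun i => Var (S i)) f.
Proof.
  unfold shift; rewrite map_form_sub; [reflexivity|].
  intros k; extensionality i; destruct i; [reflexivity|].
  unfold shift_var; simpl. change (S i <? S k) with (i <? k).
  now destruct (i <? k).
Qed.

Lemma step_sub f : step f = sub (Succ (Var 0) .: fun i => Var (S i)) f.
Proof.
  unfold step; rewrite map_form_sub.
  - f_equal. extensionality i; now destruct i.
  - intros k; extensionality i; destruct i; [reflexivity|].
    unfold step_var; simpl. now destruct (i =? k).
Qed.

Lemma inst_sub s f : inst s f = sub (s .: Var) f.
Proof.
  unfold inst; rewrite map_form_sub.
  - f_equal. extensionality i; destruct i; [apply map_term_id|reflexivity].
  - intros k; extensionality i; destruct i; [reflexivity|].
    unfold inst_var; simpl. change (S i <? S k) with (i <? k).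
    destruct (Nat.ltb_spec i k); [reflexivity|].
    destruct (Nat.eqb_spec i k).
    + unfold shift_term. rewrite map_term_comp. reflexivity.
    + simpl. f_equal. lia.
Qed.

Lemma inst_up_sub t s f : inst t (sub (up s) f) = sub (t .: s) f.
Proof.
  rewrite inst_sub, sub_comp. f_equal. extensionality i. destruct i; simpl; [reflexivity|].
  rewrite map_term_comp. apply map_term_id.
Qed.

Lemma map_term_closed n t s r : closed_term n t -> (forall i, i < n -> s i = r i) ->
  map_term s t = map_term r t.
Proof. intros H E; induction t; simpl in *; f_equal; intuition. Qed.

Lemma sub_closed f : forall n s r, closed_form n f -> (forall i, i < n -> s i = r i) ->
  sub s f = sub r f.
Proof.
  induction f; simpl; intros n s r H E; f_equal;
    try (eapply map_term_closed; [eapply proj1; eassumption|assumption]);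
    try (eapply map_term_closed; [eapply proj2; eassumption|assumption]);
    try solve [intuition eauto].
  eapply IHf; [eassumption|]. intros [|i] Hi; simpl; [reflexivity|].
  rewrite E by lia. reflexivity.
Qed.

Lemma sentence_sub s f : sentence f -> sub s f = f.
Proof.
  intros H. rewrite <- (sub_id f) at 2. apply sub_closed with (n := 0); [exact H|lia].
Qed.

Lemma closed_map_term m s t : (forall i, closed_term m (s i)) -> closed_term m (map_term s t).
Proof. intros H; induction t; simpl; auto. Qed.

Lemma closed_sub f : forall m s, (forall i, closed_term m (s i)) -> closed_form m (sub s f).
Proof.
  induction f; simpl; intros m s H; auto using closed_map_term.
  apply IHf. intros [|i]; simpl; [lia|].
  assert (G : forall t, closed_term m t -> closed_term (S m) (map_term (fun j => Var (S j)) t)).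
  { induction t; simpl; intuition lia. }
  apply G, H.
Qed.

Lemma closed_term_mono t : forall n m, n <= m -> closed_term n t -> closed_term m t.
Proof. induction t; simpl; intros; intuition (eauto; lia). Qed.

Lemma closed_mono f : forall n m, n <= m -> closed_form n f -> closed_form m f.
Proof.
  induction f; simpl; intros n m Hn H; intuition eauto using closed_term_mono.
  eapply IHf; [|eassumption]; lia.
Qed.

Fixpoint term_bound (t : term) : nat :=
  match t with
  | Var i => S i
  | Zero => 0
  | Succ t => term_bound t
  | Add t u | Mul t u => max (term_bound t) (term_bound u)
  end.

Fixpoint bound (f : form) : nat :=
  match f with
  | Equ t u | Less t u => max (term_bound t) (term_bound u)
  | Bot => 0
  | Imp f g => max (bound f) (bound g)
  | All f => pred (bound f)
  end.

Lemma term_boundP t : closed_term (term_bound t) t.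
Proof.
  induction t; simpl; auto; split; eapply closed_term_mono; try eassumption; lia.
Qed.

Lemma boundP f : closed_form (bound f) f.
Proof.
  induction f; simpl; try split; auto;
    try (eapply closed_term_mono; [|apply term_boundP]; lia);
    (eapply closed_mono; [|eassumption]); lia.
Qed.

(** * Tarskian semantics *)

Record structure : Type := Structure {
  carrier :> Type;
  ze : carrier;
  su : carrier -> carrier;
  ad : carrier -> carrier -> carrier;
  mu : carrier -> carrier -> carrier;
  lt : carrier -> carrier -> Prop
}.
Arguments ze {s}.
Arguments su {s}.
Arguments ad {s}.
Arguments mu {s}.
Arguments lt {s}.

Fixpoint ev {M : structure} (rho : nat -> M) (t : term) : M :=
  match t with
  | Var i => rho i
  | Zero => ze
  | Succ t => su (ev rho t)
  | Add t u => ad (ev rho t) (ev rho u)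
  | Mul t u => mu (ev rho t) (ev rho u)
  end.

Fixpoint tr {M : structure} (rho : nat -> M) (f : form) : Prop :=
  match f with
  | Equ t u => ev rho t = ev rho u
  | Less t u => lt (ev rho t) (ev rho u)
  | Bot => False
  | Imp f g => tr rho f -> tr rho g
  | All f => forall x, tr (x .: rho) f
  end.

Lemma ev_map (M : structure) (rho : nat -> M) s t :
  ev rho (map_term s t) = ev (fun i => ev rho (s i)) t.
Proof. induction t; simpl; congruence. Qed.

Lemma ev_up (M : structure) (rho : nat -> M) s x :
  (fun i => ev (x .: rho) (up s i)) = x .: (fun i => ev rho (s i)).
Proof.
  extensionality i; destruct i; [reflexivity|]. simpl. rewrite ev_map. reflexivity.
Qed.

Lemma tr_sub (M : structure) f : forall (rho : nat -> M) s,
  tr rho (sub s f) <-> tr (fun i => ev rho (s i)) f.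
Proof.
  induction f; intros; simpl; rewrite ?ev_map, ?IHf1, ?IHf2; try reflexivity.
  split; intros H x; specialize (H x); rewrite IHf, ev_up in *; assumption.
Qed.

Lemma tr_inst (M : structure) f (rho : nat -> M) t :
  tr rho (inst t f) <-> tr (ev rho t .: rho) f.
Proof.
  rewrite inst_sub, tr_sub.
  replace (ev rho t .: rho) with (fun i => ev rho ((t .: Var) i)); [reflexivity|].
  extensionality i; now destruct i.
Qed.

Lemma tr_step (M : structure) f (rho : nat -> M) x :
  tr (x .: rho) (step f) <-> tr (su x .: rho) f.
Proof.
  rewrite step_sub, tr_sub.
  replace (su x .: rho) with
    (fun i => ev (x .: rho) ((Succ (Var 0) .: fun i => Var (S i)) i)); [reflexivity|].
  extensionality i; now destruct i.
Qed.

Lemma ev_closed (M : structure) n t (r r' : nat -> M) : closed_term n t ->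
  (forall i, i < n -> r i = r' i) -> ev r t = ev r' t.
Proof. intros H E; induction t; simpl in *; f_equal; intuition. Qed.

Lemma tr_closed (M : structure) f : forall n (r r' : nat -> M), closed_form n f ->
  (forall i, i < n -> r i = r' i) -> (tr r f <-> tr r' f).
Proof.
  induction f; simpl; intros n r r' H E;
    try (destruct H; erewrite (@ev_closed M n t), (@ev_closed M n u); eauto; reflexivity).
  - reflexivity.
  - destruct H. rewrite IHf1, IHf2; eauto. reflexivity.
  - assert (G : forall x, tr (x .: r) f <-> tr (x .: r') f).
    { intros x. eapply IHf; [exact H|]. intros [|i] Hi; simpl; auto. apply E; lia. }
    split; intros K x; apply G, K.
Qed.

(** * Completeness of the calculus *)

Lemma pair_inj a b c d : pair a b = pair c d -> a = c /\ b = d.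
Proof. unfold pair. intros H. assert (a + b = c + d) by nia. nia. Qed.

Lemma gn_term_inj t : forall u, gn_term t = gn_term u -> t = u.
Proof.
  induction t; destruct u; cbn [gn_term]; intros H; apply pair_inj in H as [H1 H2];
    try discriminate; try reflexivity; try apply pair_inj in H2 as [H2 H3]; f_equal; auto.
Qed.

Lemma gn_inj f : forall g, gn f = gn g -> f = g.
Proof.
  induction f; destruct g; cbn [gn]; intros H; apply pair_inj in H as [H1 H2];
    try discriminate; try reflexivity; try apply pair_inj in H2 as [H2 H3];
    f_equal; auto using gn_term_inj.
Qed.

Section Completeness.
Variable T : form -> Prop.
Local Notation pr := (provable T).

Lemma pr_id f : pr (Imp f f).
Proof.
  apply pr_mp with (f := Imp f (Imp f f)); [apply pr_logic, ax_K|].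
  apply pr_mp with (f := Imp f (Imp (Imp f f) f)); apply pr_logic; [apply ax_K|apply ax_S].
Qed.

(** The universal closure of a provable formula is a sentence, so substitution
    does not change it; its quantifiers are then removed one at a time, each with
    the term wanted for its variable. *)
Lemma pr_sub f : pr f -> forall s, pr (sub s f).
Proof.
  intros H.
  assert (E : forall n g, (forall s, pr (sub s (Nat.iter n All g))) ->
    forall s, pr (sub s g)).
  { induction n; simpl; intros g Hg; [exact Hg|].
    assert (E : Nat.iter n All (All g) = All (Nat.iter n All g)).
    { clear. induction n; simpl; congruence. }
    assert (K : forall s, pr (sub s (All g))) by (apply IHn; rewrite E; exact Hg).
    intros s. replace (sub s g) with (inst (s 0) (sub (up (fun i => s (S i))) g)).
    - eapply pr_mp; [apply (K (fun i => s (S i)))|]. apply pr_logic, ax_inst.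
    - rewrite inst_up_sub. f_equal. extensionality i; now destruct i. }
  apply (E (bound f)). intros s.
  assert (C : sentence (Nat.iter (bound f) All f)).
  { unfold sentence. generalize (boundP f). generalize (bound f) as n. intros n.
    replace (closed_form n f) with (closed_form (n + 0) f) by (f_equal; lia).
    generalize 0. induction n; simpl; auto. intros m Hm. apply IHn.
    replace (n + S m) with (S (n + m)) by lia. exact Hm. }
  rewrite sentence_sub by exact C.
  clear C. induction (bound f); simpl; auto using pr_gen.
Qed.

(** Generalization acts on theorems of T only, never on hypotheses: the free
    variables of hypotheses are constants, and the deduction theorem has no side
    condition. *)
Inductive ded (G : form -> Prop) : form -> Prop :=
| ded_pr f : pr f -> ded G f
| ded_hyp f : G f -> ded G f
| ded_mp f g : ded G f -> ded G (Imp f g) -> ded G g.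

Definition with_hyp (G : form -> Prop) (f : form) : form -> Prop := fun g => G g \/ g = f.

Lemma ded_imp G f g : ded (with_hyp G f) g -> ded G (Imp f g).
Proof.
  induction 1 as [g H|g [H| ->]|g h _ IH1 _ IH2].
  - eapply ded_mp; [apply ded_pr, H|]. apply ded_pr, pr_logic, ax_K.
  - eapply ded_mp; [apply ded_hyp, H|]. apply ded_pr, pr_logic, ax_K.
  - apply ded_pr, pr_id.
  - eapply ded_mp; [exact IH1|]. eapply ded_mp; [exact IH2|].
    apply ded_pr, pr_logic, ax_S.
Qed.

Lemma ded_mono (G G' : form -> Prop) f : (forall g, G g -> G' g) -> ded G f -> ded G' f.
Proof. intros H; induction 1; eauto using ded. Qed.

Lemma ded_dn G f : ded (with_hyp G (Neg f)) Bot -> ded G f.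
Proof.
  intros H. apply ded_imp in H. eapply ded_mp; [exact H|]. apply ded_pr, pr_logic, ax_DN.
Qed.

Lemma ded_explode G f : ded G Bot -> ded G f.
Proof. intros H. apply ded_dn. eapply ded_mono; [|exact H]. now left. Qed.

(** Replacing the fresh variable #n by a bound one turns each step of the
    derivation into a step between universal formulas. *)
Lemma ded_all_intro G n f : (forall g, G g -> closed_form n g) -> closed_form n (All f) ->
  ded G (inst (Var n) f) -> ded G (All f).
Proof.
  intros HG Hf H.
  (* the variable #n becomes #0, all others are shifted *)
  pose (s := fun i => if i =? n then Var 0 else Var (S i)).
  assert (E : forall g, ded G g -> ded G (All (sub s g))).
  { induction 1 as [g Hg|g Hg|g h _ IH1 _ IH2].
    - apply ded_pr, pr_gen, pr_sub, Hg.
    - eapply ded_mp; [apply ded_hyp, Hg|]. apply ded_pr, pr_logic.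
      replace (sub s g) with (shift g); [apply ax_vac|].
      rewrite shift_sub. apply sub_closed with (n := n); [auto|].
      intros i Hi. unfold s. destruct (Nat.eqb_spec i n); [lia|reflexivity].
    - eapply ded_mp; [exact IH1|]. eapply ded_mp; [exact IH2|].
      apply ded_pr, pr_logic, ax_dist. }
  apply E in H. replace (sub s (inst (Var n) f)) with f in H; [exact H|].
  rewrite inst_sub, sub_comp. rewrite <- (sub_id f) at 1.
  apply sub_closed with (n := S n); [exact Hf|].
  intros [|i] Hi; simpl; unfold s; [now rewrite Nat.eqb_refl|].
  destruct (Nat.eqb_spec i n); [lia|reflexivity].
Qed.

Variable phi : form.
Hypothesis unprovable : ~ pr phi.

Definition listed (l : list form) : form -> Prop := fun f => In f l.
Definition consistent (l : list form) : Prop := ~ ded (listed l) Bot.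

Definition enum (n : nat) : form :=
  epsilon (inhabits Bot) (fun f => gn f = n).

Lemma enum_gn f : enum (gn f) = f.
Proof. apply gn_inj. unfold enum. apply epsilon_spec. now exists f. Qed.

(** Free variables serve as Henkin constants: when a universal formula is
    refuted, a fresh variable is made a counterexample. *)
Definition witness (l : list form) (f : form) : form :=
  match f with
  | All g => Neg (inst (Var (max (bound f) (list_max (map bound l)))) g)
  | _ => Neg f
  end.

Fixpoint stage (n : nat) : list form :=
  match n with
  | 0 => [Neg phi]
  | S n =>
      let l := stage n in let f := enum n in
      (if excluded_middle_informative (consistent (f :: l)) then f else witness l f) :: l
  end.

Lemma ded_cons_imp l f g : ded (listed (f :: l)) g -> ded (listed l) (Imp f g).
Proof.
  intros H. apply ded_imp. eapply ded_mono; [|exact H].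
  intros h [-> | Hh]; [now right|now left].
Qed.

Lemma listed_bound l g m : listed l g -> list_max (map bound l) <= m -> closed_form m g.
Proof.
  intros Hg Hm. eapply closed_mono; [|apply boundP].
  etransitivity; [|exact Hm].
  assert (H := proj1 (list_max_le (map bound l) _) (Nat.le_refl _)).
  rewrite Forall_forall in H. apply H, in_map, Hg.
Qed.

Lemma consistent_witness l f : consistent l -> ~ consistent (f :: l) ->
  consistent (witness l f :: l).
Proof.
  intros Hl Hf. apply NNPP in Hf. apply ded_cons_imp in Hf.
  assert (E : consistent (Neg f :: l)).
  { intros H. apply ded_cons_imp in H. apply Hl. eapply ded_mp; [exact Hf|exact H]. }
  destruct f; try exact E. clear E. intros H. apply Hl. eapply ded_mp; [|exact Hf].
  unfold witness in H.
  set (m := max (bound (All f)) (list_max (map bound l))) in *.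
  apply ded_all_intro with (n := m).
  - intros g Hg. eapply listed_bound; [exact Hg|]. lia.
  - eapply closed_mono; [|apply boundP]. lia.
  - apply ded_cons_imp in H. eapply ded_mp; [exact H|]. apply ded_pr, pr_logic, ax_DN.
Qed.

Lemma stage_consistent n : consistent (stage n).
Proof.
  induction n; cbn [stage].
  - intros H. apply unprovable.
    assert (K : ded (fun _ => False) phi).
    { apply ded_dn. eapply ded_mono; [|exact H]. intros g [<- | []]. now right. }
    clear H. revert K. generalize phi. intros p K. induction K as [p H|p []|]; [exact H|].
    eapply pr_mp; [exact IHK1|exact IHK2].
  - destruct (excluded_middle_informative (consistent (enum n :: stage n))); auto.
    apply consistent_witness; assumption.
Qed.

Definition limit (f : form) : Prop := exists n, In f (stage n).
Definition thm (f : form) : Prop := ded limit f.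

Lemma stage_mono n m f : n <= m -> In f (stage n) -> In f (stage m).
Proof. induction 1; auto. intros H1. right. auto. Qed.

Lemma thm_stage f : thm f -> exists n, ded (listed (stage n)) f.
Proof.
  induction 1 as [f H|f [n H]|f g _ [n IH1] _ [m IH2]].
  - exists 0. now apply ded_pr.
  - exists n. now apply ded_hyp.
  - exists (max n m).
    eapply ded_mp; (eapply ded_mono; [|first [exact IH1|exact IH2]]);
      intros h; apply stage_mono; lia.
Qed.

Lemma thm_consistent : ~ thm Bot.
Proof. intros H. apply thm_stage in H as [n H]. exact (stage_consistent H). Qed.

Lemma thm_complete f : thm f \/ thm (Neg f) /\
  forall g, f = All g -> exists i, thm (Neg (inst (Var i) g)).
Proof.
  assert (E : limit (if excluded_middle_informative (consistent (f :: stage (gn f)))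
                     then f else witness (stage (gn f)) f)).
  { exists (S (gn f)). cbn [stage]. rewrite enum_gn. now left. }
  destruct (excluded_middle_informative _) as [H|H].
  - left. apply ded_hyp, E.
  - right. apply NNPP in H. apply ded_cons_imp in H. split.
    + eapply ded_mono; [|exact H]. intros g Hg. exists (gn f). exact Hg.
    + intros g ->. eexists. apply ded_hyp, E.
Qed.

Lemma thm_imp f g : (thm f -> thm g) -> thm (Imp f g).
Proof.
  intros H. apply ded_imp. destruct (thm_complete f) as [Hf|[Hf _]].
  - eapply ded_mono; [|exact (H Hf)]. now left.
  - apply ded_explode. eapply ded_mp; [apply ded_hyp; now right|].
    eapply ded_mono; [|exact Hf]. now left.
Qed.

Lemma thm_all f : (forall t, thm (inst t f)) -> thm (All f).
Proof.
  intros H. destruct (thm_complete (All f)) as [Hf|[_ Hf]]; [exact Hf|].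
  destruct (Hf f eq_refl) as [i Hi]. exfalso. apply thm_consistent.
  eapply ded_mp; [apply (H (Var i))|exact Hi].
Qed.

Lemma thm_inst f t : thm (All f) -> thm (inst t f).
Proof. intros H. eapply ded_mp; [exact H|]. apply ded_pr, pr_logic, ax_inst. Qed.

Definition teq (t u : term) : Prop := thm (Equ t u).

Lemma teq_refl t : teq t t.
Proof. apply ded_pr, pr_logic, ax_refl. Qed.

Lemma teq_subst t u f : teq t u -> thm (inst t f) -> thm (inst u f).
Proof.
  intros H Hf. eapply ded_mp; [exact Hf|]. eapply ded_mp; [exact H|].
  apply ded_pr, pr_logic, ax_leibniz.
Qed.

Local Notation lift t := (map_term (fun i => Var (S i)) t).

Lemma inst_lift u t : map_term (u .: Var) (lift t) = t.
Proof. rewrite map_term_comp. apply map_term_id. Qed.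

Lemma teq_sym t u : teq t u -> teq u t.
Proof.
  intros H. pose proof (@teq_subst t u (Equ (Var 0) (lift t)) H) as K.
  rewrite !inst_sub in K. cbn [sub map_term push] in K. rewrite !inst_lift in K.
  apply K, teq_refl.
Qed.

Lemma teq_trans t u v : teq t u -> teq u v -> teq t v.
Proof.
  intros H H'. pose proof (@teq_subst u v (Equ (lift t) (Var 0)) H') as K.
  rewrite !inst_sub in K. cbn [sub map_term push] in K. rewrite !inst_lift in K. exact (K H).
Qed.

(** Equivalence classes are represented by their characteristic predicates, so
    that provably equal terms become equal elements. *)
Definition tclass : Type := { P : term -> Prop | exists t, P = teq t }.
Definition cls (t : term) : tclass := exist _ (teq t) (ex_intro _ t eq_refl).

Lemma cls_eq t u : cls t = cls u <-> teq t u.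
Proof.
  split; intros H.
  - apply (f_equal (@proj1_sig _ _)) in H. simpl in H. rewrite H. apply teq_refl.
  - apply subset_eq_compat. extensionality v. apply propositional_extensionality.
    split; intros K; [eapply teq_trans; [apply teq_sym, H|exact K]
                     |eapply teq_trans; [exact H|exact K]].
Qed.

Lemma cls_rep (x : tclass) : exists t, cls t = x.
Proof. destruct x as [P [t ->]]. exists t. reflexivity. Qed.

Definition rep (x : tclass) : term := epsilon (inhabits Zero) (fun t => cls t = x).

Lemma repK x : cls (rep x) = x.
Proof. unfold rep. apply epsilon_spec, cls_rep. Qed.

Lemma rep_cls t : teq (rep (cls t)) t.
Proof. apply cls_eq, repK. Qed.

Definition henkin : structure := {|
  carrier := tclass;
  ze := cls Zero;
  su x := cls (Succ (rep x));
  ad x y := cls (Add (rep x) (rep y));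
  mu x y := cls (Mul (rep x) (rep y));
  lt x y := thm (Less (rep x) (rep y)) |}.


Lemma cls_su t : cls (Succ (rep (cls t))) = cls (Succ t).
Proof.
  apply cls_eq. pose proof (@teq_subst _ _ (Equ (Succ (Var 0)) (Succ (lift t)))
    (teq_sym (rep_cls t))) as K.
  rewrite !inst_sub in K. cbn [sub map_term push] in K. rewrite !inst_lift in K.
  apply K, teq_refl.
Qed.

Lemma teq_cong2 (c : term -> term -> term) t t' u u' :
  (forall s a b, map_term s (c a b) = c (map_term s a) (map_term s b)) ->
  teq t t' -> teq u u' -> teq (c t u) (c t' u').
Proof.
  intros Hc Ht Hu.
  pose proof (@teq_subst _ _ (Equ (lift (c t u)) (c (Var 0) (lift u))) Ht) as K.
  pose proof (@teq_subst _ _ (Equ (lift (c t u)) (c (lift t') (Var 0))) Hu) as K'.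
  rewrite !inst_sub in K, K'. cbn [sub] in K, K'.
  rewrite !Hc in K, K'. cbn [map_term push] in K, K'. rewrite !inst_lift in K. rewrite !inst_lift in K'.
  apply K', K, teq_refl.
Qed.

Lemma thm_less t t' u u' : teq t t' -> teq u u' -> thm (Less t u) -> thm (Less t' u').
Proof.
  intros Ht Hu H.
  pose proof (@teq_subst _ _ (Less (Var 0) (lift u)) Ht) as K.
  pose proof (@teq_subst _ _ (Less (lift t') (Var 0)) Hu) as K'.
  rewrite !inst_sub in K, K'. cbn [sub map_term push] in K, K'.
  rewrite !inst_lift in K. rewrite !inst_lift in K'. auto.
Qed.

Lemma henkin_ev (s : nat -> term) t : @ev henkin (fun i => cls (s i)) t = cls (map_term s t).
Proof.
  induction t; cbn [ev map_term]; rewrite ?IHt, ?IHt1, ?IHt2; try reflexivity.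
  - apply cls_su.
  - apply cls_eq, (@teq_cong2 Add); auto using rep_cls.
  - apply cls_eq, (@teq_cong2 Mul); auto using rep_cls.
Qed.

Lemma henkin_truth f : forall s, @tr henkin (fun i => cls (s i)) f <-> thm (sub s f).
Proof.
  induction f; intros s; cbn [tr sub].
  - rewrite !henkin_ev. apply cls_eq.
  - rewrite !henkin_ev. simpl.
    split; apply thm_less; auto using rep_cls, teq_sym.
  - split; [tauto|apply thm_consistent].
  - rewrite IHf1, IHf2. split; [apply thm_imp|].
    intros H K. eapply ded_mp; eassumption.
  - assert (E : forall t, @tr henkin (cls t .: fun i => cls (s i)) f <->
                          thm (inst t (sub (up s) f))).
    { intros t. rewrite inst_up_sub, <- IHf.
      replace (fun i => cls ((t .: s) i)) with (cls t .: fun i => cls (s i));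
        [reflexivity|]. extensionality i; now destruct i. }
    split.
    + intros H. apply thm_all. intros t. apply E, H.
    + intros H x. destruct (cls_rep x) as [t <-]. apply E, thm_inst, H.
Qed.

Lemma henkin_model f (rho : nat -> henkin) : T f -> tr rho f.
Proof.
  intros H. replace rho with (fun i => cls (rep (rho i))).
  - apply henkin_truth. apply ded_pr, pr_sub, pr_axiom, H.
  - extensionality i. apply repK.
Qed.

Lemma henkin_refutes : ~ @tr henkin (fun i => cls (Var i)) phi.
Proof.
  rewrite henkin_truth, sub_id. intros H. apply thm_consistent.
  eapply ded_mp; [exact H|]. apply ded_hyp. exists 0. now left.
Qed.

End Completeness.

(** If [phi] is not provable, the term model of a complete theory with witnesses
    that contains its negation satisfies T and refutes [phi]. *)
Theorem completeness (T : form -> Prop) (phi : form) :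
  (forall (M : structure) (rho : nat -> M),
     (forall f r, T f -> @tr M r f) -> tr rho phi) ->
  provable T phi.
Proof.
  intros H. apply NNPP. intros N.
  apply (henkin_refutes N). apply H. intros f r Hf. now apply henkin_model.
Qed.

(** * The meaning of formulas written with Rocq binders *)

Section Meaning.
Variable M : structure.

Definition std (n : nat) : M := Nat.iter n su ze.
Definition pr2 (x y : M) : M := ad (mu (ad x y) (ad x y)) x.

(** The terms and formulas written with binders are functions of the number of
    variables in scope.  A world is such a number with values for the variables;
    it becomes later when a quantifier binds a new variable.  A term denotes x,
    and a formula means a proposition, when this persists in all later worlds:
    the meaning of a formula is then computed by structural rules, in which a
    bound variable is any term that denotes the element quantified over. *)
Definition world : Type := (nat * (nat -> M))%type.

Inductive later (w : world) : world -> Prop :=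
| later_refl : later w w
| later_push d r x : later w (d, r) -> later w (S d, x .: r).

Lemma later_trans u v w : later u v -> later v w -> later u w.
Proof. intros H K; revert H; induction K; eauto using later. Qed.

Definition den (w : world) (t : tm) (x : M) : Prop :=
  forall v, later w v -> ev (snd v) (t (fst v)) = x.
Definition means (w : world) (f : fm) (A : Prop) : Prop :=
  forall v, later w v -> (tr (snd v) (f (fst v)) <-> A).
Definition means1 (w : world) (f : tm -> fm) (P : M -> Prop) : Prop :=
  forall v t x, later w v -> den v t x -> means v (f t) (P x).
Definition means2 (w : world) (f : tm -> tm -> fm) (P : M -> M -> Prop) : Prop :=
  forall v t x, later w v -> den v t x -> means1 v (f t) (P x).
Definition means3 (w : world) (f : tm -> tm -> tm -> fm) (P : M -> M -> M -> Prop) : Prop :=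
  forall v t x, later w v -> den v t x -> means2 v (f t) (P x).
Definition means_rule (w : world) (f : tm -> (tm -> fm) -> fm)
  (R : M -> (M -> Prop) -> Prop) : Prop :=
  forall v t x D E, later w v -> den v t x -> means1 v D E -> means v (f t D) (R x E).

Section Mono.
Variables v w : world.
Hypothesis H : later v w.
Lemma den_later t x : den v t x -> den w t x.
Proof. intros K u L; eauto using later_trans. Qed.
Lemma means_later f A : means v f A -> means w f A.
Proof. intros K u L; eauto using later_trans. Qed.
Lemma means1_later f A : means1 v f A -> means1 w f A.
Proof. intros K u t x L; eauto using later_trans. Qed.
Lemma means2_later f A : means2 v f A -> means2 w f A.
Proof. intros K u t x L; eauto using later_trans. Qed.
Lemma means3_later f A : means3 v f A -> means3 w f A.
Proof. intros K u t x L; eauto using later_trans. Qed.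
Lemma means_rule_later f A : means_rule v f A -> means_rule w f A.
Proof. intros K u t x D E L; eauto using later_trans. Qed.
End Mono.

Lemma means1_app w f P t x : means1 w f P -> den w t x -> means w (f t) (P x).
Proof. intros H; apply H, later_refl. Qed.
Lemma means2_app w f P t x u y :
  means2 w f P -> den w t x -> den w u y -> means w (f t u) (P x y).
Proof. intros H K; apply (H _ _ _ (later_refl _) K), later_refl. Qed.
Lemma means3_app w f P t x u y s z :
  means3 w f P -> den w t x -> den w u y -> den w s z -> means w (f t u s) (P x y z).
Proof. intros H K; apply means2_app, (H _ _ _ (later_refl _) K). Qed.
Lemma means_rule_app w f R t x D E :
  means_rule w f R -> den w t x -> means1 w D E -> means w (f t D) (R x E).
Proof. intros H; apply H, later_refl. Qed.

Lemma ev_num (r : nat -> M) n : ev r (num n) = std n.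
Proof. induction n; simpl; congruence. Qed.

Lemma den_num w n : den w (hnum n) (std n).
Proof. intros v _. apply ev_num. Qed.
Lemma den_ze w : den w (hnum 0) ze.
Proof. apply den_num. Qed.
Lemma den_su w t x : den w t x -> den w (hsucc t) (su x).
Proof. intros H v L. simpl. now rewrite H. Qed.
Lemma den_ad w t x u y : den w t x -> den w u y -> den w (hadd t u) (ad x y).
Proof. intros H K v L. simpl. now rewrite H, K. Qed.
Lemma den_mu w t x u y : den w t x -> den w u y -> den w (hmul t u) (mu x y).
Proof. intros H K v L. simpl. now rewrite H, K. Qed.
Lemma den_pr2 w t x u y : den w t x -> den w u y -> den w (hpair t u) (pr2 x y).
Proof. intros H K. unfold pr2, hpair. auto using den_ad, den_mu. Qed.

Lemma den_level d (r : nat -> M) l : l < d -> den (d, r) (level l) (r (d - S l)).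
Proof.
  intros Hl v L. unfold level.
  enough (E : l < fst v /\ snd v (fst v - S l) = r (d - S l)) by apply E.
  induction L as [|d' r' y L [IH1 IH2]]; [now split|].
  simpl in *. split; [lia|]. replace (d' - l) with (S (d' - S l)) by lia. exact IH2.
Qed.

Lemma den_last d (r : nat -> M) x : den (S d, x .: r) (level d) x.
Proof.
  replace x with ((x .: r) (S d - S d)) at 2 by now rewrite Nat.sub_diag.
  apply den_level. lia.
Qed.

Lemma means_iff w f A B : (A <-> B) -> means w f A -> means w f B.
Proof. intros E H v L. rewrite <- E. auto. Qed.
Lemma means_equ w t x u y : den w t x -> den w u y -> means w (hequ t u) (x = y).
Proof. intros H K v L. simpl. rewrite H, K; tauto. Qed.
Lemma means_less w t x u y : den w t x -> den w u y -> means w (hless t u) (lt x y).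
Proof. intros H K v L. simpl. rewrite H, K; tauto. Qed.
Lemma means_bot w : means w hbot False.
Proof. intros v L. simpl. tauto. Qed.
Lemma means_imp w f A g B : means w f A -> means w g B -> means w (himp f g) (A -> B).
Proof. intros H K v L. simpl. rewrite (H v L), (K v L). tauto. Qed.
Lemma means_neg w f A : means w f A -> means w (hneg f) (~ A).
Proof. intros H v L. simpl. rewrite (H v L). tauto. Qed.
Lemma means_and w f A g B : means w f A -> means w g B -> means w (hand f g) (A /\ B).
Proof. intros H K v L. simpl. rewrite (H v L), (K v L). tauto. Qed.
Lemma means_or w f A g B : means w f A -> means w g B -> means w (hor f g) (A \/ B).
Proof. intros H K v L. simpl. rewrite (H v L), (K v L). tauto. Qed.
Lemma means_eqv w f A g B : means w f A -> means w g B -> means w (hiff f g) (A <-> B).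
Proof. intros H K v L. simpl. rewrite (H v L), (K v L). tauto. Qed.
Lemma means_all w f P : means1 w f P -> means w (hall f) (forall x, P x).
Proof.
  intros H [d r] L. simpl.
  assert (E : forall x, tr (x .: r) (f (level d) (S d)) <-> P x).
  { intros x. refine (H (S d, x .: r) _ _ (later_push _ L) _ _ (later_refl _)).
    apply den_last. }
  split; intros K x; apply E, K.
Qed.
Lemma means_ex w f P : means1 w f P -> means w (hex f) (exists x, P x).
Proof.
  intros H v L.
  assert (K : means w (fun d => Neg (hall (fun x => hneg (f x)) d))
              (~ forall x, ~ P x)).
  { apply means_neg with (f := hall (fun x => hneg (f x))), means_all.
    intros u t x L' Ht. apply means_neg, H; assumption. }
  specialize (K v L). change (tr (snd v) (hex f (fst v)) <-> ~ (forall x, ~ P x)) in K.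
  rewrite K. split.
  - intros N. apply NNPP. intros C. apply N. intros x Hx. apply C. now exists x.
  - intros [x Hx] N. exact (N x Hx).
Qed.

(** A formula with de Bruijn variables, made usable under the binders above: the
    term for #i is the i-th of the list. *)
Definition hform (f : form) (ts : list tm) : fm :=
  fun d => sub (fun i => nth i ts (hnum 0) d) f.

Lemma means_hform w f ts xs :
  Forall2 (den w) ts xs -> means w (hform f ts) (tr (fun i => nth i xs ze) f).
Proof.
  intros H v L. unfold hform. rewrite tr_sub.
  replace (fun i => ev (snd v) (nth i ts (hnum 0) (fst v))) with (fun i => nth i xs ze);
    [tauto|].
  extensionality i. revert i. induction H; intros [|i]; simpl; auto.
  symmetry; auto.
Qed.

(** The parameters are the values of the variables of the world. *)
Definition definable (P : M -> Prop) : Prop := exists w f, means1 w f P.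

Lemma name_param (w : world) (x : M) : exists v t, later w v /\ den v t x.
Proof.
  destruct w as [d r]. exists (S d, x .: r), (level d). split.
  - apply later_push, later_refl.
  - apply den_last.
Qed.

Lemma definable_form P : definable P -> exists r f, forall x, tr (x .: r) f <-> P x.
Proof.
  intros [[d r] [f H]]. exists r, (f (level d) (S d)). intros x.
  refine (H (S d, x .: r) _ _ (later_push _ (later_refl _)) _ _ (later_refl _)).
  apply den_last.
Qed.

End Meaning.

Arguments std {M}.
Arguments pr2 {M}.

(* Hypotheses about [v] are replaced by the same ones about the later [w]. *)
Ltac lift L :=
  match type of L with
  | later ?v ?w =>
    repeat match goal with
    | H : den v _ _ |- _ => apply (den_later L) in H
    | H : means v _ _ |- _ => apply (means_later L) in H
    | H : means1 v _ _ |- _ => apply (means1_later L) in H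
    | H : means2 v _ _ |- _ => apply (means2_later L) in H
    | H : means3 v _ _ |- _ => apply (means3_later L) in H
    | H : means_rule v _ _ |- _ => apply (means_rule_later L) in H
    end; clear L
  end.

(* The rules for defined notions, to be extended as they are introduced. *)
Ltac means_base := fail.

(* The rule is chosen by the shape of the proposition, so the same tactic finds
   the meaning of a given formula, and a formula for a given meaning. *)
Ltac means_step :=
  match goal with
  | |- den _ _ _ => first
      [ eassumption | simple eapply den_num | simple eapply den_ze
      | simple eapply den_su | simple eapply den_ad | simple eapply den_mu
      | refine (den_pr2 _ _) ]
  | |- means1 _ _ _ => first [ eassumption |
      let v := fresh "v" in let t := fresh "t" in let x := fresh "x" in
      let L := fresh "L" in let H := fresh "H" in
      intros v t x L H; lift L; cbv beta ]
  | |- means2 _ _ _ => first [ eassumption |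
      let v := fresh "v" in let t := fresh "t" in let x := fresh "x" in
      let L := fresh "L" in let H := fresh "H" in
      intros v t x L H; lift L; cbv beta ]
  | |- means3 _ _ _ => first [ eassumption |
      let v := fresh "v" in let t := fresh "t" in let x := fresh "x" in
      let L := fresh "L" in let H := fresh "H" in
      intros v t x L H; lift L; cbv beta ]
  | |- means_rule _ _ _ => first [ eassumption |
      let v := fresh "v" in let t := fresh "t" in let x := fresh "x" in
      let D := fresh "D" in let E := fresh "E" in
      let L := fresh "L" in let H := fresh "H" in let K := fresh "K" in
      intros v t x D E L H K; lift L; cbv beta ]
  | |- means _ _ _ => first
      [ eassumption
      | means_base
      | match goal with
        | |- means _ _ (~ _) => refine (means_neg _)
        | |- means _ _ (_ /\ _) => refine (means_and _ _)
        | |- means _ _ (_ \/ _) => refine (means_or _ _)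
        | |- means _ _ (_ <-> _) => refine (means_eqv _ _)
        | |- means _ _ False => refine (@means_bot _ _)
        | |- means _ _ (_ = _) => refine (means_equ _ _)
        | |- means _ _ (lt _ _) => refine (means_less _ _)
        | |- means _ _ (ex _) => refine (means_ex _)
        | |- means _ _ (_ -> _) => refine (means_imp _ _)
        | |- means _ _ (forall x, _) => refine (means_all _)
        | H : means1 _ ?f ?P |- means _ _ (?P _) => refine (means1_app H _)
        | H : means2 _ ?f ?P |- means _ _ (?P _ _) => refine (means2_app H _ _)
        | H : means3 _ ?f ?P |- means _ _ (?P _ _ _) => refine (means3_app H _ _ _)
        | H : means_rule _ ?f ?R |- means _ _ (?R _ _) => refine (means_rule_app H _ _)
        end ]
  end.
Ltac means := repeat means_step.

(* The arguments are the elements which the predicate has as parameters: each of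
   them becomes the value of a new variable. *)
Ltac defn_start w :=
  match goal with |- @definable ?M _ => pose (w := (0, fun _ : nat => @ze M) : world M) end.
Ltac defn_param w p :=
  let v := fresh "w" in let t := fresh "t" in
  let L := fresh "L" in let H := fresh "H" in
  destruct (name_param w p) as [v [t [L H]]]; lift L; try clear w;
  rename v into w.
Ltac defn_end w := exists w; eexists; means.
Tactic Notation "defn" :=
  let w := fresh "w" in defn_start w; defn_end w.
Tactic Notation "defn" constr(a) :=
  let w := fresh "w" in defn_start w; defn_param w a; defn_end w.
Tactic Notation "defn" constr(a) "," constr(b) :=
  let w := fresh "w" in defn_start w; defn_param w a; defn_param w b; defn_end w.

(** * Arithmetic in a model of PA *)

Record model : Type := Model {
  str :> structure;
  str_PA : forall f (r : nat -> str), PA f -> tr r f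
}.

(** To derive a formula in an extension of PA, one argues in the models of PA. *)
Lemma model_completeness (T : form -> Prop) f : (forall g, PA g -> T g) ->
  (forall (M : model) (r : nat -> M), (forall g s, T g -> @tr M s g) -> tr r f) ->
  provable T f.
Proof.
  intros HT H. apply completeness. intros S r HS.
  exact (H (@Model S (fun g s Hg => HS g s (HT g Hg))) r HS).
Qed.

Declare Scope m_scope.
Delimit Scope m_scope with m.
Notation "x + y" := (ad x y) : m_scope.
Notation "x * y" := (mu x y) : m_scope.
Notation "x < y" := (lt x y) : m_scope.
Notation "x <= y" := (lt x (su y)) : m_scope.
Notation "⟪ x , .. , y , z ⟫" := (pr2 x .. (pr2 y z) ..) (at level 0) : m_scope.

Section Arithmetic.
Variable M : model.
Implicit Types x y z u v w a b c d m n q r i j k : M.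
Local Open Scope m_scope.

Lemma ind (P : M -> Prop) : definable P -> P ze -> (forall x, P x -> P (su x)) ->
  forall x, P x.
Proof.
  intros D H0 HS. destruct (definable_form D) as (r & f & E).
  pose proof (@str_PA M (induction f) r (PA_induction f)) as H.
  simpl in H. rewrite tr_inst in H.
  intros x. apply E, H.
  - apply E, H0.
  - intros y Hy. apply tr_step, E, HS, E, Hy.
Qed.

Local Ltac base k := 
  match goal with |- ?G =>
  let f := eval cbv in (nth k PA_base Bot) in
  let H := fresh in
  assert (H : forall r : nat -> M, tr r f);
  [ intros r; apply str_PA; apply PA_of_base; do 10 (try (left; reflexivity); right) | simpl in H ]
  end.

Lemma su_ne0 x : su x <> ze.
Proof. base 0. exact (H (fun _ => x)). Qed.
Lemma su_inj x y : su x = su y -> x = y.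
Proof. base 1. exact (H (x .: fun _ => y)). Qed.
Lemma ad0 x : x + ze = x.
Proof. base 2. exact (H (fun _ => x)). Qed.
Lemma adS x y : x + su y = su (x + y).
Proof. base 3. exact (H (x .: fun _ => y)). Qed.
Lemma mu0 x : x * ze = ze.
Proof. base 4. exact (H (fun _ => x)). Qed.
Lemma muS x y : x * su y = x * y + x.
Proof. base 5. exact (H (x .: fun _ => y)). Qed.
Lemma lt_ex x y : x < y <-> exists z, x + su z = y.
Proof.
  base 6. specialize (H (x .: fun _ => y)). simpl in H.
  split.
  - intros L. apply NNPP. intros N. apply H. intros H1 H2. apply (H1 L).
    intros z Hz. apply N. now exists z.
  - intros [z Hz]. apply NNPP. intros N. apply H. intros H1 H2.
    apply N, H2. intros K. exact (K z Hz).
Qed.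

Lemma ad0l x : ze + x = x.
Proof.
  revert x; apply ind; [defn|apply ad0|]. intros x H. now rewrite adS, H.
Qed.
Lemma adSl x y : su x + y = su (x + y).
Proof.
  revert y; apply ind; [defn x|now rewrite !ad0|]. intros y H. now rewrite !adS, H.
Qed.
Lemma ad_comm x y : x + y = y + x.
Proof.
  revert y; apply ind; [defn x|now rewrite ad0, ad0l|].
  intros y H. now rewrite adS, adSl, H.
Qed.
Lemma ad_assoc x y z : x + (y + z) = (x + y) + z.
Proof.
  revert z; apply ind; [defn x, y|now rewrite !ad0|].
  intros z H. now rewrite !adS, H.
Qed.
Lemma mu0l x : ze * x = ze.
Proof.
  revert x; apply ind; [defn|apply mu0|]. intros x H. now rewrite muS, H, ad0.
Qed.
Lemma muSl x y : su x * y = x * y + y.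
Proof.
  revert y; apply ind; [defn x|now rewrite !mu0, ad0|].
  intros y H. rewrite !muS, H, !adS. f_equal.
  rewrite <- !ad_assoc. f_equal. apply ad_comm.
Qed.
Lemma mu_comm x y : x * y = y * x.
Proof.
  revert y; apply ind; [defn x|now rewrite mu0, mu0l|].
  intros y H. now rewrite muS, muSl, H.
Qed.
Lemma mu_distr x y z : (x + y) * z = x * z + y * z.
Proof.
  revert z; apply ind; [defn x, y|now rewrite !mu0, ad0|].
  intros z H. rewrite !muS, H, <- !ad_assoc. f_equal.
  rewrite !ad_assoc. f_equal. apply ad_comm.
Qed.
Lemma mu_assoc x y z : x * (y * z) = (x * y) * z.
Proof.
  revert z; apply ind; [defn x, y|now rewrite !mu0|].
  intros z H. rewrite !muS, (mu_comm x), mu_distr, <- H, (mu_comm x y).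
  f_equal. apply mu_comm.
Qed.
Lemma mu1l x : su ze * x = x.
Proof. now rewrite muSl, mu0l, ad0l. Qed.

Lemma model_ring : semi_ring_theory (@ze M) (su ze) ad mu (@eq M).
Proof.
  constructor; auto using ad0l, ad_comm, ad_assoc, mu1l, mu0l, mu_comm, mu_assoc, mu_distr.
Qed.
Lemma su1 x : su x = x + su ze.
Proof. now rewrite adS, ad0. Qed.
Add Ring model_ring : model_ring.

End Arithmetic.

(* The semiring tactic knows addition but no successor function. *)
Ltac expand_su := 
  repeat match goal with
  | |- context [su ?x] => lazymatch x with ze => fail | _ => rewrite (su1 x) end
  end.
Ltac sring := expand_su; ring.

Section Order.
Variable M : model.
Implicit Types x y z u v w a b c d m n q r i j k : M.
Local Open Scope m_scope.
Add Ring model_ring1 : (model_ring M).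

Lemma cases x : x = ze \/ exists y, x = su y.
Proof.
  revert x; apply ind; [defn|now left|]. intros x _. right. now exists x.
Qed.
Lemma ad_cancel x y z : x + z = y + z -> x = y.
Proof.
  revert z. apply (@ind M (fun z => x + z = y + z -> x = y)); [defn x, y| |].
  - now rewrite !ad0.
  - intros z H. rewrite !adS. intros K. apply su_inj in K. auto.
Qed.
Lemma lt_0 x : ~ x < ze.
Proof. rewrite lt_ex. intros [z H]. rewrite adS in H. now apply su_ne0 in H. Qed.
Lemma le_ex x y : x <= y <-> exists z, x + z = y.
Proof.
  rewrite lt_ex. split; intros [z H]; exists z.
  - rewrite adS in H. now apply su_inj.
  - now rewrite adS, H.
Qed.
Lemma lt_irrefl x : ~ x < x.
Proof.
  rewrite lt_ex. intros [z H].
  apply (@su_ne0 M z). apply ad_cancel with x. rewrite ad0l, ad_comm. exact H.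
Qed.
Lemma lt_trans x y z : x < y -> y < z -> x < z.
Proof.
  rewrite !lt_ex. intros [u <-] [v <-]. exists (u + su v). sring.
Qed.
Lemma lt_su_iff x y : x < su y <-> x < y \/ x = y.
Proof.
  rewrite le_ex, lt_ex. split.
  - intros [z <-]. destruct (cases z) as [->|[u ->]]; [right; now rewrite ad0|].
    left. now exists u.
  - intros [[z <-]| ->]; [now exists (su z)|]. exists ze. apply ad0.
Qed.
Lemma lt_su x : x < su x.
Proof. apply lt_su_iff. now right. Qed.
Lemma le_refl x : x <= x.
Proof. apply lt_su. Qed.
Lemma lt_le x y : x < y -> x <= y.
Proof. intros H. apply lt_su_iff. now left. Qed.
Lemma lt_le_trans x y z : x < y -> y <= z -> x < z.
Proof. intros H [K | ->]%lt_su_iff; eauto using lt_trans. Qed.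
Lemma le_lt_trans x y z : x <= y -> y < z -> x < z.
Proof. intros [K | ->]%lt_su_iff H; eauto using lt_trans. Qed.
Lemma le_trans x y z : x <= y -> y <= z -> x <= z.
Proof. intros H K. eapply le_lt_trans; eassumption. Qed.
Lemma lt_total x y : x < y \/ x = y \/ y < x.
Proof.
  revert x. apply (@ind M (fun x => x < y \/ x = y \/ y < x)); [defn y| |].
  - destruct (cases y) as [->|[z ->]]; [now right; left|].
    left. rewrite lt_ex. exists z. apply ad0l.
  - intros x [H|[->|H]].
    + rewrite lt_ex in H. destruct H as [z <-].
      destruct (cases z) as [->|[u ->]]; [right; left; now rewrite adS, ad0|].
      left. rewrite lt_ex. exists u. sring.
    + right; right. apply lt_su.
    + right; right. apply lt_le, H.
Qed.
Lemma not_lt x y : ~ x < y <-> y <= x.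
Proof.
  split.
  - intros H. rewrite lt_su_iff. destruct (lt_total x y) as [|[->|]]; tauto.
  - intros H K. apply (@lt_irrefl x). eapply lt_le_trans; eassumption.
Qed.
Lemma lt_asym x y : x < y -> ~ y < x.
Proof. intros H K. apply (@lt_irrefl x). eapply lt_trans; eassumption. Qed.
Lemma le_0 x : ze <= x.
Proof. apply le_ex. exists x. apply ad0l. Qed.
Lemma su_lt x y : su x < su y <-> x < y.
Proof.
  rewrite lt_su_iff. split.
  - intros [H| <-]; [|apply lt_su]. eapply lt_trans; [apply lt_su|exact H].
  - intros H. apply lt_su_iff. rewrite <- not_lt. intros K.
    apply (@lt_irrefl x). eapply lt_le_trans; eassumption.
Qed.
Lemma le_ad x y : x <= x + y.
Proof. apply le_ex. now exists y. Qed.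
Lemma le_adl x y : x <= y + x.
Proof. rewrite ad_comm. apply le_ad. Qed.
Lemma lt_ad x y : x < x + su y.
Proof. apply lt_ex. now exists y. Qed.
Lemma ad_lt x y z : x + z < y + z <-> x < y.
Proof.
  rewrite !lt_ex. split; intros [u H]; exists u.
  - apply ad_cancel with z. rewrite <- H. sring.
  - rewrite <- H. sring.
Qed.
Lemma le_mu x y : y <> ze -> x <= x * y.
Proof.
  intros H. destruct (cases y) as [->|[z ->]]; [easy|].
  apply le_ex. exists (x * z). sring.
Qed.

Lemma strong_ind (P : M -> Prop) : definable P ->
  (forall x, (forall y, y < x -> P y) -> P x) -> forall x, P x.
Proof.
  intros D H.
  assert (K : forall x y, y < x -> P y).
  { apply (@ind M (fun x => forall y, y < x -> P y)).
    - destruct D as (w & f & D). exists w. eexists. means.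
    - intros y Hy. now apply lt_0 in Hy.
    - intros x IH y [Hy| ->]%lt_su_iff; auto. }
  intros x. apply (K (su x)), lt_su.
Qed.

Lemma least (P : M -> Prop) : definable P -> (exists x, P x) ->
  exists x, P x /\ forall y, y < x -> ~ P y.
Proof.
  intros D [x Hx]. apply NNPP. intros N.
  assert (K : forall x, ~ P x).
  { apply (@strong_ind (fun x => ~ P x)).
    - destruct D as (w & f & D). exists w. eexists. means.
    - intros y Hy Py. apply N. exists y. auto. }
  exact (K x Hx).
Qed.

Lemma division a m : m <> ze -> exists q r, a = q * m + r /\ r < m.
Proof.
  intros Hm. revert a. apply (@ind M (fun a => exists q r, a = q * m + r /\ r < m)).
  - defn m.
  - exists ze, ze. split; [sring|]. destruct (cases m) as [->|[n ->]]; [easy|]. apply le_0.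
  - intros a (q & r & -> & Hr). destruct (lt_total (su r) m) as [H|[H|H]].
    + exists q, (su r). split; [sring|exact H].
    + exists (su q), ze. split; [rewrite <- H; sring|].
      destruct (cases m) as [->|[n ->]]; [easy|]. apply le_0.
    + apply lt_su_iff in H. destruct H as [H| ->];
        exfalso; [eapply lt_asym|eapply lt_irrefl]; eassumption.
Qed.

Lemma division_unique m q r q' r' :
  q * m + r = q' * m + r' -> r < m -> r' < m -> q = q' /\ r = r'.
Proof.
  assert (K : forall q q' r r', q < q' -> q * m + r = q' * m + r' -> r < m -> False).
  { clear. intros q q' r r' Hq H Hr. apply lt_ex in Hq as [z <-].
    apply (@lt_irrefl r). apply (lt_le_trans Hr).
    apply le_ex. exists (z * m + r'). apply ad_cancel with (q * m).
    transitivity (q * m + r); [rewrite H; sring|sring]. }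
  intros H Hr Hr'. destruct (lt_total q q') as [L|[->|L]].
  - exfalso; eauto.
  - split; [reflexivity|]. apply ad_cancel with (q' * m). rewrite (ad_comm r), H. sring.
  - exfalso; eauto.
Qed.

(** The square of x + y dominates: equal pairs have equal sums, and then equal
    first components. *)
Lemma pr2_inj x y z u : ⟪x, y⟫ = ⟪z, u⟫ -> x = z /\ y = u.
Proof.
  assert (K : forall x y z u, x + y < z + u -> ⟪x, y⟫ <> ⟪z, u⟫).
  { clear. intros x y z u H E. apply lt_ex in H as [v H].
    unfold pr2 in E. rewrite <- H in E.
    apply (@lt_irrefl ((x + y) * (x + y) + x)). rewrite E at 2. apply lt_ex.
    exists ((x+y) * (su v) + (x + y) * v + su v * v + v + y + z). sring. }
  intros H. destruct (lt_total (x + y) (z + u)) as [L|[L|L]].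
  - now apply K in L.
  - unfold pr2 in H. rewrite L in H.
    assert (E : x = z).
    { apply ad_cancel with ((z + u) * (z + u)). rewrite !(ad_comm _ ((z + u) * (z + u))).
      exact H. }
    split; [exact E|]. subst. apply ad_cancel with z. rewrite !(ad_comm _ z). exact L.
  - apply K in L. now symmetry in H.
Qed.

Lemma le_pr2_l x y : x <= ⟪x, y⟫.
Proof. unfold pr2. apply le_adl. Qed.
Lemma le_square x : x <= x * x.
Proof.
  destruct (cases x) as [->|[y ->]]; [apply le_0|]. apply le_mu, su_ne0.
Qed.
Lemma le_pr2_r x y : y <= ⟪x, y⟫.
Proof.
  unfold pr2. eapply le_trans; [|apply le_ad].
  eapply le_trans; [|apply le_square]. apply le_adl.
Qed.

Lemma std_inj (n p : nat) : @std M n = std p -> n = p.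
Proof.
  revert p; induction n; intros [|p]; simpl; intros H; auto.
  - now apply eq_sym, su_ne0 in H.
  - now apply su_ne0 in H.
  - f_equal. apply IHn, su_inj, H.
Qed.
Lemma std_ad (n p : nat) : @std M (n + p) = std n + std p.
Proof. induction n; simpl; rewrite ?ad0l, ?adSl; congruence. Qed.
Lemma std_mu (n p : nat) : @std M (n * p) = std n * std p.
Proof.
  induction n; simpl; rewrite ?mu0l, ?muSl; [reflexivity|].
  rewrite std_ad, IHn. apply ad_comm.
Qed.
Lemma std_pair (n p : nat) : @std M (pair n p) = ⟪std n, std p⟫.
Proof. unfold pair, pr2. now rewrite std_ad, std_mu, std_ad. Qed.

End Order.
Arguments lt_irrefl {M} [x].

(** * Coding of finite sequences *)

Section Sequences.
Variable M : model.
Implicit Types x y z u v a b c d m n q r i j k p s t : M.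
Local Open Scope m_scope.
Add Ring model_ring2 : (model_ring M).

Definition Beta a b i y : Prop :=
  y < su (su i * b) /\ exists q, a = q * su (su i * b) + y.

Lemma means_Beta w ta tb ti ty a b i y :
  den w ta a -> den w tb b -> den w ti i -> den w ty y ->
  means w (aBeta ta tb ti ty) (Beta a b i y).
Proof. intros. unfold aBeta, Beta. means. Qed.

Lemma Beta_fun a b i y y' : Beta a b i y -> Beta a b i y' -> y = y'.
Proof.
  intros [H [q Hq]] [H' [q' Hq']]. subst a.
  eapply division_unique; eassumption.
Qed.
Lemma Beta_total a b i : exists y, Beta a b i y.
Proof.
  destruct (@division M a (su (su i * b))) as (q & r & H & Hr); [apply su_ne0|].
  exists r. split; [exact Hr|]. now exists q.
Qed.
Lemma Beta_le a b i y : Beta a b i y -> y <= a.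
Proof. intros [_ [q ->]]. apply le_adl. Qed.

Definition cong m x y : Prop := exists u v, x + m * u = y + m * v.

Lemma cong_mul m x y x' y' : cong m x y -> cong m x' y' -> cong m (x * x') (y * y').
Proof.
  intros (u & v & H) (u' & v' & H').
  exists (u * x' + x * u' + m * u * u'), (v * y' + y * v' + m * v * v').
  transitivity ((x + m * u) * (x' + m * u')); [sring|]. rewrite H, H'. sring.
Qed.

Lemma cong_rem m x y : cong m x y -> y < m -> exists q, x = q * m + y.
Proof.
  intros (u & v & H) Hy.
  destruct (@division M x m) as (q & r & -> & Hr).
  { intros ->. now apply lt_0 in Hy. }
  exists q. f_equal.
  apply (@division_unique M m (q + u) r v y); auto.
  transitivity (q * m + r + m * u); [sring|]. rewrite H. sring.
Qed.

Lemma cong_trans m x y z : cong m x y -> cong m y z -> cong m x z.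
Proof.
  intros (u & v & H) (u' & v' & H'). exists (u + u'), (v + v').
  transitivity (x + m * u + m * u'); [sring|]. rewrite H.
  transitivity (y + m * u' + m * v); [sring|]. rewrite H'. sring.
Qed.

Definition invertible m x : Prop := exists u, cong m (x * u) (su ze).

Lemma invertible_mul m x y : invertible m x -> invertible m y -> invertible m (x * y).
Proof.
  intros [u H] [v K]. exists (u * v).
  assert (E := cong_mul H K).
  replace (x * y * (u * v)) with (x * u * (y * v)) by sring.
  replace (su ze) with (@su M ze * su ze) by sring. exact E.
Qed.

(** The moduli of the β function are invertible modulo each other when [b] is a
    multiple of the differences of their indices: both b and the difference
    i - k are then invertible modulo 1 + (i + 1) b. *)
Lemma moduli_coprime b i k d e : i = k + su d -> b = su d * e ->
  invertible (su (su i * b)) (su (su k * b)).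
Proof.
  intros Hi Hb.
  set (X := e * (su i * su i)).
  assert (H : su (su k * b) * X + su ze + su (su i * b) * su (su i * b)
              = su (su i * b) * (X + su (su ze))).
  { unfold X. subst i b. sring. }
  exists (X * (su i * b)). exists (X + su (su ze)), (su (su k * b) * X + su (su i * b)).
  transitivity (su (su k * b) * X * (su i * b) + (su (su i * b) * (X + su (su ze)))); [sring|].
  rewrite <- H. sring.
Qed.

Lemma mu_ne0 x y : x <> ze -> y <> ze -> x * y <> ze.
Proof.
  destruct (cases x) as [->|[x' ->]], (cases y) as [->|[y' ->]]; try easy.
  intros _ _. rewrite muS, adS. apply su_ne0.
Qed.

Lemma common_multiple n :
  exists c, c <> ze /\ forall d, d < n -> exists e, c = su d * e.
Proof.
  revert n.
  apply (@ind M (fun n => exists c, c <> ze /\ forall d, d < n -> exists e, c = su d * e)).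
  - defn.
  - exists (su ze). split; [apply su_ne0|]. intros d H. now apply lt_0 in H.
  - intros n (c & Hc & H). exists (c * su n). split; [apply mu_ne0; auto using su_ne0|].
    intros d [Hd| ->]%lt_su_iff.
    + destruct (H d Hd) as [e ->]. exists (e * su n). sring.
    + exists c. sring.
Qed.

Definition definable2 (Z : M -> M -> Prop) : Prop := exists w f, means2 w f Z.

Lemma bounded_values (Z : M -> M -> Prop) n : definable2 Z ->
  (forall i, i < n -> exists y, Z i y) ->
  exists c, forall i, i < n -> exists y, Z i y /\ y <= c.
Proof.
  intros (w & f & D). revert n.
  apply (@ind M (fun n => (forall i, i < n -> exists y, Z i y) ->
    exists c, forall i, i < n -> exists y, Z i y /\ y <= c)).
  - defn_end w.
  - intros _. exists ze. intros i H. now apply lt_0 in H.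
  - intros n IH H. destruct IH as [c Hc].
    { intros i Hi. apply H, lt_le, Hi. }
    destruct (H n (lt_su n)) as [y Hy].
    exists (c + y). intros i [Hi| ->]%lt_su_iff.
    + destruct (Hc i Hi) as [z [Hz Hz']]. exists z. split; [exact Hz|].
      eapply le_trans; [exact Hz'|apply le_ad].
    + exists y. split; [exact Hy|apply le_adl].
Qed.

(** The product of the first j moduli is a multiple of each of them, and is
    invertible modulo the other ones. *)
Lemma coprime_products n b :
  (forall d, d < n -> exists e, b = su d * e) ->
  forall j, j <= n -> exists c,
    (forall k, k < j -> exists e, c = su (su k * b) * e) /\
    (forall i, j <= i -> i <= n -> invertible (su (su i * b)) c).
Proof.
  intros Hb. unfold invertible, cong.
  apply (@ind M (fun j => j <= n -> exists c,
    (forall k, k < j -> exists e, c = su (su k * b) * e) /\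
    (forall i, j <= i -> i <= n ->
      exists u, exists v z, c * u + su (su i * b) * v = su ze + su (su i * b) * z))).
  - defn n, b.
  - intros _. exists (su ze). split; [intros k H; now apply lt_0 in H|].
    intros i _ _. exists (su ze), ze, ze. sring.
  - intros j IH Hj. destruct IH as (c & Hc & Hc').
    { apply lt_le. exact (proj1 (su_lt _ _) Hj). }
    exists (c * su (su j * b)). split.
    + intros k [Hk| ->]%lt_su_iff.
      * destruct (Hc k Hk) as [e ->]. exists (e * su (su j * b)). sring.
      * exists c. sring.
    + intros i Hi Hin. apply invertible_mul.
      * apply Hc'; [|exact Hin]. exact (lt_le (proj1 (su_lt _ _) Hi)).
      * assert (L := proj1 (su_lt _ _) Hi). apply lt_ex in L as [d <-].
        destruct (Hb d) as [e He].
        { eapply lt_le_trans; [|exact Hin]. apply su_lt. eapply lt_le_trans;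
            [apply lt_su|]. rewrite <- adS. apply le_adl. }
        eapply moduli_coprime; [reflexivity|exact He].
Qed.

(** The values are bounded, so moduli that exceed the bound and are coprime can
    be chosen; the Chinese remainder theorem is then proved by induction on the
    number of congruences. *)
Theorem sequence_coded (Z : M -> M -> Prop) n : definable2 Z ->
  (forall i, i < n -> exists y, Z i y) ->
  exists a b, forall i, i < n -> exists y, Z i y /\ Beta a b i y.
Proof.
  intros DZ HZ.
  destruct (bounded_values DZ HZ) as [c Hc].
  destruct (common_multiple n) as (g & Hg0 & Hg).
  set (b := g * su c).
  assert (Hb : forall d, d < n -> exists e, b = su d * e).
  { intros d Hd. destruct (Hg d Hd) as [e He]. exists (e * su c). unfold b. rewrite He. sring. }
  assert (Hcb : forall i, c < su (su i * b)).
  { intros i. apply le_lt_trans with (su i * b); [|apply lt_su].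
    apply le_trans with (su c); [apply lt_le, lt_su|].
    unfold b. replace (su i * (g * su c)) with (su c * (su i * g)) by sring.
    apply le_mu, mu_ne0; [apply su_ne0|exact Hg0]. }
  enough (H : forall j, j <= n -> exists a, forall k, k < j ->
    exists y, (Z k y /\ y <= c) /\ exists q, a = q * su (su k * b) + y).
  { destruct (H n (le_refl n)) as [a Ha]. exists a, b. intros i Hi.
    destruct (Ha i Hi) as (y & [Hy Hyc] & Hq). exists y. split; [exact Hy|].
    split; [|exact Hq]. eapply le_lt_trans; [exact Hyc|apply Hcb]. }
  destruct DZ as (w & f & D).
  apply (@ind M (fun j => j <= n -> exists a, forall k, k < j ->
    exists y, (Z k y /\ y <= c) /\ exists q, a = q * su (su k * b) + y)).
  { defn_param w n. defn_param w b. defn_param w c. defn_end w. }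
  { intros _. exists ze. intros k H. now apply lt_0 in H. }
  intros j IH Hj. apply (proj1 (su_lt _ _)) in Hj.
  destruct (IH (lt_le Hj)) as [a Ha].
  destruct (coprime_products Hb (lt_le Hj)) as (p & Hp & Hp').
  destruct (Hp' j (le_refl j) (lt_le Hj)) as [u Hu].
  destruct (Hc j Hj) as (z & Hz & Hzc).
  (* z + a (m - 1), where m is the j-th modulus, is z - a modulo m *)
  exists (a + p * (u * (z + a * (su j * b)))).
  intros k [Hk| ->]%lt_su_iff.
  - destruct (Ha k Hk) as (y & Hy & q & Hq). exists y. split; [exact Hy|].
    destruct (Hp k Hk) as [e He].
    exists (q + e * (u * (z + a * (su j * b)))). rewrite He. rewrite Hq at 1. sring.
  - exists z. split; [split; assumption|].
    apply cong_rem; [|eapply le_lt_trans; [exact Hzc|apply Hcb]].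
    apply cong_trans with (a + (z + a * (su j * b))).
    + destruct Hu as (s & t & Hu).
      exists (s * (z + a * (su j * b))), (t * (z + a * (su j * b))).
      transitivity (a + (p * u + su (su j * b) * s) * (z + a * (su j * b))); [sring|].
      rewrite Hu. sring.
    + exists ze, a. sring.
Qed.
End Sequences.

(** * Inductively generated sets *)

Ltac means_base ::=
  match goal with
  | |- means _ _ (Beta _ _ _ _) => refine (means_Beta _ _ _ _)
  end.

Section Derivations.
Variable M : model.
Implicit Types x y z u v a b c d m n q i j k p : M.
Local Open Scope m_scope.

Definition listed_in a b n z : Prop := exists j, j < n /\ Beta a b j z.

Definition Der (R : M -> (M -> Prop) -> Prop) x : Prop :=
  exists a b n, Beta a b n x /\
    forall i, i < su n -> exists y, Beta a b i y /\ R y (listed_in a b i).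

Lemma means_Der w rule R t x : means_rule w rule R -> den w t x ->
  means w (aDer rule t) (Der R x).
Proof. intros H K. unfold aDer, Der, listed_in. means. Qed.

Definition monotone (R : M -> (M -> Prop) -> Prop) : Prop :=
  forall y (D E : M -> Prop), (forall z, D z -> E z) -> R y D -> R y E.

Section Rule.
Variable R : M -> (M -> Prop) -> Prop.
Hypothesis mono : monotone R.

Definition chain a b n : Prop :=
  forall i, i < n -> exists y, Beta a b i y /\ R y (listed_in a b i).

Lemma Der_listed a b n z : chain a b n -> listed_in a b n z -> Der R z.
Proof.
  intros C (j & Hj & H). exists a, b, j. split; [exact H|].
  intros i Hi. apply C. eapply le_lt_trans; eassumption.
Qed.

(** The entries before the last one are derivations of their own last entries. *)
Lemma Der_inv x : Der R x -> R x (Der R).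
Proof.
  intros (a & b & n & Hx & C). destruct (C n (lt_su n)) as (y & Hy & Ry).
  rewrite (Beta_fun Hx Hy). eapply mono; [|exact Ry].
  intros z Hz. apply (@Der_listed a b n); [|exact Hz].
  intros i Hi. apply C. eapply lt_trans; [exact Hi|apply lt_su].
Qed.

Lemma chain_snoc a b n x : chain a b n -> R x (listed_in a b n) ->
  exists a' b', chain a' b' (su n) /\ Beta a' b' n x /\
    forall z, listed_in a b n z -> listed_in a' b' (su n) z.
Proof.
  intros C Rx.
  destruct (@sequence_coded M (fun i y => i < n /\ Beta a b i y \/ i = n /\ y = x) (su n))
    as (a' & b' & H).
  { unfold definable2. pose (w := (0, fun _ => ze) : world M).
    defn_param w a. defn_param w b. defn_param w n. defn_param w x. defn_end w. }
  { intros i [Hi| ->]%lt_su_iff; [|exists x; tauto].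
    destruct (C i Hi) as (y & Hy & _). exists y. tauto. }
  assert (E : forall i y, i < n -> Beta a b i y -> Beta a' b' i y).
  { intros i y Hi Hy. destruct (H i (lt_le Hi)) as (y' & [[_ K]|[-> _]] & B).
    - now rewrite (Beta_fun Hy K).
    - now apply lt_irrefl in Hi. }
  assert (Ex : Beta a' b' n x).
  { destruct (H n (lt_su n)) as (y' & [[K _]|[_ ->]] & B); [now apply lt_irrefl in K|exact B]. }
  assert (L : forall i z, i <= n -> listed_in a b i z -> listed_in a' b' i z).
  { intros i z Hi (j & Hj & B). exists j. split; [exact Hj|]. apply E; [|exact B].
    eapply lt_le_trans; eassumption. }
  exists a', b'. split; [|split; [exact Ex|]].
  - intros i [Hi| ->]%lt_su_iff.
    + destruct (C i Hi) as (y & Hy & Ry). exists y. split; [auto|].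
      eapply mono; [|exact Ry]. intros z. apply L, lt_le, Hi.
    + exists x. split; [exact Ex|]. eapply mono; [|exact Rx]. intros z.
      apply L, le_refl.
  - intros z (j & Hj & B). exists j. split; [apply lt_le, Hj|auto].
Qed.

Lemma Der_intro a b n x : chain a b n -> R x (listed_in a b n) -> Der R x.
Proof.
  intros C Rx. destruct (chain_snoc C Rx) as (a' & b' & C' & B & _).
  exists a', b', n. split; assumption.
Qed.

Lemma Der_chain x : Der R x -> exists a b n, chain a b n /\ listed_in a b n x.
Proof.
  intros (a & b & n & B & C). exists a, b, (su n). split; [exact C|].
  exists n. split; [apply lt_su|exact B].
Qed.

Lemma chain_app a b n a' b' n' : chain a b n -> chain a' b' n' ->
  exists a1 b1, chain a1 b1 (n + n') /\
    forall z, listed_in a b n z \/ listed_in a' b' n' z -> listed_in a1 b1 (n + n') z.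
Proof.
  intros C C'.
  destruct (@sequence_coded M (fun i y => i < n /\ Beta a b i y \/
    exists k, i = n + k /\ Beta a' b' k y) (n + n')) as (a1 & b1 & H).
  { unfold definable2. pose (w := (0, fun _ => ze) : world M).
    defn_param w a. defn_param w b. defn_param w n. defn_param w a'. defn_param w b'.
    defn_end w. }
  { intros i Hi. destruct (lt_total i n) as [L|L].
    - destruct (Beta_total a b i) as [y B]. exists y. now left.
    - assert (K : n <= i) by (apply not_lt; intros K; destruct L as [->|L];
        [now apply lt_irrefl in K|now apply (lt_asym K)]).
      apply le_ex in K as [k <-]. destruct (Beta_total a' b' k) as [y B].
      exists y. right. now exists k. }
  assert (E : forall i y, i < n -> Beta a b i y -> Beta a1 b1 i y).
  { intros i y Hi Hy. destruct (H i) as (y' & [[_ K]|(k & -> & K)] & B).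
    - eapply lt_le_trans; [exact Hi|apply le_ad].
    - now rewrite (Beta_fun Hy K).
    - now apply not_lt in Hi; [|apply le_ad]. }
  assert (E' : forall i y, i < n' -> Beta a' b' i y -> Beta a1 b1 (n + i) y).
  { intros i y Hi Hy. destruct (H (n + i)) as (y' & [[K _]|(k & K & B')] & B).
    - rewrite (ad_comm n i), (ad_comm n n'). now apply ad_lt.
    - now apply not_lt in K; [|apply le_ad].
    - rewrite (ad_comm n i), (ad_comm n k) in K. apply ad_cancel in K. subst k.
      now rewrite (Beta_fun Hy B'). }
  exists a1, b1. split.
  - intros i Hi. destruct (lt_total i n) as [L|L].
    + destruct (C i L) as (y & Hy & Ry). exists y. split; [auto|].
      eapply mono; [|exact Ry]. intros z (j & Hj & B). exists j. split; [exact Hj|].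
      apply E; [eapply lt_trans; eassumption|exact B].
    + assert (K : n <= i) by (apply not_lt; intros K; destruct L as [->|L];
        [now apply lt_irrefl in K|now apply (lt_asym K)]).
      apply le_ex in K as [k <-].
      assert (Hk : k < n').
      { rewrite (ad_comm n k), (ad_comm n n') in Hi. now apply ad_lt in Hi. }
      destruct (C' k Hk) as (y & Hy & Ry). exists y. split; [auto|].
      eapply mono; [|exact Ry]. intros z (j & Hj & B). exists (n + j). split.
      * rewrite (ad_comm n k), (ad_comm n j). now apply ad_lt.
      * apply E'; [eapply lt_trans; eassumption|exact B].
  - intros z [(j & Hj & B)|(j & Hj & B)].
    + exists j. split; [eapply lt_le_trans; [exact Hj|apply le_ad]|auto].
    + exists (n + j). split; [|auto]. rewrite (ad_comm n j), (ad_comm n n'). now apply ad_lt.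
Qed.

(** Sets generated by rules with at most two premises are closed under the rules:
    derivations of the premises are concatenated and followed by the conclusion. *)
Lemma Der_close u v x : Der R u -> Der R v ->
  R x (fun z => z = u \/ z = v) -> Der R x.
Proof.
  intros (a & b & n & C & Hu)%Der_chain (a' & b' & n' & C' & Hv)%Der_chain Rx.
  destruct (chain_app C C') as (a1 & b1 & C1 & H).
  apply (Der_intro C1). eapply mono; [|exact Rx].
  intros z [-> | ->]; apply H; auto.
Qed.

Lemma Der_close1 u x : Der R u -> R x (fun z => z = u) -> Der R x.
Proof.
  intros H Rx. apply (Der_close H H). eapply mono; [|exact Rx]. now left.
Qed.

Lemma Der_close0 x : R x (fun z => False) -> Der R x.
Proof.
  intros H. apply (@Der_intro ze ze ze).
  - intros i Hi. now apply lt_0 in Hi.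
  - eapply mono; [|exact H]. easy.
Qed.

(** The number of derivations to be joined may be nonstandard, so they are joined
    by an induction inside the model, for which the family has to be definable. *)
Lemma Der_family w rule fQ (Q : M -> M -> Prop) n :
  means_rule w rule R -> means2 w fQ Q ->
  (forall m, m < n -> exists z, Q m z /\ Der R z) ->
  exists a b k, chain a b k /\ forall m, m < n -> exists z, Q m z /\ listed_in a b k z.
Proof.
  intros DR DQ. revert n. unfold chain, listed_in.
  apply (@ind M (fun n => (forall m, m < n -> exists z, Q m z /\ Der R z) ->
    exists a b k, (forall i, i < k -> exists y, Beta a b i y /\
        R y (fun z => exists j, j < i /\ Beta a b j z)) /\
      forall m, m < n -> exists z, Q m z /\ (exists j, j < k /\ Beta a b j z))).
  { exists w. eexists. unfold Der, listed_in. means. }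
  { intros _. exists ze, ze, ze. split; intros i Hi; now apply lt_0 in Hi. }
  intros n IH H. destruct IH as (a & b & k & C & HQ).
  { intros m Hm. apply H, lt_le, Hm. }
  destruct (H n (lt_su n)) as (z & Qz & (a' & b' & k' & C' & Hz)%Der_chain).
  destruct (@chain_app a b k a' b' k') as (a1 & b1 & C1 & L); [exact C|exact C'|].
  exists a1, b1, (k + k'). split; [exact C1|].
  intros m [Hm| ->]%lt_su_iff.
  - destruct (HQ m Hm) as (y & Qy & Hy). exists y. split; [exact Qy|].
    apply L. left. exact Hy.
  - exists z. split; [exact Qz|]. apply L. right. exact Hz.
Qed.

End Rule.
End Derivations.

(** * The arithmetized notions inside a model *)

Ltac means_base ::=
  match goal with
  | |- means _ _ (Beta _ _ _ _) => refine (means_Beta _ _ _ _)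
  | |- means _ _ (Der _ _) => refine (means_Der _ _)
  end.

Section Syntax.
Variable M : model.
Local Open Scope m_scope.
Implicit Types D : M -> Prop.

(* Each notion of the arithmetized syntax has a counterpart for the elements of a
   model: q for constructors of codes, r for rules and m for relations. *)
Definition qVar (i : M) : M := ⟪std 0, i⟫.
Definition qZero : M := ⟪std 1, std 0⟫.
Definition qSucc (t : M) : M := ⟪std 2, t⟫.
Definition qAdd (t u : M) : M := ⟪std 3, t, u⟫.
Definition qMul (t u : M) : M := ⟪std 4, t, u⟫.
Definition qEqu (t u : M) : M := ⟪std 5, t, u⟫.
Definition qLess (t u : M) : M := ⟪std 6, t, u⟫.
Definition qBot : M := ⟪std 7, std 0⟫.
Definition qImp (f g : M) : M := ⟪std 8, f, g⟫.
Definition qAll (f : M) : M := ⟪std 9, f⟫.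
Definition qNeg (f : M) : M := qImp f qBot.

Definition rTerm (n : M) (t : M) D : Prop :=
  (exists i, i < n /\ t = qVar i)
  \/ t = qZero
  \/ (exists u, D u /\ t = qSucc u)
  \/ (exists u v, D u /\ D v /\ (t = qAdd u v \/ t = qMul u v)).
Definition mTerm (n t : M) : Prop := Der (rTerm n) t.

Definition rForm (y : M) D : Prop :=
  exists n f, y = ⟪n, f⟫ /\
    ((exists t u, mTerm n t /\ mTerm n u /\ (f = qEqu t u \/ f = qLess t u))
     \/ f = qBot
     \/ (exists g h, D ⟪n, g⟫ /\ D ⟪n, h⟫ /\ f = qImp g h)
     \/ (exists g, D ⟪su n, g⟫ /\ f = qAll g)).
Definition mForm (n f : M) : Prop := Der rForm ⟪n, f⟫.
Definition mIsTerm (t : M) : Prop := exists n, mTerm n t.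
Definition mIsForm (f : M) : Prop := exists n, mForm n f.

Definition rMapTerm (V : M -> M -> Prop) (y : M) D : Prop :=
  (exists i u, V i u /\ y = ⟪qVar i, u⟫)
  \/ y = ⟪qZero, qZero⟫
  \/ (exists u u', D ⟪u, u'⟫ /\ y = ⟪qSucc u, qSucc u'⟫)
  \/ (exists u u' w w', D ⟪u, u'⟫ /\ D ⟪w, w'⟫ /\
       (y = ⟪qAdd u w, qAdd u' w'⟫ \/ y = ⟪qMul u w, qMul u' w'⟫)).
Definition mMapTerm V (t t' : M) : Prop := Der (rMapTerm V) ⟪t, t'⟫.

Definition rMapForm (V : M -> M -> M -> Prop) (y : M) D : Prop :=
  exists k,
    (exists t t' u u', mMapTerm (V k) t t' /\ mMapTerm (V k) u u' /\
       (y = ⟪k, qEqu t u, qEqu t' u'⟫ \/ y = ⟪k, qLess t u, qLess t' u'⟫))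
    \/ y = ⟪k, qBot, qBot⟫
    \/ (exists g g' h h', D ⟪k, g, g'⟫ /\ D ⟪k, h, h'⟫ /\
         y = ⟪k, qImp g h, qImp g' h'⟫)
    \/ (exists g g', D ⟪su k, g, g'⟫ /\ y = ⟪k, qAll g, qAll g'⟫).
Definition mMapForm V (k f f' : M) : Prop := Der (rMapForm V) ⟪k, f, f'⟫.

Definition mShiftTerm (k t t' : M) : Prop :=
  mMapTerm (fun i u => u = qVar (k + i)) t t'.
Definition mShiftVar (k i u : M) : Prop :=
  (i < k /\ u = qVar i) \/ (~ i < k /\ u = qVar (su i)).
Definition mInstVar (s k i u : M) : Prop :=
  (i < k /\ u = qVar i) \/ (i = k /\ mShiftTerm k s u)
  \/ (exists j, k < i /\ i = su j /\ u = qVar j).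
Definition mStepVar (k i u : M) : Prop :=
  (i = k /\ u = qSucc (qVar k)) \/ (~ i = k /\ u = qVar i).
Definition mShift (f g : M) : Prop := mMapForm mShiftVar (std 0) f g.
Definition mInst (s f g : M) : Prop := mMapForm (mInstVar s) (std 0) f g.
Definition mStep (f g : M) : Prop := mMapForm mStepVar (std 0) f g.

Definition rNum (y : M) D : Prop :=
  y = ⟪std 0, qZero⟫ \/ (exists m u, D ⟪m, u⟫ /\ y = ⟪su m, qSucc u⟫).
Definition mNum (n t : M) : Prop := Der rNum ⟪n, t⟫.
Definition mInstNum (f n g : M) : Prop := exists t, mNum n t /\ mInst t f g.

Definition mLogicalAxiom (y : M) : Prop :=
  (exists f g, mIsForm f /\ mIsForm g /\ y = qImp f (qImp g f))
  \/ (exists f g h, mIsForm f /\ mIsForm g /\ mIsForm h /\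
       y = qImp (qImp f (qImp g h)) (qImp (qImp f g) (qImp f h)))
  \/ (exists f, mIsForm f /\ y = qImp (qNeg (qNeg f)) f)
  \/ (exists s f g, mIsTerm s /\ mIsForm f /\ mInst s f g /\ y = qImp (qAll f) g)
  \/ (exists f g, mIsForm f /\ mIsForm g /\
       y = qImp (qAll (qImp f g)) (qImp (qAll f) (qAll g)))
  \/ (exists f g, mIsForm f /\ mShift f g /\ y = qImp f (qAll g))
  \/ (exists s, mIsTerm s /\ y = qEqu s s)
  \/ (exists s t f g h, mIsTerm s /\ mIsTerm t /\ mIsForm f /\
       mInst s f g /\ mInst t f h /\ y = qImp (qEqu s t) (qImp g h)).

Definition rPrv (Ax : M -> Prop) (y : M) D : Prop :=
  mLogicalAxiom y
  \/ Ax y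
  \/ (exists f, D f /\ D (qImp f y))
  \/ (exists f, D f /\ y = qAll f).
Definition mPrv Ax (x : M) : Prop := Der (rPrv Ax) x.

Definition mAxPA (y : M) : Prop :=
  fold_right (fun f F => y = std (gn f) \/ F)
    (exists f g h, mIsForm f /\ mInst qZero f g /\ mStep f h /\
       y = qImp g (qImp (qAll (qImp f h)) (qAll f)))
    PA_base.

Definition rVal (y : M) D : Prop :=
  y = ⟪qZero, std 0⟫
  \/ (exists u m, D ⟪u, m⟫ /\ y = ⟪qSucc u, su m⟫)
  \/ (exists u m w p, D ⟪u, m⟫ /\ D ⟪w, p⟫ /\
       (y = ⟪qAdd u w, m + p⟫ \/ y = ⟪qMul u w, m * p⟫)).
Definition mVal (t n : M) : Prop := Der rVal ⟪t, n⟫.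

Definition rDec (y : M) D : Prop :=
  (exists t u m n, mVal t m /\ mVal u n /\
     ((m = n /\ y = ⟪std 1, qEqu t u⟫)
      \/ (~ m = n /\ y = ⟪std 0, qEqu t u⟫)
      \/ (m < n /\ y = ⟪std 1, qLess t u⟫)
      \/ (~ m < n /\ y = ⟪std 0, qLess t u⟫)))
  \/ y = ⟪std 0, qBot⟫
  \/ (exists f g, (D ⟪std 0, f⟫ \/ D ⟪std 1, g⟫) /\ y = ⟪std 1, qImp f g⟫)
  \/ (exists f g, D ⟪std 1, f⟫ /\ D ⟪std 0, g⟫ /\ y = ⟪std 0, qImp f g⟫)
  \/ (exists t n f, mVal t n /\
       (forall m, m < n -> exists g, mInstNum f m g /\ D ⟪std 1, g⟫) /\
       y = ⟪std 1, qAll (qImp (qLess (qVar (std 0)) t) f)⟫)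
  \/ (exists f n g, mInstNum f n g /\ D ⟪std 0, g⟫ /\ y = ⟪std 0, qAll f⟫).
Definition mDecided (b s : M) : Prop := Der rDec ⟪b, s⟫.

Definition mInSigma (e x : M) : Prop := exists s, mInstNum e x s /\ mDecided (std 1) s.
Definition mInPi (e x : M) : Prop := ~ exists s, mInstNum e x s /\ mDecided (std 0) s.
Definition mLe (l x y : M) : Prop := exists p e, l = ⟪p, e⟫ /\ mInSigma e ⟪x, y⟫.
Definition mDom (l x : M) : Prop := mLe l x x.
Definition mLt (l x y : M) : Prop := mLe l x y /\ ~ x = y.
Definition mLO (l : M) : Prop :=
  (exists p e, l = ⟪p, e⟫ /\
     (forall n, mInPi p n <-> mInSigma e n) /\
     (forall n, mInSigma e n -> exists x y, n = ⟪x, y⟫))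
  /\ (forall x y, mLe l x y -> mDom l x /\ mDom l y)
  /\ (forall x y z, mLe l x y /\ mLe l y z -> mLe l x z)
  /\ (forall x y, mLe l x y /\ mLe l y x -> x = y)
  /\ (forall x y, mDom l x /\ mDom l y -> mLe l x y \/ mLe l y x).

Definition mPrvDot (Ax : M -> Prop) (f x : M) : Prop :=
  exists s, mInstNum f x s /\ mPrv Ax s.
Definition mAxOpen (Ax : M -> Prop) (l v x y : M) : Prop :=
  mDom l x /\
  (Ax y
   \/ exists z f, mLt l z x /\ mForm (std 1) f /\
       exists g1 g2 g, mInstNum v v g1 /\ mInstNum g1 z g2 /\ mInstNum g2 f g /\
         y = qAll (qImp g f)).

End Syntax.

Section Meanings1.
Variable M : model.
Implicit Types w : world M.

Lemma means_Term w tn tt n t : den w tn n -> den w tt t ->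
  means w (aTerm tn tt) (mTerm n t).
Proof. intros. unfold aTerm, mTerm, rTerm. means. Qed.

Lemma means_MapTerm w v V t t' x x' : means2 w v V -> den w t x -> den w t' x' ->
  means w (aMapTerm v t t') (mMapTerm V x x').
Proof. intros. unfold aMapTerm, mMapTerm, rMapTerm. means. Qed.

Lemma means_Num w n t x y : den w n x -> den w t y -> means w (aNum n t) (mNum x y).
Proof. intros. unfold aNum, mNum, rNum. means. Qed.

Lemma means_Val w n t x y : den w n x -> den w t y -> means w (aVal n t) (mVal x y).
Proof. intros. unfold aVal, mVal, rVal. means. Qed.
End Meanings1.

Ltac means_syntax1 :=
  match goal with
  | |- means _ _ (Beta _ _ _ _) => refine (means_Beta _ _ _ _)
  | |- means _ _ (Der _ _) => refine (means_Der _ _)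
  | |- means _ _ (mTerm _ _) => refine (means_Term _ _)
  | |- means _ _ (mMapTerm _ _ _) => refine (means_MapTerm _ _ _)
  | |- means _ _ (mNum _ _) => refine (means_Num _ _)
  | |- means _ _ (mVal _ _) => refine (means_Val _ _)
  end.
Ltac means_base ::= means_syntax1.

Section Meanings2.
Variable M : model.
Implicit Types w : world M.

Lemma means_Form w n f x y : den w n x -> den w f y -> means w (aForm n f) (mForm x y).
Proof. intros. unfold aForm, mForm, rForm. means. Qed.

Lemma means_MapForm w v V k f g x y z : means3 w v V ->
  den w k x -> den w f y -> den w g z ->
  means w (aMapForm v k f g) (mMapForm V x y z).
Proof. intros. unfold aMapForm, mMapForm, rMapForm. means. Qed.

Lemma means_ShiftTerm w k t u x y z : den w k x -> den w t y -> den w u z ->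
  means w (aShiftTerm k t u) (mShiftTerm x y z).
Proof. intros. unfold aShiftTerm, mShiftTerm. means. Qed.

Lemma means_InstVar w s k i u a x y z :
  den w s a -> den w k x -> den w i y -> den w u z ->
  means w (aInstVar s k i u) (mInstVar a x y z).
Proof. intros. unfold aInstVar, mInstVar, aShiftTerm, mShiftTerm. means. Qed.
End Meanings2.

Ltac means_syntax2 :=
  first [ means_syntax1 |
  match goal with
  | |- means _ _ (mForm _ _) => refine (means_Form _ _)
  | |- means _ _ (mMapForm _ _ _ _) => refine (means_MapForm _ _ _ _)
  | |- means _ _ (mShiftTerm _ _ _) => refine (means_ShiftTerm _ _ _)
  | |- means _ _ (mInstVar _ _ _ _) => refine (means_InstVar _ _ _ _)
  end ].
Ltac means_base ::= means_syntax2.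

Section Meanings3.
Variable M : model.
Implicit Types w : world M.

Lemma means_Shift w f g x y : den w f x -> den w g y ->
  means w (aShift f g) (mShift x y).
Proof. intros. unfold aShift, mShift, aShiftVar, mShiftVar. means. Qed.
Lemma means_Inst w s f g a x y : den w s a -> den w f x -> den w g y ->
  means w (aInst s f g) (mInst a x y).
Proof. intros. unfold aInst, mInst. means. Qed.
Lemma means_Step w f g x y : den w f x -> den w g y ->
  means w (aStep f g) (mStep x y).
Proof. intros. unfold aStep, mStep, aStepVar, mStepVar. means. Qed.
End Meanings3.

Ltac means_syntax3 :=
  first [ means_syntax2 |
  match goal with
  | |- means _ _ (mShift _ _) => refine (means_Shift _ _)
  | |- means _ _ (mInst _ _ _) => refine (means_Inst _ _ _)
  | |- means _ _ (mStep _ _) => refine (means_Step _ _)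
  end ].
Ltac means_base ::= means_syntax3.

Section Meanings4.
Variable M : model.
Implicit Types w : world M.

Lemma means_InstNum w f n g x y z : den w f x -> den w n y -> den w g z ->
  means w (aInstNum f n g) (mInstNum x y z).
Proof. intros. unfold aInstNum, mInstNum. means. Qed.

Lemma means_LogicalAxiom w y x : den w y x ->
  means w (aLogicalAxiom y) (mLogicalAxiom x).
Proof. intros. unfold aLogicalAxiom, mLogicalAxiom, mIsForm, mIsTerm. means. Qed.

Lemma means_AxPA w y x : den w y x -> means w (aAxPA y) (mAxPA x).
Proof.
  intros H. unfold aAxPA, mAxPA. induction PA_base; cbn [fold_right].
  - unfold mIsForm. means.
  - refine (means_or _ IHl). means.
Qed.
End Meanings4.

Ltac means_syntax4 :=
  first [ means_syntax3 |
  match goal with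
  | |- means _ _ (mInstNum _ _ _) => refine (means_InstNum _ _ _)
  | |- means _ _ (mLogicalAxiom _) => refine (means_LogicalAxiom _)
  | |- means _ _ (mAxPA _) => refine (means_AxPA _)
  end ].
Ltac means_base ::= means_syntax4.

Section Meanings5.
Variable M : model.
Implicit Types w : world M.

Lemma means_Prv w ax Ax y x : means1 w ax Ax -> den w y x ->
  means w (aPrv ax y) (mPrv Ax x).
Proof. intros. unfold aPrv, mPrv, rPrv. means. Qed.

Lemma means_rDec w : means_rule w (fun y D =>
    (∃ t u m n, aVal t m ∧ aVal u n ∧
       ((m ≐ n ∧ y ≐ ⟨hnum 1, cEqu t u⟩)
        ∨ (¬ m ≐ n ∧ y ≐ ⟨hnum 0, cEqu t u⟩)
        ∨ (m ⋖ n ∧ y ≐ ⟨hnum 1, cLess t u⟩)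
        ∨ (¬ m ⋖ n ∧ y ≐ ⟨hnum 0, cLess t u⟩)))
    ∨ y ≐ ⟨hnum 0, cBot⟩
    ∨ (∃ f g, (D ⟨hnum 0, f⟩ ∨ D ⟨hnum 1, g⟩) ∧ y ≐ ⟨hnum 1, cImp f g⟩)
    ∨ (∃ f g, D ⟨hnum 1, f⟩ ∧ D ⟨hnum 0, g⟩ ∧ y ≐ ⟨hnum 0, cImp f g⟩)
    ∨ (∃ t n f, aVal t n ∧
         (∀ m, m ⋖ n ⇒ ∃ g, aInstNum f m g ∧ D ⟨hnum 1, g⟩) ∧
         y ≐ ⟨hnum 1, cAll (cImp (cLess (cVar (hnum 0)) t) f)⟩)
    ∨ (∃ f n g, aInstNum f n g ∧ D ⟨hnum 0, g⟩ ∧ y ≐ ⟨hnum 0, cAll f⟩))%fm (@rDec M).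
Proof. unfold rDec. means. Qed.

Lemma means_Decided w b t x y : den w b x -> den w t y ->
  means w (aDecided b t) (mDecided x y).
Proof.
  intros. unfold aDecided, mDecided. refine (means_Der (@means_rDec w) _). means.
Qed.
End Meanings5.

Ltac means_syntax5 :=
  first [ means_syntax4 |
  match goal with
  | |- means _ _ (mPrv _ _) => refine (means_Prv _ _)
  | |- means _ _ (mDecided _ _) => refine (means_Decided _ _)
  end ].
Ltac means_base ::= means_syntax5.

Section Meanings6.
Variable M : model.
Implicit Types w : world M.

Lemma means_Le w l t u x y z : den w l x -> den w t y -> den w u z ->
  means w (aLe l t u) (mLe x y z).
Proof. intros. unfold aLe, mLe, mInSigma. means. Qed.

Lemma means_Lt w l t u x y z : den w l x -> den w t y -> den w u z ->
  means w (aLt l t u) (mLt x y z).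
Proof. intros. unfold aLt, mLt. refine (means_and (means_Le _ _ _) _); means. Qed.

Lemma means_LO w l x : den w l x -> means w (aLO l) (mLO x).
Proof. intros. unfold aLO, mLO, mDom, mLe, mInPi, mInSigma. means. Qed.
End Meanings6.

Ltac means_syntax6 :=
  first [ means_syntax5 |
  match goal with
  | |- means _ _ (mLe _ _ _) => refine (means_Le _ _ _)
  | |- means _ _ (mDom _ _) => refine (means_Le _ _ _)
  | |- means _ _ (mLt _ _ _) => refine (means_Lt _ _ _)
  end ].
Ltac means_base ::= means_syntax6.

Section Meanings7.
Variable M : model.
Implicit Types w : world M.

Lemma means_PrvDot w ax Ax f t x y : means1 w ax Ax -> den w f x -> den w t y ->
  means w (aPrvDot ax f t) (mPrvDot Ax x y).
Proof. intros. unfold aPrvDot, mPrvDot. means. Qed.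

Lemma means_AxOpen w ax Ax l v t u a b x y : means1 w ax Ax ->
  den w l a -> den w v b -> den w t x -> den w u y ->
  means w (aAxOpen ax l v t u) (mAxOpen Ax a b x y).
Proof. intros. unfold aAxOpen, mAxOpen. means. Qed.
End Meanings7.

(** * Substitution on codes *)

Arguments qZero {M}.
Arguments qBot {M}.

(* Codes with different constructors differ in their first components, which are
   distinct standard numbers. *)
Ltac code_eq :=
  unfold qVar, qZero, qSucc, qAdd, qMul, qEqu, qLess, qBot, qImp, qAll in *;
  repeat match goal with
  | H : pr2 _ _ = pr2 _ _ |- _ =>
      let H1 := fresh in let H2 := fresh in apply pr2_inj in H as [H1 H2]
  | H : std _ = std _ |- _ => apply std_inj in H; first [discriminate H | clear H]
  | H : ?x = ?y |- _ => first [is_var x | is_var y]; subst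
  end.

Section Codes.
Variable M : model.
Local Open Scope m_scope.
Implicit Types x y z : M.

Lemma rTerm_mono (n : M) : monotone (rTerm n).
Proof. intros y D E H. unfold rTerm. firstorder. Qed.
Lemma rForm_mono : monotone (@rForm M).
Proof.
  intros y D E H (n & f & Hy & K). exists n, f. split; [exact Hy|].
  destruct K as [K|[K|[(g & h & Dg & Dh & K)|(g & Dg & K)]]]; auto.
  - right; right; left. exists g, h. auto.
  - right; right; right. exists g. auto.
Qed.
Lemma rMapTerm_mono (V : M -> M -> Prop) : monotone (rMapTerm V).
Proof.
  intros y D E H [K|[K|[(u & u' & D1 & K)|(u & u' & w & w' & D1 & D2 & K)]]].
  - left; exact K.
  - right; left; exact K.
  - right; right; left. exists u, u'. auto.
  - right; right; right. exists u, u', w, w'. auto.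
Qed.
Lemma rMapForm_mono V : monotone (@rMapForm M V).
Proof.
  intros y D E H (k & K). exists k.
  destruct K as [K|[K|[(g & g' & h & h' & D1 & D2 & K)|(g & g' & D1 & K)]]].
  - left; exact K.
  - right; left; exact K.
  - right; right; left. exists g, g', h, h'. auto.
  - right; right; right. exists g, g'. auto.
Qed.
Lemma rNum_mono : monotone (@rNum M).
Proof.
  intros y D E H [K|(m & u & D1 & K)]; [left; exact K|right; exists m, u; auto].
Qed.

(** ** Terms *)

Section MapTerm.
Variable V : M -> M -> Prop.

Lemma MapTerm_Var i y : mMapTerm V (qVar i) y <-> V i y.
Proof.
  split.
  - intros H. apply Der_inv in H; [|apply rMapTerm_mono].
    destruct H as [(j & u & K & H)|[H|[(u & u' & _ & H)|(u & u' & w & w' & _ & _ & [H|H])]]];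
      code_eq; exact K.
  - intros H. apply Der_close0; [apply rMapTerm_mono|]. left. now exists i, y.
Qed.
Lemma MapTerm_Zero y : mMapTerm V qZero y <-> y = qZero.
Proof.
  split.
  - intros H. apply Der_inv in H; [|apply rMapTerm_mono].
    destruct H as [(j & u & K & H)|[H|[(u & u' & _ & H)|(u & u' & w & w' & _ & _ & [H|H])]]];
      code_eq; reflexivity.
  - intros ->. apply Der_close0; [apply rMapTerm_mono|]. right; left. reflexivity.
Qed.
Lemma MapTerm_Succ t y :
  mMapTerm V (qSucc t) y <-> exists t', mMapTerm V t t' /\ y = qSucc t'.
Proof.
  split.
  - intros H. apply Der_inv in H; [|apply rMapTerm_mono].
    destruct H as [(j & u & K & H)|[H|[(u & u' & K & H)|(u & u' & w & w' & _ & _ & [H|H])]]];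
      code_eq. now exists u'.
  - intros (t' & H & ->). eapply Der_close1; [apply rMapTerm_mono|exact H|].
    right; right; left. now exists t, t'.
Qed.
Lemma MapTerm_Add t u y : mMapTerm V (qAdd t u) y <->
  exists t' u', mMapTerm V t t' /\ mMapTerm V u u' /\ y = qAdd t' u'.
Proof.
  split.
  - intros H. apply Der_inv in H; [|apply rMapTerm_mono].
    destruct H as [(j & v & K & H)|[H|[(v & v' & K & H)|(v & v' & w & w' & K & K' & [H|H])]]];
      code_eq. now exists v', w'.
  - intros (t' & u' & H & K & ->). eapply Der_close; [apply rMapTerm_mono|exact H|exact K|].
    right; right; right. exists t, t', u, u'. auto 6.
Qed.
Lemma MapTerm_Mul t u y : mMapTerm V (qMul t u) y <->
  exists t' u', mMapTerm V t t' /\ mMapTerm V u u' /\ y = qMul t' u'.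
Proof.
  split.
  - intros H. apply Der_inv in H; [|apply rMapTerm_mono].
    destruct H as [(j & v & K & H)|[H|[(v & v' & K & H)|(v & v' & w & w' & K & K' & [H|H])]]];
      code_eq. now exists v', w'.
  - intros (t' & u' & H & K & ->). eapply Der_close; [apply rMapTerm_mono|exact H|exact K|].
    right; right; right. exists t, t', u, u'. auto 6.
Qed.
End MapTerm.

(** The recursion is over actual terms, whereas [a i] is any element: so this is a
    code in the model, possibly of a term with nonstandard numerals. *)
Fixpoint tcode (a : nat -> M) (t : term) : M :=
  match t with
  | Var i => a i
  | Zero => qZero
  | Succ t => qSucc (tcode a t)
  | Add t u => qAdd (tcode a t) (tcode a u)
  | Mul t u => qMul (tcode a t) (tcode a u)
  end.

Definition cvar (i : nat) : M := qVar (std i).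

Lemma std_gn_term t : std (gn_term t) = tcode cvar t.
Proof.
  induction t; cbn [gn_term tcode]; rewrite !std_pair; rewrite ?IHt, ?IHt1, ?IHt2;
    reflexivity.
Qed.

Lemma tcode_map a s t : tcode a (map_term s t) = tcode (fun i => tcode a (s i)) t.
Proof. induction t; simpl; congruence. Qed.

Lemma MapTerm_code V a b t : (forall i y, mMapTerm V (a i) y <-> y = b i) ->
  forall y, mMapTerm V (tcode a t) y <-> y = tcode b t.
Proof.
  intros H. induction t; intros y; simpl.
  - apply H.
  - apply MapTerm_Zero.
  - rewrite MapTerm_Succ. split.
    + intros (t' & K & ->). apply IHt in K as ->. reflexivity.
    + intros ->. eexists; split; [|reflexivity]. now apply IHt.
  - rewrite MapTerm_Add. split.
    + intros (t' & u' & K & L & ->). apply IHt1 in K as ->. apply IHt2 in L as ->. reflexivity.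
    + intros ->. do 2 eexists; repeat split; [now apply IHt1|now apply IHt2].
  - rewrite MapTerm_Mul. split.
    + intros (t' & u' & K & L & ->). apply IHt1 in K as ->. apply IHt2 in L as ->. reflexivity.
    + intros ->. do 2 eexists; repeat split; [now apply IHt1|now apply IHt2].
Qed.

(** ** Formulas *)

Section MapForm.
Variable V : M -> M -> M -> Prop.
Lemma MapForm_Equ k t u y : mMapForm V k (qEqu t u) y <->
  exists t' u', mMapTerm (V k) t t' /\ mMapTerm (V k) u u' /\ y = qEqu t' u'.
Proof.
  split.
  - intros H. apply Der_inv in H; [|apply rMapForm_mono].
    destruct H as [k' [(a & a' & b & b' & K & K' & [H|H])|[H|[(g & g' & h & h' & K & K' & H)|
      (g & g' & K & H)]]]]; code_eq. now exists a', b'.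
  - intros (t' & u' & H & K & ->). apply Der_close0; [apply rMapForm_mono|].
    exists k. left. exists t, t', u, u'. auto.
Qed.
Lemma MapForm_Less k t u y : mMapForm V k (qLess t u) y <->
  exists t' u', mMapTerm (V k) t t' /\ mMapTerm (V k) u u' /\ y = qLess t' u'.
Proof.
  split.
  - intros H. apply Der_inv in H; [|apply rMapForm_mono].
    destruct H as [k' [(a & a' & b & b' & K & K' & [H|H])|[H|[(g & g' & h & h' & K & K' & H)|
      (g & g' & K & H)]]]]; code_eq. now exists a', b'.
  - intros (t' & u' & H & K & ->). apply Der_close0; [apply rMapForm_mono|].
    exists k. left. exists t, t', u, u'. auto.
Qed.
Lemma MapForm_Bot k y : mMapForm V k qBot y <-> y = qBot.
Proof.
  split.
  - intros H. apply Der_inv in H; [|apply rMapForm_mono].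
    destruct H as [k' [(a & a' & b & b' & K & K' & [H|H])|[H|[(g & g' & h & h' & K & K' & H)|
      (g & g' & K & H)]]]]; code_eq. reflexivity.
  - intros ->. apply Der_close0; [apply rMapForm_mono|]. exists k. right; left. reflexivity.
Qed.
Lemma MapForm_Imp k g h y : mMapForm V k (qImp g h) y <->
  exists g' h', mMapForm V k g g' /\ mMapForm V k h h' /\ y = qImp g' h'.
Proof.
  split.
  - intros H. apply Der_inv in H; [|apply rMapForm_mono].
    destruct H as [k' [(a & a' & b & b' & K & K' & [H|H])|[H|[(g1 & g' & h1 & h' & K & K' & H)|
      (g1 & g' & K & H)]]]]; code_eq. now exists g', h'.
  - intros (g' & h' & H & K & ->). eapply Der_close; [apply rMapForm_mono|exact H|exact K|].
    exists k. right; right; left. exists g, g', h, h'. auto.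
Qed.
Lemma MapForm_All k g y : mMapForm V k (qAll g) y <->
  exists g', mMapForm V (su k) g g' /\ y = qAll g'.
Proof.
  split.
  - intros H. apply Der_inv in H; [|apply rMapForm_mono].
    destruct H as [k' [(a & a' & b & b' & K & K' & [H|H])|[H|[(g1 & g' & h1 & h' & K & K' & H)|
      (g1 & g' & K & H)]]]]; code_eq. now exists g'.
  - intros (g' & H & ->). eapply Der_close1; [apply rMapForm_mono|exact H|].
    exists k. right; right; right. exists g, g'. auto.
Qed.
End MapForm.

(** Here [a k i] is put for the variable #i at an occurrence under k binders. *)
Fixpoint fcode (a : nat -> nat -> M) (k : nat) (f : form) : M :=
  match f with
  | Equ t u => qEqu (tcode (a k) t) (tcode (a k) u)
  | Less t u => qLess (tcode (a k) t) (tcode (a k) u)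
  | Bot => qBot
  | Imp f g => qImp (fcode a k f) (fcode a k g)
  | All f => qAll (fcode a (S k) f)
  end.

Lemma fcode_Imp a k f g : fcode a k (Imp f g) = qImp (fcode a k f) (fcode a k g).
Proof. reflexivity. Qed.
Lemma fcode_All a k f : fcode a k (All f) = qAll (fcode a (S k) f).
Proof. reflexivity. Qed.

Lemma std_gn k f : std (gn f) = fcode (fun _ => cvar) k f.
Proof.
  revert k; induction f; intros k; cbn [gn fcode]; rewrite !std_pair, ?std_gn_term;
    rewrite <- ?IHf, <- ?IHf1, <- ?IHf2; reflexivity.
Qed.

Lemma fcode_map v k f :
  fcode (fun _ => cvar) k (map_form v k f) = fcode (fun k i => tcode cvar (v k i)) k f.
Proof.
  revert k; induction f; intros k; cbn [map_form fcode];
    rewrite ?tcode_map, ?IHf, ?IHf1, ?IHf2; reflexivity.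
Qed.

Lemma fcode_map_S a v k f :
  fcode a (S k) (map_form v k f) = fcode (fun k i => tcode (a (S k)) (v k i)) k f.
Proof.
  revert k; induction f; intros k; cbn [map_form fcode];
    rewrite ?tcode_map, ?IHf, ?IHf1, ?IHf2; reflexivity.
Qed.

Lemma tcode_closed a b n t : closed_term n t -> (forall i, (i < n)%nat -> a i = b i) ->
  tcode a t = tcode b t.
Proof. intros H E; induction t; simpl in *; f_equal; intuition. Qed.

Lemma fcode_closed a b f : forall n k k', closed_form n f ->
  (forall j i, (i < n + j)%nat -> a (k + j)%nat i = b (k' + j)%nat i) ->
  fcode a k f = fcode b k' f.
Proof.
  induction f; intros n k k' H E; cbn [closed_form fcode] in *.
  1,2: destruct H; f_equal; eapply tcode_closed; try eassumption; intros i Hi;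
    specialize (E 0 i); rewrite !Nat.add_0_r in E; auto.
  - reflexivity.
  - destruct H. f_equal; eauto.
  - f_equal. eapply IHf; [exact H|]. intros j i Hi.
    replace (S k + j)%nat with (k + S j)%nat by lia.
    replace (S k' + j)%nat with (k' + S j)%nat by lia. apply E. lia.
Qed.

(** On codes of actual formulas the arithmetized replacement is a function, and
    is computed by recursion on the formula. *)
Lemma MapForm_code V a b f :
  (forall k i y, mMapTerm (V (std k)) (a k i) y <-> y = b k i) ->
  forall k y, mMapForm V (std k) (fcode a k f) y <-> y = fcode b k f.
Proof.
  intros H. induction f; intros k y; cbn [fcode].
  - assert (E := fun t => MapTerm_code t (H k)). rewrite MapForm_Equ. split.
    + intros (t' & u' & K & L & ->). apply E in K as ->. apply E in L as ->. reflexivity.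
    + intros ->. do 2 eexists; repeat split; now apply E.
  - assert (E := fun t => MapTerm_code t (H k)). rewrite MapForm_Less. split.
    + intros (t' & u' & K & L & ->). apply E in K as ->. apply E in L as ->. reflexivity.
    + intros ->. do 2 eexists; repeat split; now apply E.
  - apply MapForm_Bot.
  - rewrite MapForm_Imp. split.
    + intros (t' & u' & K & L & ->). apply IHf1 in K as ->. apply IHf2 in L as ->. reflexivity.
    + intros ->. do 2 eexists; repeat split; [now apply IHf1|now apply IHf2].
  - rewrite MapForm_All. change (su (std k)) with (@std M (S k)). split.
    + intros (t' & K & ->). apply IHf in K as ->. reflexivity.
    + intros ->. eexists; split; [|reflexivity]. now apply IHf.
Qed.

(** ** Numerals *)

Lemma Num_0 (t : M) : mNum ze t <-> t = qZero.
Proof.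
  split.
  - intros H. apply Der_inv in H; [|apply rNum_mono].
    destruct H as [H|(m & u & _ & H)]; code_eq; [reflexivity|].
    now apply eq_sym, su_ne0 in H0.
  - intros ->. apply Der_close0; [apply rNum_mono|]. now left.
Qed.
Lemma Num_S (n t : M) : mNum (su n) t <-> exists u, mNum n u /\ t = qSucc u.
Proof.
  split.
  - intros H. apply Der_inv in H; [|apply rNum_mono].
    destruct H as [H|(m & u & K & H)]; code_eq; [now apply su_ne0 in H0|].
    apply su_inj in H0 as ->. now exists u.
  - intros (u & H & ->). eapply Der_close1; [apply rNum_mono|exact H|].
    right. now exists n, u.
Qed.

Lemma Num_ex (n : M) : exists t, mNum n t.
Proof.
  revert n. apply ind; [defn|exists qZero; now apply Num_0|].
  intros n [t H]. exists (qSucc t). apply Num_S. now exists t.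
Qed.

Lemma Num_unique (n t u : M) : mNum n t -> mNum n u -> t = u.
Proof.
  revert t u. apply (@ind M (fun n => forall t u : M, mNum n t -> mNum n u -> t = u)) with (x := n).
  - defn.
  - intros t u ->%Num_0 ->%Num_0. reflexivity.
  - intros m IH t u (t' & H & ->)%Num_S (u' & K & ->)%Num_S. f_equal. eauto.
Qed.

Definition qnum (n : M) : M := epsilon (inhabits ze) (mNum n).

Lemma Num_iff (n t : M) : mNum n t <-> t = qnum n.
Proof.
  assert (H : mNum n (qnum n)) by exact (epsilon_spec (inhabits ze) (mNum n) (Num_ex n)).
  split; [intros K; eauto using Num_unique|now intros ->].
Qed.
Lemma qnum_0 : qnum ze = qZero.
Proof. symmetry. now apply Num_iff, Num_0. Qed.
Lemma qnum_S n : qnum (su n) = qSucc (qnum n).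
Proof. symmetry. apply Num_iff, Num_S. exists (qnum n). split; [now apply Num_iff|easy]. Qed.

Lemma qnum_std a n : qnum (std n) = tcode a (num n).
Proof.
  induction n; [apply qnum_0|]. change (@std M (S n)) with (su (@std M n)).
  rewrite qnum_S, IHn. reflexivity.
Qed.

(** A numeral has no variables; as its length may be nonstandard, this takes an
    induction in the model. *)
Lemma MapTerm_qnum V n y : definable2 V -> mMapTerm V (qnum n) y <-> y = qnum n.
Proof.
  intros (w & v & D).
  enough (H : forall n t : M, mNum n t -> forall y, mMapTerm V t y <-> y = t).
  { apply H with (n := n). now apply Num_iff. }
  clear n y. apply (@ind M (fun n => forall t : M, mNum n t -> forall y, mMapTerm V t y <-> y = t)).
  - exists w. eexists. means.
  - intros t ->%Num_0 y. apply MapTerm_Zero.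
  - intros n IH t (u & Hu & ->)%Num_S y. rewrite MapTerm_Succ. split.
    + intros (t' & K & ->). apply (IH _ Hu) in K as ->. reflexivity.
    + intros ->. exists u. split; [|reflexivity]. now apply (IH _ Hu).
Qed.

(** ** Instantiation *)

Lemma std_lt i k : @std M i < std k <-> (i < k)%nat.
Proof.
  assert (H : forall i k, (i < k)%nat -> @std M i < std k).
  { clear. intros i k H. replace k with (i + S (k - S i))%nat by lia.
    rewrite std_ad. apply lt_ad. }
  split; [|apply H]. intros K. destruct (Nat.lt_total i k) as [L|[->|L]]; [exact L|..].
  - now apply lt_irrefl in K.
  - apply H in L. now apply (lt_asym K) in L.
Qed.

(** All codes of formulas that occur below have variables or numerals at the
    places of the variables of an actual formula. *)
Definition entry : Type := (nat + M)%type.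
Definition ecode (e : entry) : M := match e with inl j => cvar j | inr n => qnum n end.

(** This mirrors [inst_var]; [sh k] is the code of the k-fold shift of the
    instantiating term. *)
Definition inst_entry (sh : nat -> M) (k : nat) (e : entry) : M :=
  match e with
  | inl j => if j <? k then cvar j else if j =? k then sh k else cvar (pred j)
  | inr n => qnum n
  end.

Lemma Inst_entry s sh k e y :
  (forall k y, mShiftTerm (std k) s y <-> y = sh k) ->
  mMapTerm (mInstVar s (std k)) (ecode e) y <-> y = inst_entry sh k e.
Proof.
  intros Hs. destruct e as [j|n]; simpl.
  - unfold cvar. rewrite MapTerm_Var. unfold mInstVar. rewrite !std_lt.
    destruct (Nat.ltb_spec j k) as [L|L]; [|destruct (Nat.eqb_spec j k) as [->|N]].
    + split; [|tauto].
      intros [[_ H]|[[H _]|(i & H & _)]]; [exact H| |apply std_lt in H; lia].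
      apply std_inj in H. lia.
    + split.
      * intros [[H _]|[[_ H]|(i & H & _)]]; [lia| |apply std_lt in H; lia]. now apply Hs.
      * intros ->. right; left. split; [reflexivity|]. now apply Hs.
    + split.
      * intros [[H _]|[[H _]|(i & _ & H & ->)]]; [lia|apply std_inj in H; lia|].
        destruct j; [lia|]. apply su_inj in H. subst i. reflexivity.
      * intros ->. right; right. exists (std (pred j)). split; [apply std_lt; lia|].
        split; [|reflexivity]. destruct j; [lia|reflexivity].
  - apply MapTerm_qnum.
    unfold definable2. pose (w := (0, fun _ => ze) : world M).
    defn_param w s. defn_param w (@std M k). defn_end w.
Qed.

Lemma Inst_code s sh d f y :
  (forall k y, mShiftTerm (std k) s y <-> y = sh k) ->
  mInst s (fcode (fun k i => ecode (d k i)) 0 f) y <->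
  y = fcode (fun k i => inst_entry sh k (d k i)) 0 f.
Proof. intros Hs. apply MapForm_code. intros k i z. now apply Inst_entry. Qed.

Lemma ShiftTerm_qnum k n y : mShiftTerm k (qnum n) y <-> y = qnum n.
Proof.
  apply MapTerm_qnum. unfold definable2. pose (w := (0, fun _ => ze) : world M).
  defn_param w k. defn_end w.
Qed.

Lemma InstNum_code n d f y :
  mInstNum (fcode (fun k i => ecode (d k i)) 0 f) n y <->
  y = fcode (fun k i => inst_entry (fun _ => qnum n) k (d k i)) 0 f.
Proof.
  rewrite <- (@Inst_code (qnum n)) by (intros; apply ShiftTerm_qnum).
  split.
  - intros (t & ->%Num_iff & H). exact H.
  - intros H. exists (qnum n). split; [now apply Num_iff|exact H].
Qed.

End Codes.

(** * Provability inside a model *)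

Section Provability.
Variable M : model.
Local Open Scope m_scope.
Implicit Types x y z : M.

Definition gcode (f : form) : M := fcode (fun _ => @cvar M) 0 f.

Lemma gcode_at k f : fcode (fun _ => @cvar M) k f = gcode f.
Proof. unfold gcode. rewrite <- !std_gn. reflexivity. Qed.

Lemma Term_code n t : closed_term n t -> mTerm (std n) (tcode (@cvar M) t).
Proof.
  induction t; simpl.
  - intros H. apply Der_close0; [apply rTerm_mono|]. left. exists (std i).
    split; [now apply std_lt|reflexivity].
  - intros _. apply Der_close0; [apply rTerm_mono|]. right; left. reflexivity.
  - intros H. eapply Der_close1; [apply rTerm_mono|exact (IHt H)|].
    right; right; left. eauto.
  - intros [H K]. eapply Der_close; [apply rTerm_mono|exact (IHt1 H)|exact (IHt2 K)|].
    right; right; right. eauto 8.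
  - intros [H K]. eapply Der_close; [apply rTerm_mono|exact (IHt1 H)|exact (IHt2 K)|].
    right; right; right. eauto 8.
Qed.

Lemma Form_code f : forall n, closed_form n f -> mForm (@std M n) (gcode f).
Proof.
  unfold mForm. induction f; intros n; simpl.
  - intros [H K]. apply Der_close0; [apply rForm_mono|]. do 2 eexists.
    split; [reflexivity|]. left. eauto 8 using Term_code.
  - intros [H K]. apply Der_close0; [apply rForm_mono|]. do 2 eexists.
    split; [reflexivity|]. left. eauto 8 using Term_code.
  - intros _. apply Der_close0; [apply rForm_mono|]. do 2 eexists.
    split; [reflexivity|]. right; left. reflexivity.
  - intros [H K]. eapply Der_close; [apply rForm_mono|exact (IHf1 _ H)|exact (IHf2 _ K)|].
    do 2 eexists. split; [reflexivity|]. right; right; left. eauto 8.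
  - intros H. eapply Der_close1; [apply rForm_mono|exact (IHf _ H)|].
    do 2 eexists. split; [reflexivity|]. right; right; right.
    exists (gcode f). split; [reflexivity|]. unfold gcode; cbn [fcode].
    now rewrite (gcode_at 1).
Qed.

Lemma IsTerm_code t : mIsTerm (tcode (@cvar M) t).
Proof. exists (std (term_bound t)). apply Term_code, term_boundP. Qed.
Lemma IsForm_code f : mIsForm (gcode f).
Proof. exists (std (bound f)). apply Form_code, boundP. Qed.

Lemma IsTerm_qnum n : mIsTerm (@qnum M n).
Proof.
  exists ze. enough (H : forall n t : M, mNum n t -> mTerm ze t).
  { apply (H n). now apply Num_iff. }
  clear n. apply (@ind M (fun n => forall t : M, mNum n t -> mTerm ze t)).
  - defn.
  - intros t ->%Num_0. apply Der_close0; [apply rTerm_mono|]. right; left. reflexivity.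
  - intros n IH t (u & Hu & ->)%Num_S.
    eapply Der_close1; [apply rTerm_mono|exact (IH u Hu)|]. right; right; left. eauto.
Qed.

Lemma ShiftTerm_code k t y :
  mShiftTerm (std k) (tcode (@cvar M) t) y <-> y = tcode (@cvar M) (shift_term k t).
Proof.
  unfold shift_term. rewrite tcode_map. apply MapTerm_code.
  intros i z. unfold cvar at 1. rewrite MapTerm_Var. simpl. unfold cvar.
  rewrite std_ad. reflexivity.
Qed.

Lemma Shift_code f y : mShift (gcode f) y <-> y = gcode (shift f).
Proof.
  unfold gcode, shift. rewrite fcode_map.
  apply MapForm_code with (k := 0). intros k i z.
  unfold cvar at 1. rewrite MapTerm_Var. unfold mShiftVar, shift_var. rewrite std_lt.
  destruct (Nat.ltb_spec i k); simpl; unfold cvar; intuition lia.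
Qed.

Lemma Step_code f y : mStep (gcode f) y <-> y = gcode (step f).
Proof.
  unfold gcode, step. rewrite fcode_map.
  apply MapForm_code with (k := 0). intros k i z.
  unfold cvar at 1. rewrite MapTerm_Var. unfold mStepVar, step_var.
  destruct (Nat.eqb_spec i k) as [->|N]; simpl; unfold cvar.
  - intuition congruence.
  - split; [|intros ->; right; split; [|reflexivity]; intros H; now apply std_inj in H].
    intros [[H _]|[_ H]]; [now apply std_inj in H|exact H].
Qed.

Lemma Inst_std s f y : mInst (tcode (@cvar M) s) (gcode f) y <-> y = gcode (inst s f).
Proof.
  pose (sh := fun k => tcode (@cvar M) (shift_term k s)).
  assert (E := fun y => @Inst_code M (tcode (@cvar M) s) sh (fun _ i => inl i) f y
    (fun k z => ShiftTerm_code k s z)).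
  change (fcode _ 0 f) with (gcode f) in E at 1. rewrite E.
  unfold gcode, inst. rewrite fcode_map.
  replace (fun k i => inst_entry sh k (inl i)) with
    (fun k i => tcode (@cvar M) (inst_var s k i)); [reflexivity|].
  extensionality k; extensionality i. unfold inst_var, inst_entry, sh.
  destruct (i <? k); [reflexivity|]. now destruct (i =? k).
Qed.

Section Theory.
Variable Ax : M -> Prop.

Lemma rPrv_mono : monotone (rPrv Ax).
Proof.
  intros y D E H [K|[K|[(f & D1 & D2)|(f & D1 & K)]]].
  - left; exact K.
  - right; left; exact K.
  - right; right; left. exists f. auto.
  - right; right; right. exists f. auto.
Qed.

Lemma Prv_logic y : mLogicalAxiom y -> mPrv Ax y.
Proof. intros H. apply Der_close0; [apply rPrv_mono|]. now left. Qed.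
Lemma Prv_axiom y : Ax y -> mPrv Ax y.
Proof. intros H. apply Der_close0; [apply rPrv_mono|]. right; now left. Qed.
Lemma Prv_mp y z : mPrv Ax y -> mPrv Ax (qImp y z) -> mPrv Ax z.
Proof.
  intros H K. eapply Der_close; [apply rPrv_mono|exact H|exact K|].
  right; right; left. eauto.
Qed.
Lemma Prv_gen y : mPrv Ax y -> mPrv Ax (qAll y).
Proof.
  intros H. eapply Der_close1; [apply rPrv_mono|exact H|].
  right; right; right. eauto.
Qed.

Lemma LogicalAxiom_code f : logical_axiom f -> mLogicalAxiom (gcode f).
Proof.
  unfold mLogicalAxiom. destruct 1; unfold gcode, Neg; cbn [fcode]; rewrite ?gcode_at.
  - left. eauto 8 using IsForm_code.
  - right; left. eauto 10 using IsForm_code.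
  - right; right; left. exists (gcode f). split; [apply IsForm_code|reflexivity].
  - right; right; right; left. exists (tcode (@cvar M) s), (gcode f), (gcode (inst s f)).
    repeat split; auto using IsForm_code, IsTerm_code. now apply Inst_std.
  - do 4 right; left. eauto 8 using IsForm_code.
  - do 5 right; left. exists (gcode f), (gcode (shift f)).
    repeat split; auto using IsForm_code. now apply Shift_code.
  - do 6 right; left. eauto 8 using IsTerm_code.
  - do 7 right.
    exists (tcode (@cvar M) s), (tcode (@cvar M) t), (gcode f), (gcode (inst s f)),
      (gcode (inst t f)).
    repeat split; auto using IsForm_code, IsTerm_code; now apply Inst_std.
Qed.

Lemma AxPA_code f : PA f -> mAxPA (gcode f).
Proof.
  unfold mAxPA. destruct 1 as [f H|f].
  - unfold gcode. rewrite <- std_gn. induction PA_base as [|g l IH]; [destruct H|].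
    destruct H as [->|H]; [now left|]. right. now apply IH.
  - enough (H : exists g0 g h : M, mIsForm g0 /\ mInst qZero g0 g /\ mStep g0 h /\
       gcode (induction f) = qImp g (qImp (qAll (qImp g0 h)) (qAll g0))).
    { induction PA_base as [|g l IH]; [exact H|]. now right. }
    exists (gcode f), (gcode (inst Zero f)), (gcode (step f)).
    repeat split; auto using IsForm_code.
    + now apply (Inst_std Zero).
    + now apply Step_code.
    + unfold induction, gcode; cbn [fcode]. now rewrite !gcode_at.
Qed.

Hypothesis Ax_PA : forall y, mAxPA y -> Ax y.

(** The first derivability condition: each step of an actual derivation is a step
    in the sense of the model. *)
Lemma provable_Prv f : provable PA f -> mPrv Ax (gcode f).
Proof.
  induction 1 as [f H|f H|f g _ IH1 _ IH2|f _ IH].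
  - now apply Prv_logic, LogicalAxiom_code.
  - now apply Prv_axiom, Ax_PA, AxPA_code.
  - exact (Prv_mp IH1 IH2).
  - unfold gcode; cbn [fcode]; rewrite gcode_at. now apply Prv_gen.
Qed.

(** The element n may be nonstandard: only the derivation of the universal formula
    is an actual one, and it is followed by one instantiation in the model. *)
Lemma Prv_inst f n : provable PA (All f) ->
  mPrv Ax (fcode (fun k i => inst_entry (fun _ => qnum n) k (inl i)) 0 f).
Proof.
  intros H. apply provable_Prv in H. unfold gcode in H; cbn [fcode] in H.
  rewrite gcode_at in H. refine (Prv_mp H _). apply Prv_logic.
  right; right; right; left. exists (qnum n), (gcode f). eexists.
  repeat split; auto using IsTerm_qnum, IsForm_code.
  apply (@Inst_code M (qnum n) (fun _ => qnum n) (fun _ i => inl i));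
    [intros; apply ShiftTerm_qnum|reflexivity].
Qed.
End Theory.
End Provability.

Ltac means_syntax7 :=
  first [ means_syntax6 |
  match goal with
  | |- means _ _ (mPrvDot _ _ _) => refine (means_PrvDot _ _ _)
  | |- means _ _ (mAxOpen _ _ _ _ _) => refine (means_AxOpen _ _ _ _ _)
  end ].
Ltac means_base ::= means_syntax7.

(* Gödel numbers are unary and huge: they must not be computed. *)
Opaque gn num.

(** * Reflection along an ill-founded order *)

(** This makes closed formulas out of formulas written with binders, whose
    meaning is independent of the variables outside their scope. *)
Definition cut (n : nat) (f : form) : form :=
  sub (fun i => if i <? n then Var i else Zero) f.

Lemma closed_cut n f : closed_form n (cut n f).
Proof.
  apply closed_sub. intros i. destruct (Nat.ltb_spec i n); simpl; auto.
Qed.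

(** The variables of [antecedent] are v, z, f, x.  Numerals are put for v and f;
    x becomes the variable of a quantifier in front of the formula, and z the
    first variable outside that quantifier. *)
Definition ant_var (v f k i : nat) : term :=
  if i <? k then Var i else
  match i - k with
  | 0 => num v | 1 => Var (S k) | 2 => num f | 3 => Var k
  | S (S (S (S j))) => Var (S (S (k + j)))
  end.

Lemma ant_var_up v f k : ant_var v f (S k) = up (ant_var v f k).
Proof.
  extensionality i. destruct i as [|i]; [reflexivity|]. unfold ant_var. cbn [up push].
  change (S i <? S k) with (i <? k). destruct (Nat.ltb_spec i k) as [H|H]; [reflexivity|].
  change (S i - S k) with (i - k).
  destruct (i - k) as [|[|[|[|j]]]]; cbn [map_term]; rewrite ?map_term_num; reflexivity.
Qed.

Definition inst_e (M : model) (n : M) (k : nat) (e : entry M) : entry M :=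
  match e with
  | inl j => if j <? k then inl j else if j =? k then inr n else inl (pred j)
  | inr m => inr m
  end.

Lemma InstNum_entries (M : model) (n : M) (c : nat -> nat -> entry M) f y :
  mInstNum (fcode (fun k i => ecode (c k i)) 0 f) n y <->
  y = fcode (fun k i => ecode (inst_e n k (c k i))) 0 f.
Proof.
  rewrite InstNum_code.
  replace (fun k i => inst_entry _ k (c k i)) with
    (fun k i => ecode (inst_e n k (c k i))); [reflexivity|].
  extensionality k; extensionality i. unfold inst_e, inst_entry.
  destruct (c k i) as [j|m]; [|reflexivity].
  destruct (j <? k); [reflexivity|]. now destruct (j =? k).
Qed.

(** The left-hand side comes from instantiating a sentence proved in PA, the
    right-hand side from the definition of the axioms of the iteration: numerals
    are put for v, z, f in turn. *)
Lemma ant_var_code (M : model) (v f : nat) (z : M) g :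
  fcode (fun k i => inst_entry (fun _ => qnum z) k (inl i)) 1 (map_form (ant_var v f) 0 g) =
  fcode (fun k i => ecode (inst_e (std f) k (inst_e z k (inst_e (std v) k (inl i))))) 0 g.
Proof.
  rewrite fcode_map_S.
  replace (fun k i => tcode _ _) with (fun k i =>
    ecode (inst_e (std f) k (inst_e z k (inst_e (@std M v) k (inl i))))); [reflexivity|].
  extensionality k; extensionality i. unfold ant_var, inst_e.
  assert (E : i < k \/ exists j, i = k + j).
  { destruct (Nat.lt_ge_cases i k); [now left|right; exists (i - k); lia]. }
  destruct E as [L|[j ->]]; [|replace (k + j - k) with j by lia;
    destruct j as [|[|[|[|j]]]]];
    repeat (cbn [ecode tcode inst_entry]; match goal with
    | |- context [?a <? ?b] => destruct (Nat.ltb_spec a b); try lia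
    | |- context [?a =? ?b] => destruct (Nat.eqb_spec a b); try lia
    end);
    cbn [ecode]; first [apply qnum_std | f_equal; lia].
Qed.

Section Reflection.
Variables (l : nat) (phi : form) (top : nat).
Variable desc : tm -> fm.
Variable Desc : forall M : model, M -> Prop.
Hypothesis phi_sentence : sentence phi.
Hypothesis desc_meaning : forall (M : model) (w : world M) t x,
  den w t x -> means w (desc t) (Desc x).
Hypothesis order_linear : forall M : model, mLO (@std M l).
Hypothesis desc_top : forall M : model, mDom (std l) (@std M top) /\ Desc (@std M top).
Hypothesis desc_down : forall (M : model) (r : nat -> M), ~ tr r phi ->
  forall x : M, Desc x -> exists y, mLt (std l) y x /\ Desc y.

Let ant : form := antecedent aAxPA l.
Let v : nat := gn ant.

(** The theory is the one attached to z, and the formula coded by f is taken at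
    the numeral of x. *)
Definition Prf (M : model) (z f x : M) : Prop :=
  mPrvDot (mAxOpen (@mAxPA M) (std l) (std v) z) f x.

Lemma antecedent_meaning (M : model) (r : nat -> M) :
  tr r ant <-> mPrvDot (mAxOpen (@mAxPA M) (std l) (r 0) (r 1)) (r 2) (r 3).
Proof.
  assert (H3 := @den_level M 4 r 3 ltac:(lia)). assert (H2 := @den_level M 4 r 2 ltac:(lia)).
  assert (H1 := @den_level M 4 r 1 ltac:(lia)). assert (H0 := @den_level M 4 r 0 ltac:(lia)).
  simpl in H0, H1, H2, H3.
  assert (H : means (4, r) (aPrvDot (aAxOpen aAxPA (hnum l) (level 3) (level 2))
    (level 1) (level 0)) (mPrvDot (mAxOpen (@mAxPA M) (std l) (r 0) (r 1)) (r 2) (r 3)))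
    by means.
  unfold ant, antecedent; cbv zeta. specialize (H _ (later_refl _)). exact H.
Qed.

(** This is ¬Y(z), in the manner of Yablo's paradox.  For the diagonalization, u
    stands for the code of this very formula in the variables u and z, and k is
    the code of the result of putting the numeral of u for u. *)
Definition yablo_open (u z : tm) : fm :=
  (¬ (¬ hform phi [] ∧ desc z ∧
      ∀ k c e, aInstNum u u k ∧ aLe (hnum l) c z ∧ aLt (hnum l) e c ⇒
        hform ant [hnum v; c; k; e]))%fm.
Definition yablo0 : form := cut 2 (yablo_open (level 1) (level 0) 2).
Definition yablo : form := inst (num (gn yablo0)) yablo0.

Lemma closed_yablo : closed_form 1 yablo.
Proof.
  unfold yablo. generalize (gn yablo0) as n. intros n.
  unfold yablo0, cut. rewrite inst_sub, sub_comp. apply closed_sub.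
  intros i. destruct (Nat.ltb_spec i 2) as [H|H]; cbn [map_term]; [|exact I].
  destruct i as [|[|i]]; cbn [push]; [|exact Nat.lt_0_1|lia].
  induction n; [exact I|exact IHn].
Qed.

Lemma yablo_meaning (M : model) (r : nat -> M) :
  tr r yablo <-> ~ (~ tr r phi /\ Desc (r 0) /\
    forall c e : M, mLe (std l) c (r 0) /\ mLt (std l) e c -> Prf c (std (gn yablo)) e).
Proof.
  unfold yablo. rewrite tr_inst, ev_num. unfold yablo0 at 2, cut. rewrite tr_sub.
  set (u := gn yablo0).
  set (s := fun i => ev _ _).
  assert (H1 := @den_level M 2 s 1 ltac:(lia)). assert (H0 := @den_level M 2 s 0 ltac:(lia)).
  change (s (2 - 2)) with (@std M u) in H1. change (s (2 - 1)) with (r 0) in H0.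
  assert (H : means (2, s) (yablo_open (level 1) (level 0))
    (~ (~ @tr M (fun i => nth i [] ze) phi /\ Desc (r 0) /\
      forall k c e : M, mInstNum (std u) (std u) k /\ mLe (std l) c (r 0) /\
        mLt (std l) e c -> @tr M (fun i => nth i [std v; c; k; e] ze) ant))).
  { unfold yablo_open. means.
    - apply means_hform, Forall2_nil.
    - now apply desc_meaning.
    - apply means_hform. repeat apply Forall2_cons; [..|apply Forall2_nil]; means. }
  transitivity (~ (~ @tr M (fun i => nth i [] ze) phi /\ Desc (r 0) /\
      forall k c e : M, mInstNum (std u) (std u) k /\ mLe (std l) c (r 0) /\
        mLt (std l) e c -> @tr M (fun i => nth i [std v; c; k; e] ze) ant)).
  { exact (H _ (later_refl _)). }
  clear H.
  assert (E : @tr M (fun i => nth i [] ze) phi <-> tr r phi).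
  { apply tr_closed with (n := 0); [exact phi_sentence|lia]. }
  rewrite E.
  assert (K : forall k : M, mInstNum (std u) (std u) k <-> k = std (gn yablo)).
  { intros k. unfold u at 1. rewrite (std_gn M 0 yablo0).
    rewrite (@InstNum_code M (std u) (fun _ i => inl i) yablo0 k).
    rewrite (std_gn M 0 yablo). unfold yablo, inst. rewrite fcode_map. fold u.
    replace (fun k i => tcode _ _) with
      (fun k i => inst_entry (fun _ => qnum (@std M u)) k (inl i)); [reflexivity|].
    extensionality j; extensionality i. unfold inst_entry, inst_var.
    destruct (i <? j); [reflexivity|]. destruct (i =? j); [|reflexivity].
    rewrite (qnum_std (@cvar M)). f_equal. unfold shift_term. now rewrite map_term_num. }
  unfold Prf. fold ant.
  assert (E2 : (forall k c e : M, mInstNum (std u) (std u) k /\ mLe (std l) c (r 0) /\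
      mLt (std l) e c -> @tr M (fun i => nth i [std v; c; k; e] ze) ant) <->
    (forall c e : M, mLe (std l) c (r 0) /\ mLt (std l) e c ->
      mPrvDot (mAxOpen (@mAxPA M) (std l) (std v) c) (std (gn yablo)) e)).
  { split.
    - intros A c e [B C]. specialize (A (std (gn yablo)) c e).
      rewrite antecedent_meaning in A. apply A. split; [now apply K|tauto].
    - intros A k c e (Hk & B & C). apply K in Hk as ->. rewrite antecedent_meaning.
      apply A. now split. }
  rewrite E2. reflexivity.
Qed.

(** The premise is, at each numeral for the free variable z, literally the axiom
    of reflection for the theory attached to z and the formula [yablo]. *)
Definition step_form : form := Imp (All (Imp (map_form (ant_var v (gn yablo)) 0 ant) yablo)) yablo.

Lemma ant_var_meaning (M : model) (r : nat -> M) :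
  tr r (map_form (ant_var v (gn yablo)) 0 ant) <-> Prf (r 1) (std (gn yablo)) (r 0).
Proof.
  rewrite map_form_sub by apply ant_var_up. rewrite tr_sub, antecedent_meaning.
  assert (E0 : ev r (ant_var v (gn yablo) 0 0) = std v) by exact (ev_num r v).
  assert (E2 : ev r (ant_var v (gn yablo) 0 2) = std (gn yablo)) by exact (ev_num r (gn yablo)).
  rewrite E0, E2. reflexivity.
Qed.

(** If Y(z) held, the theory of z would refute Y(y) for some y below z in the
    class, so Y(y) would fail by reflection; but Y(y) follows from Y(z). *)
Lemma step_provable : provable PA (All step_form).
Proof.
  apply model_completeness; [auto|]. intros M r0 _ z.
  intros H. apply yablo_meaning. intros (Hphi & HD & HY).
  change ((z .: r0) 0) with z in HD, HY.
  assert (Hphi' : forall r' : nat -> M, ~ tr r' phi).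
  { intros r' K. apply Hphi. revert K. apply tr_closed with (n := 0); [exact phi_sentence|lia]. }
  destruct (desc_down Hphi HD) as (y & Hyz & Dy).
  destruct (order_linear M) as (_ & L1 & L2 & L3 & _).
  assert (HL := L1 _ _ (proj1 Hyz)).
  assert (P : Prf z (std (gn yablo)) y).
  { apply HY. split; [exact (proj2 HL)|exact Hyz]. }
  specialize (H y (proj2 (ant_var_meaning _) P)). apply yablo_meaning in H.
  apply H. clear H. change ((y .: z .: r0) 0) with y.
  split; [apply Hphi'|]. split; [exact Dy|].
  intros c e [Hc He]. apply HY. split; [|exact He].
  apply (L2 c y z). split; [exact Hc|exact (proj1 Hyz)].
Qed.

(** The theory attached to z has reflection for the theory of x among its axioms,
    and PA proves that this refutes Y(x).  As x and z range over a model, PA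
    proves the lemma itself. *)
Lemma refuted_below (M : model) (z x : M) :
  mDom (std l) z -> mLt (std l) x z -> Prf z (std (gn yablo)) x.
Proof.
  intros Hz Hx. unfold Prf.
  set (Ax := mAxOpen (@mAxPA M) (std l) (std v) z).
  assert (HPA : forall y, mAxPA y -> Ax y) by (intros y Hy; split; auto).
  assert (H := Prv_inst HPA x step_provable).
  unfold step_form in H. rewrite fcode_Imp, fcode_All, fcode_Imp in H.
  eexists. split.
  { rewrite (std_gn M 0 yablo). apply (@InstNum_code M x (fun _ i => inl i)). reflexivity. }
  refine (Prv_mp _ H). clear H. apply Prv_axiom. split; [exact Hz|]. right.
  exists x, (std (gn yablo)). split; [exact Hx|]. split.
  { rewrite (std_gn M 0 yablo). apply (Form_code M closed_yablo). }
  do 3 eexists. split; [|split; [|split]].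
  - unfold v at 1. rewrite (std_gn M 0 ant).
    apply (@InstNum_entries M (std v) (fun _ i => inl i)). reflexivity.
  - apply InstNum_entries. reflexivity.
  - apply InstNum_entries. reflexivity.
  - rewrite ant_var_code.
    replace (fcode _ 1 yablo) with (@std M (gn yablo)); [reflexivity|].
    rewrite (std_gn M 0 yablo). apply (fcode_closed closed_yablo).
    intros j i Hi. simpl. destruct (Nat.ltb_spec i (S j)); [reflexivity|lia].
Qed.

(** If [phi] failed, an element x of the class below [top] would satisfy Y(x) by
    [refuted_below], while reflection for the theory of [top] refutes Y(x). *)
Theorem reflection_proves : order_dom l top -> provable (RFN_iter PA aAxPA l) phi.
Proof.
  intros Htop. apply model_completeness; [intros g Hg; now left|].
  intros M r HR. apply NNPP. intros Hphi.
  assert (Hphi' : forall r' : nat -> M, ~ tr r' phi).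
  { intros r' K. apply Hphi. revert K. apply tr_closed with (n := 0); [exact phi_sentence|lia]. }
  destruct (desc_top M) as [Dtop Dt].
  assert (HY : forall x : M, Prf (std top) (std (gn yablo)) x -> tr (x .: r) yablo).
  { intros x.
    assert (K := HR (reflection (aAxIter aAxPA l (hnum top)) yablo) r).
    assert (K' := K (or_intror (ex_intro _ top (ex_intro _ yablo
      (conj Htop (conj closed_yablo eq_refl)))))).
    specialize (K' x). intros H. apply K'. clear K K'.
    assert (Hx : den (1, x .: r) (level 0) x) by apply den_last.
    assert (Hm : means (1, x .: r) (aPrvDot (aAxIter aAxPA l (hnum top))
      (hnum (gn yablo)) (level 0)) (Prf (std top) (std (gn yablo)) x)).
    { unfold aAxIter, Prf. means. }
    exact (proj2 (Hm _ (later_refl _)) H). }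
  destruct (desc_down Hphi Dt) as (x & Hx & Dx).
  assert (H := HY x (refuted_below Dtop Hx)). apply yablo_meaning in H. apply H.
  split; [apply Hphi'|]. split; [exact Dx|].
  intros c e [Hc He]. apply refuted_below; [|exact He].
  destruct (order_linear M) as (_ & L1 & _). exact (proj1 (L1 _ _ Hc)).
Qed.
End Reflection.

(** * Decision of bounded formulas inside a model *)

Definition lift_term (t : term) : term := map_term (fun j => Var (S j)) t.

(** The bound is a term in which the bound variable does not occur, as required
    for the verification of bounded quantifiers. *)
Inductive bounded : form -> Prop :=
| bounded_equ t u : bounded (Equ t u)
| bounded_less t u : bounded (Less t u)
| bounded_bot : bounded Bot
| bounded_imp f g : bounded f -> bounded g -> bounded (Imp f g)
| bounded_all t f : bounded f -> bounded (All (Imp (Less (Var 0) (lift_term t)) f)).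

Section Decision.
Variable M : model.
Local Open Scope m_scope.
Implicit Types x y z : M.

Lemma rVal_mono : monotone (@rVal M).
Proof.
  intros y D E H [K|[(u & m & D1 & K)|(u & m & w & p & D1 & D2 & K)]].
  - left; exact K.
  - right; left. exists u, m. auto.
  - right; right. exists u, m, w, p. auto.
Qed.

Lemma Val_Zero (n : M) : mVal qZero n <-> n = ze.
Proof.
  split.
  - intros H. apply Der_inv in H; [|apply rVal_mono].
    destruct H as [H|[(u & m & _ & H)|(u & m & w & p & _ & _ & [H|H])]]; code_eq; reflexivity.
  - intros ->. apply Der_close0; [apply rVal_mono|]. now left.
Qed.
Lemma Val_Succ (t n : M) : mVal (qSucc t) n <-> exists m, mVal t m /\ n = su m.
Proof.
  split.
  - intros H. apply Der_inv in H; [|apply rVal_mono].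
    destruct H as [H|[(u & m & K & H)|(u & m & w & p & _ & _ & [H|H])]]; code_eq. now exists m.
  - intros (m & H & ->). eapply Der_close1; [apply rVal_mono|exact H|].
    right; left. now exists t, m.
Qed.
Lemma Val_Add (t u n : M) : mVal (qAdd t u) n <->
  exists m p, mVal t m /\ mVal u p /\ n = m + p.
Proof.
  split.
  - intros H. apply Der_inv in H; [|apply rVal_mono].
    destruct H as [H|[(v & m & K & H)|(v & m & w & p & K & K' & [H|H])]]; code_eq.
    now exists m, p.
  - intros (m & p & H & K & ->). eapply Der_close; [apply rVal_mono|exact H|exact K|].
    right; right. exists t, m, u, p. auto 6.
Qed.
Lemma Val_Mul (t u n : M) : mVal (qMul t u) n <->
  exists m p, mVal t m /\ mVal u p /\ n = m * p.
Proof.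
  split.
  - intros H. apply Der_inv in H; [|apply rVal_mono].
    destruct H as [H|[(v & m & K & H)|(v & m & w & p & K & K' & [H|H])]]; code_eq.
    now exists m, p.
  - intros (m & p & H & K & ->). eapply Der_close; [apply rVal_mono|exact H|exact K|].
    right; right. exists t, m, u, p. auto 6.
Qed.

Lemma Val_qnum (m n : M) : mVal (qnum m) n <-> n = m.
Proof.
  enough (H : forall m t : M, mNum m t -> forall n : M, mVal t n <-> n = m).
  { apply H. now apply Num_iff. }
  clear m n.
  apply (@ind M (fun m => forall t : M, mNum m t -> forall n : M, mVal t n <-> n = m)).
  - defn.
  - intros t ->%Num_0 n. apply Val_Zero.
  - intros m IH t (u & Hu & ->)%Num_S n. rewrite Val_Succ. split.
    + intros (p & K & ->). apply (IH _ Hu) in K as ->. reflexivity.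
    + intros ->. exists m. split; [now apply (IH _ Hu)|reflexivity].
Qed.

Lemma Val_code (e : nat -> M) t n :
  mVal (tcode (fun i => qnum (e i)) t) n <-> n = ev e t.
Proof.
  revert n; induction t; intros n; cbn [tcode ev].
  - apply Val_qnum.
  - apply Val_Zero.
  - rewrite Val_Succ. split.
    + intros (m & ->%IHt & ->). reflexivity.
    + intros ->. eexists; split; [now apply IHt|reflexivity].
  - rewrite Val_Add. split.
    + intros (m & p & ->%IHt1 & ->%IHt2 & ->). reflexivity.
    + intros ->. do 2 eexists; split; [now apply IHt1|split; [now apply IHt2|reflexivity]].
  - rewrite Val_Mul. split.
    + intros (m & p & ->%IHt1 & ->%IHt2 & ->). reflexivity.
    + intros ->. do 2 eexists; split; [now apply IHt1|split; [now apply IHt2|reflexivity]].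
Qed.

Lemma rDec_mono : monotone (@rDec M).
Proof.
  intros y D E H [K|[K|[(f & g & D1 & K)|[(f & g & D1 & D2 & K)|
    [(t & n & f & K1 & K2 & K3)|(f & n & g & K1 & D1 & K)]]]]].
  - left; exact K.
  - right; left; exact K.
  - do 2 right; left. exists f, g. split; [destruct D1; auto|exact K].
  - do 3 right; left. exists f, g. auto.
  - do 4 right; left. exists t, n, f. split; [exact K1|]. split; [|exact K3].
    intros m Hm. destruct (K2 m Hm) as (g & Hg & Dg). exists g. auto.
  - do 5 right. exists f, n, g. auto.
Qed.

Ltac dec_inv H :=
  apply Der_inv in H; [|apply rDec_mono];
  destruct H as [(?t & ?u & ?m & ?n & ?Ht & ?Hu & [[?C H]|[[?C H]|[[?C H]|[?C H]]]])
    |[H|[(?f & ?g & ?D & H)|[(?f & ?g & ?D & ?D' & H)|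
    [(?t & ?n & ?f & ?K & ?D & H)|(?f & ?n & ?g & ?K & ?D & H)]]]]];
  code_eq.

Section Atoms.
Variables (e : nat -> M) (t u : term).
Let a (t : term) := tcode (fun i => qnum (e i)) t.

Lemma Dec_Equ : (mDecided (std 1) (qEqu (a t) (a u)) <-> ev e t = ev e u) /\
  (mDecided (std 0) (qEqu (a t) (a u)) <-> ev e t <> ev e u).
Proof.
  split; split.
  - intros H. dec_inv H. apply Val_code in Ht as ->. now apply Val_code in Hu.
  - intros H. apply Der_close0; [apply rDec_mono|]. left.
    exists (a t), (a u), (ev e t), (ev e u).
    repeat (split; [now apply Val_code|]). left. now split.
  - intros H. dec_inv H. apply Val_code in Ht as ->. now apply Val_code in Hu as ->.
  - intros H. apply Der_close0; [apply rDec_mono|]. left.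
    exists (a t), (a u), (ev e t), (ev e u).
    repeat (split; [now apply Val_code|]). right; left. now split.
Qed.

Lemma Dec_Less : (mDecided (std 1) (qLess (a t) (a u)) <-> ev e t < ev e u) /\
  (mDecided (std 0) (qLess (a t) (a u)) <-> ~ ev e t < ev e u).
Proof.
  split; split.
  - intros H. dec_inv H. apply Val_code in Ht as ->. now apply Val_code in Hu as ->.
  - intros H. apply Der_close0; [apply rDec_mono|]. left.
    exists (a t), (a u), (ev e t), (ev e u).
    repeat (split; [now apply Val_code|]). do 2 right; left. now split.
  - intros H. dec_inv H. apply Val_code in Ht as ->. now apply Val_code in Hu as ->.
  - intros H. apply Der_close0; [apply rDec_mono|]. left.
    exists (a t), (a u), (ev e t), (ev e u).
    repeat (split; [now apply Val_code|]). do 3 right. now split.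
Qed.
End Atoms.

Lemma Dec_Bot : ~ mDecided (std 1) (@qBot M) /\ mDecided (std 0) (@qBot M).
Proof.
  split.
  - intros H. dec_inv H.
  - apply Der_close0; [apply rDec_mono|]. right; left. reflexivity.
Qed.

Lemma Dec_Imp1 (f g : M) :
  mDecided (std 1) (qImp f g) <-> mDecided (std 0) f \/ mDecided (std 1) g.
Proof.
  split.
  - intros H. dec_inv H. exact D.
  - intros [H|H]; (eapply Der_close1; [apply rDec_mono|exact H|]);
      do 2 right; left; exists f, g; auto.
Qed.
Lemma Dec_Imp0 (f g : M) :
  mDecided (std 0) (qImp f g) <-> mDecided (std 1) f /\ mDecided (std 0) g.
Proof.
  split.
  - intros H. dec_inv H. now split.
  - intros [H K]. eapply Der_close; [apply rDec_mono|exact H|exact K|].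
    do 3 right; left. exists f, g. auto.
Qed.
Lemma Dec_All0 (f : M) : mDecided (std 0) (qAll f) <->
  exists n g, mInstNum f n g /\ mDecided (std 0) g.
Proof.
  split.
  - intros H. dec_inv H. now exists n, g.
  - intros (n & g & H & K). eapply Der_close1; [apply rDec_mono|exact K|].
    do 5 right. exists f, n, g. auto.
Qed.
(** The verifications of the instances below the bound are joined by an induction
    in the model. *)
Lemma Dec_All1 (t f : M) :
  mDecided (std 1) (qAll (qImp (qLess (qVar (std 0)) t) f)) <->
  exists n, mVal t n /\ forall m, m < n -> exists g, mInstNum f m g /\ mDecided (std 1) g.
Proof.
  split.
  - intros H. dec_inv H. exists n. now split.
  - intros (n & Ht & H).
    pose (w := (0, fun _ => ze) : world M). defn_param w f.
    assert (DQ : exists q, means2 w q (fun m z => exists g, mInstNum f m g /\ z = ⟪std 1, g⟫)).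
    { eexists. means. }
    destruct DQ as [q DQ].
    destruct (@Der_family M (@rDec M) rDec_mono w _ q _ n (@means_rDec M w) DQ)
      as (a & b & k & C & K).
    + intros m Hm. destruct (H m Hm) as (g & Hg & D). exists ⟪std 1, g⟫.
      split; [now exists g|exact D].
    + apply (Der_intro rDec_mono C). do 4 right; left. exists t, n, f.
      split; [exact Ht|]. split; [|reflexivity].
      intros m Hm. destruct (K m Hm) as (z & (g & Hg & ->) & Hz). now exists g.
Qed.

(** Numerals of the values [e] are put for the free variables. *)
Definition env_entry (e : nat -> M) (k i : nat) : entry M :=
  if i <? k then inl i else inr (e (i - k)%nat).
Definition env_code (e : nat -> M) (k : nat) (f : form) : M :=
  fcode (fun k i => ecode (env_entry e k i)) k f.

Lemma env_inst (e : nat -> M) m f y :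
  mInstNum (env_code e 1 f) m y <-> y = env_code (m .: e) 0 f.
Proof.
  replace (env_code e 1 f) with (fcode (fun k i => ecode (env_entry e (S k) i)) 0 f).
  2:{ apply (fcode_closed (boundP f)). reflexivity. }
  rewrite InstNum_code. unfold env_code.
  replace (fun k i => inst_entry _ k _) with (fun k i => ecode (env_entry (m .: e) k i));
    [reflexivity|].
  extensionality k; extensionality i. unfold env_entry, inst_entry.
  destruct (Nat.ltb_spec i k), (Nat.ltb_spec i (S k)); try lia; cbn [ecode].
  - destruct (Nat.ltb_spec i k); [reflexivity|lia].
  - destruct (Nat.ltb_spec i k); [lia|]. destruct (Nat.eqb_spec i k); [|lia].
    now replace (i - k)%nat with 0 by lia.
  - now replace (i - k)%nat with (S (i - S k)) by lia.
Qed.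

Lemma env_term (e : nat -> M) t :
  tcode (fun i => ecode (env_entry e 0 i)) t = tcode (fun i => qnum (e i)) t.
Proof.
  f_equal. extensionality i. unfold env_entry. simpl. now rewrite Nat.sub_0_r.
Qed.

(** By induction on the formula: the rules of verification and refutation are
    invertible, and each inverts to the truth condition of its connective. *)
Lemma Dec_bounded f : bounded f -> forall e : nat -> M,
  (mDecided (std 1) (env_code e 0 f) <-> tr e f) /\
  (mDecided (std 0) (env_code e 0 f) <-> ~ tr e f).
Proof.
  unfold env_code.
  induction 1 as [t u|t u| |f g _ IHf _ IHg|t f _ IH]; intros e.
  - cbn [fcode tr]. rewrite !env_term. apply Dec_Equ.
  - cbn [fcode tr]. rewrite !env_term. apply Dec_Less.
  - cbn [fcode tr]. pose proof Dec_Bot. tauto.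
  - rewrite fcode_Imp, Dec_Imp1, Dec_Imp0. specialize (IHf e). specialize (IHg e).
    cbn [tr]. tauto.
  - assert (Et : forall x, ev (x .: e) (lift_term t) = ev e t).
    { intros x. unfold lift_term. now rewrite ev_map. }
    rewrite fcode_All. split.
    + rewrite fcode_Imp.
      replace (fcode _ 1 (Less _ _)) with
        (qLess (qVar (@std M 0)) (tcode (fun i => qnum (e i)) t)).
      2:{ cbn [fcode tcode]. f_equal. unfold lift_term. rewrite tcode_map. f_equal.
          extensionality i. unfold env_entry. cbn [tcode].
          destruct (Nat.ltb_spec (S i) 1); [lia|]. cbn [ecode]. do 2 f_equal. lia. }
      change (fcode _ 1 f) with (env_code e 1 f). rewrite Dec_All1. split.
      * intros (n & ->%Val_code & H) x. cbn [tr ev]. rewrite Et. cbn [push]. intros Hx.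
        destruct (H x Hx) as (g & ->%env_inst & D). now apply IH in D.
      * intros H. exists (ev e t). split; [now apply Val_code|].
        intros m Hm. eexists. split; [now apply env_inst|].
        apply IH, H. cbn [tr ev]. rewrite Et. exact Hm.
    + change (fcode _ 1 ?g) with (env_code e 1 g). rewrite Dec_All0.
      assert (E : forall n, mDecided (std 0) (env_code (n .: e) 0
          (Imp (Less (Var 0) (lift_term t)) f)) <-> n < ev e t /\ ~ tr (n .: e) f).
      { intros n. unfold env_code. rewrite fcode_Imp, Dec_Imp0, (proj2 (IH (n .: e))).
        cbn [fcode]. rewrite !env_term, (proj1 (Dec_Less _ _ _)), Et. reflexivity. }
      split.
      * intros (n & g & ->%env_inst & [D1 D2]%E) H. apply D2, H. cbn [tr ev].
        rewrite Et. exact D1.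
      * intros H. apply NNPP. intros N. apply H. intros x. cbn [tr ev]. rewrite Et.
        intros Hx. apply NNPP. intros K. apply N. exists x. eexists.
        split; [now apply env_inst|]. apply E. now split.
Qed.

Lemma gn_inst f (x : M) (r : nat -> M) s : closed_form 1 f ->
  mInstNum (std (gn f)) x s <-> s = env_code (x .: r) 0 f.
Proof.
  intros Hc. rewrite (std_gn M 0 f), (@InstNum_code M x (fun _ i => inl i)).
  replace (env_code _ 0 f) with (fcode (fun k i => inst_entry (fun _ => qnum x) k (inl i)) 0 f);
    [reflexivity|].
  apply (fcode_closed Hc). intros j i Hi. unfold env_entry, inst_entry.
  change (0 + j)%nat with j. destruct (Nat.ltb_spec i j); [reflexivity|].
  destruct (Nat.eqb_spec i j); [|lia]. cbn [ecode]. now replace (i - j)%nat with 0 by lia.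
Qed.

Lemma InSigma_bounded f (x : M) (r : nat -> M) : bounded f -> closed_form 1 f ->
  mInSigma (std (gn f)) x <-> tr (x .: r) f.
Proof.
  intros Hb Hc. rewrite <- (proj1 (Dec_bounded Hb (x .: r))). split.
  - intros (s & Hs & D). now apply (gn_inst x r s Hc) in Hs as ->.
  - intros D. eexists. split; [|exact D]. now apply (gn_inst x r _ Hc).
Qed.

Lemma InPi_bounded f (x : M) (r : nat -> M) : bounded f -> closed_form 1 f ->
  mInPi (std (gn f)) x <-> tr (x .: r) f.
Proof.
  intros Hb Hc. assert (E := proj2 (Dec_bounded Hb (x .: r))). unfold mInPi. split.
  - intros H. apply NNPP. intros N. apply H. eexists.
    split; [now apply (gn_inst x r _ Hc)|now apply E].
  - intros H (s & Hs & D). apply (gn_inst x r s Hc) in Hs as ->. now apply E in D.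
Qed.
End Decision.

(** * The Kleene–Brouwer order of the tree of attempted refutations *)

(** Each subformula comes with the number of variables in scope. *)
Fixpoint subs (k : nat) (f : form) : list (nat * form) :=
  (k, f) :: match f with
            | Imp g h => subs k g ++ subs k h
            | All g => subs (S k) g
            | _ => []
            end.

Lemma subs_self k f : In (k, f) (subs k f).
Proof. destruct f; left; reflexivity. Qed.

Lemma subs_trans f : forall k j g i h,
  In (j, g) (subs k f) -> In (i, h) (subs j g) -> In (i, h) (subs k f).
Proof.
  induction f; intros k j g i h H K; cbn [subs] in H;
    (destruct H as [E|H]; [injection E as -> ->; exact K|]); try destruct H.
  - right. apply in_app_iff in H. apply in_app_iff. destruct H; eauto.
  - right. eauto.
Qed.

Lemma subs_imp k f j g h : In (j, Imp g h) (subs k f) ->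
  In (j, g) (subs k f) /\ In (j, h) (subs k f).
Proof.
  intros H. split; apply (subs_trans H); cbn [subs]; right; apply in_app_iff;
    auto using subs_self.
Qed.

Lemma subs_all k f j g : In (j, All g) (subs k f) -> In (S j, g) (subs k f).
Proof. intros H. apply (subs_trans H). cbn [subs]. right. apply subs_self. Qed.

Section Tree.
Variable phi : form.
Variable M : model.
Local Open Scope m_scope.

Record point : Type := Point { pa : M; pb : M; len : M }.
Definition code (p : point) : M := ⟪pa p, pb p, len p⟫.
Definition value_at (p : point) (i y : M) : Prop := Beta (pa p) (pb p) i y.

Lemma code_inj p q : code p = code q -> p = q.
Proof.
  destruct p, q. unfold code; simpl. intros [-> [-> ->]%pr2_inj]%pr2_inj. reflexivity.
Qed.

Definition mlist (ms : list M) : M := fold_right pr2 ze ms.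

Lemma mlist_inj ms : forall ms', length ms = length ms' -> mlist ms = mlist ms' -> ms = ms'.
Proof.
  induction ms as [|x ms IH]; intros [|x' ms'] L H; try discriminate; [reflexivity|].
  simpl in *. apply pr2_inj in H as [-> H]. f_equal. apply IH; [lia|exact H].
Qed.

(** The entry at this position tells the truth value of [g] for the values [ms] of
    its k variables.  Positions without this form carry no information. *)
Definition pos (k : nat) (g : form) (ms : list M) : M :=
  ⟪std (pair k (gn g)), mlist ms⟫.

Lemma pos_inj k g ms k' g' ms' : length ms = k -> length ms' = k' ->
  pos k g ms = pos k' g' ms' -> k = k' /\ g = g' /\ ms = ms'.
Proof.
  intros L L' [H K]%pr2_inj. apply std_inj, pair_inj in H as [E G].
  apply gn_inj in G. repeat split; auto. apply mlist_inj; [congruence|exact K].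
Qed.

Lemma le_pos k g ms x : In x ms -> x <= pos k g ms.
Proof.
  intros H. apply le_trans with (mlist ms); [|apply le_pr2_r].
  induction ms as [|y ms IH]; [destruct H|]. destruct H as [->|H]; simpl.
  - apply le_pr2_l.
  - eapply le_trans; [exact (IH H)|apply le_pr2_r].
Qed.

Definition T (ms : list M) (g : form) : Prop := tr (fun i => nth i ms ze) g.

Lemma T_all ms g : T ms (All g) <-> forall x, T (x :: ms) g.
Proof.
  unfold T; cbn [tr].
  assert (E : forall x, x .: (fun i => nth i ms ze) = fun i => nth i (x :: ms) ze).
  { intros x. extensionality i. now destruct i. }
  split; intros H x; specialize (H x); rewrite E in *; exact H.
Qed.

(** An entry y is right for g when it is 0 if g holds, and positive otherwise;
    for a false universal formula, y - 1 is a counterexample. *)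
Definition right_for (g : form) (ms : list M) (y : M) : Prop :=
  (y = ze <-> T ms g) /\
  match g with All g' => forall x, y = su x -> ~ T (x :: ms) g' | _ => ~ False end.

Lemma right_ex g ms : exists y, right_for g ms y.
Proof.
  unfold right_for. destruct (classic (T ms g)) as [H|H].
  - exists ze. split; [tauto|]. destruct g; auto. intros x E. now apply eq_sym, su_ne0 in E.
  - destruct g as [| | | |g];
      try (exists (su ze); split; [split; [intros E; now apply su_ne0 in E|tauto]|tauto]).
    assert (K : exists x, ~ T (x :: ms) g).
    { apply NNPP. intros N. apply H, T_all. intros x. apply NNPP. eauto. }
    destruct K as [x Hx]. exists (su x). split.
    + split; [intros E; now apply su_ne0 in E|tauto].
    + intros y ->%su_inj. exact Hx.
Qed.

Fixpoint allbs (k : nat) (n : M) (acc : list M) (A : list M -> Prop) : Prop :=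
  match k with
  | 0 => A acc
  | S k => forall x, x < n -> allbs k n (x :: acc) A
  end.

Lemma allbs_iff k n (A : list M -> Prop) : forall acc,
  allbs k n acc A <-> forall ms, length ms = k -> (forall x, In x ms -> x < n) -> A (ms ++ acc).
Proof.
  induction k; intros acc; simpl.
  - split.
    + intros H [|] L _; [exact H|discriminate].
    + intros H. apply (H []); easy.
  - split.
    + intros H ms L Hms. destruct (rev ms) as [|x l] eqn:E.
      { apply (f_equal (@length M)) in E. rewrite length_rev in E. simpl in E. lia. }
      apply (f_equal (@rev M)) in E. rewrite rev_involutive in E. simpl in E. subst ms.
      rewrite <- app_assoc. simpl. rewrite length_app in L. simpl in L.
      apply IHk with (acc := x :: acc); [|lia|].
      * apply H, Hms. apply in_app_iff. right. now left.
      * intros y Hy. apply Hms, in_app_iff. now left.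
    + intros H x Hx. apply IHk. intros ms L Hms.
      change (x :: acc) with ([x] ++ acc). rewrite app_assoc. apply H.
      * rewrite length_app. simpl. lia.
      * intros y Hy. apply in_app_iff in Hy. destruct Hy as [Hy|[<-|[]]]; auto.
Qed.

Definition truthful (p : point) : Prop :=
  forall j, In j (subs 0 phi) ->
    allbs (fst j) (len p) [] (fun ms => pos (fst j) (snd j) ms < len p ->
      forall y, value_at p (pos (fst j) (snd j) ms) y -> right_for (snd j) ms y).

(** The truth value of a compound formula is compared with those of its immediate
    subformulas; comparisons that refer to positions beyond the length are
    postponed.  In an infinite sequence they force all entries to be right. *)
Definition local (p : point) (k : nat) (g : form) (ms : list M) : Prop :=
  let v := value_at p (pos k g ms) in
  match g with
  | Equ _ _ | Less _ _ | Bot => v ze <-> T ms g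
  | Imp g h => pos k g ms < len p -> pos k h ms < len p ->
      (v ze <-> (value_at p (pos k g ms) ze -> value_at p (pos k h ms) ze))
  | All g => forall x, x < len p -> pos (S k) g (x :: ms) < len p ->
      (v ze -> value_at p (pos (S k) g (x :: ms)) ze) /\
      (v (su x) -> ~ value_at p (pos (S k) g (x :: ms)) ze)
  end.

Definition in_tree (p : point) : Prop :=
  (forall j, In j (subs 0 phi) -> allbs (fst j) (len p) [] (fun ms =>
    pos (fst j) (snd j) ms < len p -> local p (fst j) (snd j) ms)) /\
  (pos 0 phi [] < len p -> ~ value_at p (pos 0 phi []) ze).

Lemma truthful_iff p : truthful p <-> forall k g ms y, In (k, g) (subs 0 phi) ->
  length ms = k -> pos k g ms < len p -> value_at p (pos k g ms) y -> right_for g ms y.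
Proof.
  unfold truthful. split.
  - intros H k g ms y I L Hp Hy. specialize (H _ I).
    rewrite allbs_iff in H. simpl in H.
    specialize (H ms L). rewrite app_nil_r in H. apply H; auto.
    intros x Hx. eapply le_lt_trans; [apply (le_pos k g Hx)|exact Hp].
  - intros H [k g] I. rewrite allbs_iff. simpl. intros ms L _. rewrite app_nil_r.
    intros Hp y Hy. eauto.
Qed.

Lemma truthful_in_tree p : ~ T [] phi -> truthful p -> in_tree p.
Proof.
  intros Hphi H. rewrite truthful_iff in H.
  assert (V : forall k g ms, In (k, g) (subs 0 phi) -> length ms = k -> pos k g ms < len p ->
    (value_at p (pos k g ms) ze <-> T ms g)).
  { intros k g ms I L Hp. destruct (Beta_total (pa p) (pb p) (pos k g ms)) as [y Hy].
    destruct (H k g ms y I L Hp Hy) as [E _]. rewrite <- E. split.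
    - intros K. exact (Beta_fun Hy K).
    - intros <-. exact Hy. }
  split.
  - intros [k g] I. rewrite allbs_iff. simpl. intros ms L _. rewrite app_nil_r.
    intros Hp. assert (E := V k g ms I L Hp). unfold local.
    destruct g as [t u|t u| |g h|g]; try exact E.
    + intros Hg Hh. apply subs_imp in I as [Ig Ih].
      rewrite E, (V k g ms Ig L Hg), (V k h ms Ih L Hh). reflexivity.
    + intros x Hx Hg. assert (I' := subs_all I).
      rewrite E, (V (S k) g (x :: ms) I'); [|simpl; lia|exact Hg].
      split; [intros A; now apply T_all|].
      intros A. now apply (proj2 (H k (All g) ms _ I L Hp A)).
  - intros Hp. rewrite V; auto using subs_self.
Qed.

(** ** The order *)

Section Compare.
Variables p q : point.
(* The bounds on z, here and below, make the order a bounded formula. *)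
Definition same (i : M) : Prop :=
  i < len p /\ i < len q /\ exists z, z <= pa p /\ value_at p i z /\ value_at q i z.
(** The sequences differ at i: by a smaller entry of p, or because p extends q, or
    because p and q code one sequence, when the smaller number comes first. *)
Definition before (i : M) : Prop :=
  (i < len p /\ i < len q /\
     exists z, z <= pa p /\ exists u, u <= pa q /\ value_at p i z /\ value_at q i u /\ z < u)
  \/ (i < len p /\ i = len q)
  \/ (i = len p /\ i = len q /\ code p < code q).
Definition precedes : Prop :=
  exists i, i <= len p /\ (forall j, j < i -> same j) /\ before i.
End Compare.

Lemma same_intro p q i z : i < len p -> i < len q -> value_at p i z -> value_at q i z -> same p q i.
Proof. intros. repeat split; auto. exists z. split; auto. now apply Beta_le in H1. Qed.

Lemma same_trans p q r i : same p q i -> same q r i -> same p r i.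
Proof.
  intros (H1 & H2 & z & _ & H3 & H4) (K1 & K2 & u & _ & K3 & K4).
  rewrite <- (Beta_fun H4 K3) in K4. exact (same_intro H1 K2 H3 K4).
Qed.

Ltac no_self :=
  match goal with H : ?x < ?x |- _ => exfalso; exact (lt_irrefl H) end.

Lemma before_same p q r i : before p q i -> same q r i -> before p r i.
Proof.
  intros [(H1 & H2 & z & Hz & u & Hu & Pz & Qu & L)|[[H1 ->]|(-> & H1 & H2)]]
    (K1 & K2 & v & Hv & Qv & Rv).
  - left. repeat split; auto. exists z. split; [exact Hz|]. exists v.
    split; [exact (Beta_le Rv)|]. rewrite (Beta_fun Qu Qv) in L. auto.
  - no_self.
  - rewrite H1 in K1. no_self.
Qed.

Lemma same_before p q r i : same p q i -> before q r i -> before p r i.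
Proof.
  intros (K1 & K2 & v & Hv & Pv & Qv)
    [(H1 & H2 & z & Hz & u & Hu & Qz & Ru & L)|[[H1 H2]|(H1 & H2 & H3)]].
  - left. repeat split; auto. exists v. split; [exact Hv|]. exists u.
    split; [exact Hu|]. rewrite (Beta_fun Qz Qv) in L. auto.
  - right; left. now split.
  - rewrite H1 in K2. no_self.
Qed.

Lemma before_trans p q r i : before p q i -> before q r i -> before p r i.
Proof.
  intros [(H1 & H2 & z & Hz & u & Hu & Pz & Qu & L)|[[H1 H2]|(H1 & H2 & H3)]]
    [(K1 & K2 & z' & Hz' & u' & Hu' & Qz & Ru & L')|[[K1 K2]|(K1 & K2 & K3)]].
  - left. repeat split; auto. exists z. split; [exact Hz|]. exists u'.
    split; [exact Hu'|]. rewrite (Beta_fun Qu Qz) in L.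
    exact (conj Pz (conj Ru (lt_trans L L'))).
  - right; left. now split.
  - rewrite K1 in H2. no_self.
  - rewrite H2 in K1. no_self.
  - rewrite H2 in K1. no_self.
  - right; left. now split.
  - rewrite H2 in K1. no_self.
  - rewrite H2 in K1. no_self.
  - right; right. repeat split; auto. exact (lt_trans H3 K3).
Qed.

Lemma before_irrefl p i : ~ before p p i.
Proof.
  intros [(H1 & H2 & z & Hz & u & Hu & Pz & Qu & L)|[[H1 H2]|(H1 & H2 & H3)]].
  - rewrite (Beta_fun Pz Qu) in L. no_self.
  - rewrite H2 in H1. no_self.
  - no_self.
Qed.

Lemma precedes_irrefl p : ~ precedes p p.
Proof. intros (i & _ & _ & H). exact (before_irrefl H). Qed.

Lemma before_le p q i : before p q i -> i <= len p.
Proof.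
  intros [[H _]|[[H _]|[-> _]]]; [apply lt_le, H|apply lt_le, H|apply le_refl].
Qed.

Lemma precedes_trans p q r : precedes p q -> precedes q r -> precedes p r.
Proof.
  intros (i & Hi & Si & Bi) (j & Hj & Sj & Bj).
  destruct (lt_total i j) as [L|[<-|L]].
  - exists i. split; [exact Hi|]. split; [|exact (before_same Bi (Sj i L))].
    intros k Hk. apply (same_trans (Si k Hk)), Sj. exact (lt_trans Hk L).
  - exists i. split; [exact Hi|]. split; [|exact (before_trans Bi Bj)].
    intros k Hk. exact (same_trans (Si k Hk) (Sj k Hk)).
  - exists j. assert (B := same_before (Si j L) Bj).
    split; [exact (before_le B)|]. split; [|exact B].
    intros k Hk. exact (same_trans (Si k (lt_trans Hk L)) (Sj k Hk)).
Qed.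

(** The sequences are compared at the least i where they do not agree. *)
Lemma precedes_total p q : p = q \/ precedes p q \/ precedes q p.
Proof.
  destruct (@least M (fun i => ~ same p q i)) as (i & Hi & Hmin).
  { unfold same, value_at. pose (w := (0, fun _ => ze) : world M).
    defn_param w (pa p). defn_param w (pb p). defn_param w (len p).
    defn_param w (pa q). defn_param w (pb q). defn_param w (len q). defn_end w. }
  { exists (len p). intros [H _]. no_self. }
  assert (S1 : forall j, j < i -> same p q j).
  { intros j Hj. apply NNPP. apply Hmin, Hj. }
  assert (S2 : forall j, j < i -> same q p j).
  { intros j Hj. destruct (S1 j Hj) as (H1 & H2 & z & _ & H3 & H4).
    exact (same_intro H2 H1 H4 H3). }
  assert (Lp : i <= len p).
  { apply not_lt. intros H. destruct (S1 _ H) as [K _]. no_self. }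
  assert (Lq : i <= len q).
  { apply not_lt. intros H. destruct (S2 _ H) as [K _]. no_self. }
  enough (E : p = q \/ before p q i \/ before q p i).
  { destruct E as [E|[E|E]]; [now left|right; left|right; right]; exists i; auto. }
  unfold before. apply lt_su_iff in Lp, Lq.
  destruct Lp as [Lp|Lp], Lq as [Lq|Lq].
  - destruct (Beta_total (pa p) (pb p) i) as [z Hz].
    destruct (Beta_total (pa q) (pb q) i) as [u Hu].
    assert (Bz := Beta_le Hz). assert (Bu := Beta_le Hu).
    destruct (lt_total z u) as [L|[->|L]].
    + right; left; left. repeat split; auto. exists z. split; [exact Bz|]. exists u. auto.
    + exfalso. apply Hi. exact (same_intro Lp Lq Hz Hu).
    + right; right; left. repeat split; auto. exists u. split; [exact Bu|]. exists z. auto.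
  - right; left. right; left. now split.
  - right; right. right; left. now split.
  - destruct (lt_total (code p) (code q)) as [L|[E|L]].
    + right; left. do 2 right. auto.
    + left. now apply code_inj.
    + right; right. do 2 right. auto.
Qed.

Definition leq (x y : M) : Prop :=
  exists p q, x = code p /\ y = code q /\ in_tree p /\ in_tree q /\ (p = q \/ precedes p q).

(** ** Descent when the formula is false *)

(** A right entry exists for the next position, since the position determines the
    formula and the values of its variables. *)
Lemma truthful_extend p : truthful p ->
  exists q, truthful q /\ precedes q p.
Proof.
  rewrite truthful_iff. intros H.
  assert (E : exists y, forall k g ms, In (k, g) (subs 0 phi) -> length ms = k ->
    len p = pos k g ms -> right_for g ms y).
  { destruct (classic (exists k g ms, In (k, g) (subs 0 phi) /\ length ms = k /\
      len p = pos k g ms)) as [(k & g & ms & I & L & E)|N].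
    - destruct (right_ex g ms) as [y Hy]. exists y. intros k' g' ms' I' L' E'.
      rewrite E in E'. apply pos_inj in E' as (<- & <- & <-); auto.
    - exists ze. intros k g ms I L E. exfalso. apply N. now exists k, g, ms. }
  destruct E as [y Hy].
  destruct (@sequence_coded M (fun i z => i < len p /\ Beta (pa p) (pb p) i z \/
    i = len p /\ z = y) (su (len p))) as (a & b & K).
  { unfold definable2. pose (w := (0, fun _ => ze) : world M).
    defn_param w (pa p). defn_param w (pb p). defn_param w (len p). defn_param w y.
    defn_end w. }
  { intros i [Hi| ->]%lt_su_iff; [|exists y; tauto].
    destruct (Beta_total (pa p) (pb p) i) as [z Hz]. exists z. tauto. }
  set (q := Point a b (su (len p))).
  assert (Q : forall i z, i < len p -> value_at q i z -> value_at p i z).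
  { intros i z Hi Hz. destruct (K i (lt_le Hi)) as (u & [[_ Pu]|[-> _]] & B).
    - rewrite (Beta_fun Hz B). exact Pu.
    - no_self. }
  assert (Qn : forall z, value_at q (len p) z -> z = y).
  { intros z Hz. destruct (K (len p) (lt_su _)) as (u & [[L _]|[_ ->]] & B).
    - no_self.
    - exact (Beta_fun Hz B). }
  exists q. split.
  - rewrite truthful_iff. intros k g ms z I L Hp Hz. simpl in Hp.
    apply lt_su_iff in Hp. destruct Hp as [Hp|Hp].
    + eapply H; eauto.
    + rewrite Hp in Hz. rewrite (Qn z Hz). eapply Hy; eauto.
  - exists (len p). split; [apply lt_le, lt_su|]. split.
    + intros j Hj. destruct (Beta_total a b j) as [z Hz].
      apply same_intro with z; auto. apply lt_le, Hj.
    + right; left. split; [apply lt_su|reflexivity].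
Qed.

End Tree.

(** ** A bounded formula for the order *)

Definition hallb (t : tm) (f : tm -> fm) : fm := hall (fun x => x ⋖ t ⇒ f x)%fm.
Definition hexb (t : tm) (f : tm -> fm) : fm := (¬ hallb t (fun x => ¬ f x))%fm.
Definition htrue : fm := (¬ hbot)%fm.
Definition hconj {A : Type} (l : list A) (F : A -> fm) : fm :=
  fold_right (fun j f => F j ∧ f)%fm htrue l.
Fixpoint hallbs (k : nat) (n : tm) (acc : list tm) (F : list tm -> fm) : fm :=
  match k with
  | 0 => F acc
  | S k => hallb n (fun x => hallbs k n (x :: acc) F)
  end.

Definition hat (a b i y : tm) : fm :=
  (y ⋖ hsucc (hsucc i ⊗ b) ∧ hexb (hsucc a) (fun q => a ≐ q ⊗ hsucc (hsucc i ⊗ b) ⊕ y))%fm.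
Definition hlist (ts : list tm) : tm := fold_right hpair (hnum 0) ts.
Definition hpos (k : nat) (g : form) (ts : list tm) : tm :=
  hpair (hnum (pair k (gn g))) (hlist ts).

Definition hlocal (a b n : tm) (k : nat) (g : form) (ts : list tm) : fm :=
  let v y := hat a b (hpos k g ts) y in
  match g with
  | Equ _ _ | Less _ _ | Bot => v (hnum 0) ⇔ hform g ts
  | Imp g h => hpos k g ts ⋖ n ⇒ hpos k h ts ⋖ n ⇒
      (v (hnum 0) ⇔ (hat a b (hpos k g ts) (hnum 0) ⇒ hat a b (hpos k h ts) (hnum 0)))
  | All g => hallb n (fun x => hpos (S k) g (x :: ts) ⋖ n ⇒
      (v (hnum 0) ⇒ hat a b (hpos (S k) g (x :: ts)) (hnum 0)) ∧
      (v (hsucc x) ⇒ ¬ hat a b (hpos (S k) g (x :: ts)) (hnum 0)))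
  end%fm.

Definition hin_tree (phi : form) (a b n : tm) : fm :=
  (hconj (subs 0 phi) (fun j => hallbs (fst j) n [] (fun ts =>
     hpos (fst j) (snd j) ts ⋖ n ⇒ hlocal a b n (fst j) (snd j) ts)) ∧
   (hpos 0 phi [] ⋖ n ⇒ ¬ hat a b (hpos 0 phi []) (hnum 0)))%fm.

Section HCompare.
Variables a b n a' b' n' : tm.
Definition hsame (i : tm) : fm :=
  (i ⋖ n ∧ i ⋖ n' ∧ hexb (hsucc a) (fun z => hat a b i z ∧ hat a' b' i z))%fm.
Definition hbefore (i : tm) : fm :=
  ((i ⋖ n ∧ i ⋖ n' ∧ hexb (hsucc a) (fun z => hexb (hsucc a') (fun u =>
      hat a b i z ∧ hat a' b' i u ∧ z ⋖ u)))
   ∨ (i ⋖ n ∧ i ≐ n')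
   ∨ (i ≐ n ∧ i ≐ n' ∧ ⟨a, b, n⟩ ⋖ ⟨a', b', n'⟩))%fm.
Definition hprecedes : fm :=
  hexb (hsucc n) (fun i => hallb i hsame ∧ hbefore i)%fm.
End HCompare.

Definition hleq (phi : form) (x : tm) : fm :=
  let t := hsucc x in
  hexb t (fun y => hexb t (fun z => x ≐ ⟨y, z⟩ ∧
    hexb t (fun a => hexb t (fun b => hexb t (fun n =>
    hexb t (fun a' => hexb t (fun b' => hexb t (fun n' =>
      y ≐ ⟨a, b, n⟩ ∧ z ≐ ⟨a', b', n'⟩ ∧ hin_tree phi a b n ∧ hin_tree phi a' b' n' ∧
      (y ≐ z ∨ hprecedes a b n a' b' n')))))))))%fm.

Section MeaningOfOrder.
Variable M : model.
Local Open Scope m_scope.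
Implicit Types w : world M.

Lemma means_allb w t x f (P : M -> Prop) : den w t x -> means1 w f P ->
  means w (hallb t f) (forall y, y < x -> P y).
Proof. intros. unfold hallb. means. Qed.

Lemma means_exb w t x f (P : M -> Prop) : den w t x -> means1 w f P ->
  means w (hexb t f) (exists y, y < x /\ P y).
Proof.
  intros Ht Hf. apply means_iff with (~ forall y, y < x -> ~ P y).
  - split.
    + intros H. apply NNPP. intros N. apply H. intros y Hy Py. apply N. now exists y.
    + intros (y & Hy & Py) H. exact (H y Hy Py).
  - unfold hexb, hallb. means.
Qed.

Lemma means_at w ta tb ti ty a b i y :
  den w ta a -> den w tb b -> den w ti i -> den w ty y ->
  means w (hat ta tb ti ty) (@Beta M a b i y).
Proof.
  intros Ha Hb Hi Hy.
  apply means_iff with (y < su (su i * b) /\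
    exists q, q < su a /\ a = q * su (su i * b) + y).
  - split; [intros [L (q & _ & E)]; split; [exact L|now exists q]|].
    intros [L (q & E)]. split; [exact L|]. exists q. split; [|exact E].
    rewrite E. apply le_trans with (q * su (su i * b)); [apply le_mu, su_ne0|apply le_ad].
  - unfold hat. apply means_and; [means|]. apply means_exb; means.
Qed.

Lemma means_conj {A} w (l : list A) F P : (forall j, In j l -> means w (F j) (P j)) ->
  means w (hconj l F) (forall j, In j l -> P j).
Proof.
  induction l as [|j l IH]; intros H; simpl.
  - apply means_iff with (~ False); [firstorder|]. unfold htrue. means.
  - apply means_iff with (P j /\ forall i, In i l -> P i).
    + split; [intros [Hj Hl] i [<-|Hi]; auto|auto].
    + apply means_and; [apply H; now left|]. apply IH. intros i Hi. apply H. now right.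
Qed.

Lemma Forall2_den_later w v ts (xs : list M) : later w v ->
  Forall2 (den w) ts xs -> Forall2 (den v) ts xs.
Proof. intros L. induction 1; constructor; eauto using den_later. Qed.

Lemma means_allbs w k tn n acc xs F (A : list M -> Prop) :
  den w tn n -> Forall2 (den w) acc xs ->
  (forall v ts ms, later w v -> Forall2 (den v) ts ms -> means v (F ts) (A ms)) ->
  means w (hallbs k tn acc F) (allbs k n xs A).
Proof.
  revert w acc xs. induction k; intros w acc xs Hn Ha HF; cbn [hallbs allbs].
  - apply HF; [apply later_refl|exact Ha].
  - apply means_allb; [exact Hn|]. intros v t x L Ht. apply IHk.
    + exact (den_later L Hn).
    + constructor; [exact Ht|exact (Forall2_den_later L Ha)].
    + intros u ts ms L' Hts. apply HF; [exact (later_trans L L')|exact Hts].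
Qed.

Lemma den_pos w k g ts ms : Forall2 (den w) ts ms -> den w (hpos k g ts) (pos k g ms).
Proof.
  intros H. unfold hpos, pos. apply den_pr2; [apply den_num|].
  induction H; simpl; [apply den_ze|now apply den_pr2].
Qed.
End MeaningOfOrder.

Ltac means_order :=
  match goal with
  | |- means _ (hexb _ _) _ => refine (means_exb _ _)
  | |- means _ (hallb _ _) _ => refine (means_allb _ _)
  | |- means _ (hat _ _ _ _) _ => refine (means_at _ _ _ _)
  end.
Ltac means_base ::= means_order.

Section MeaningOfOrder2.
Variable M : model.
Local Open Scope m_scope.
Implicit Types w : world M.

Lemma means_local w ta tb tn a b n k g ts ms :
  den w ta a -> den w tb b -> den w tn n -> Forall2 (den w) ts ms ->
  means w (hlocal ta tb tn k g ts) (@local M (Point a b n) k g ms).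
Proof.
  intros Ha Hb Hn Hts. assert (P := fun k g => den_pos k g Hts).
  unfold hlocal, local, value_at. cbn [pa pb len].
  pose proof (P k g) as Pg.
  destruct g as [t u|t u| |g h|g].
  1-3: apply means_eqv; [means|now apply means_hform].
  - pose proof (P k g). pose proof (P k h). means.
  - apply means_allb; [exact Hn|]. intros v t x L Ht.
    assert (Px := @den_pos M v (S k) g _ _ (Forall2_cons _ _ Ht (Forall2_den_later L Hts))).
    lift L. means.
Qed.

Lemma means_in_tree w phi ta tb tn a b n :
  den w ta a -> den w tb b -> den w tn n ->
  means w (hin_tree phi ta tb tn) (@in_tree phi M (Point a b n)).
Proof.
  intros Ha Hb Hn. unfold hin_tree, in_tree. apply means_and.
  - apply means_conj. intros [k g] _. cbn [fst snd].
    apply means_allbs; [exact Hn|constructor|].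
    intros v ts ms L Hts. lift L. assert (P := den_pos k g Hts).
    apply means_imp; [means|]. now apply means_local.
  - assert (P : den w (hpos 0 phi []) (@pos M 0 phi [])) by (apply den_pos; constructor).
    unfold value_at. means.
Qed.

Lemma means_precedes w ta tb tn a b n ta' tb' tn' a' b' n' :
  den w ta a -> den w tb b -> den w tn n ->
  den w ta' a' -> den w tb' b' -> den w tn' n' ->
  means w (hprecedes ta tb tn ta' tb' tn') (@precedes M (Point a b n) (Point a' b' n')).
Proof.
  intros. unfold hprecedes, precedes, hsame, same, hbefore, before, value_at, code.
  cbn [pa pb len]. means.
Qed.
End MeaningOfOrder2.

Section MeaningOfOrder3.
Variable phi : form.
Variable M : model.
Local Open Scope m_scope.
Implicit Types w : world M.

Definition leq_pair (x : M) : Prop := exists y z, x = ⟪y, z⟫ /\ leq phi y z.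

Lemma means_leq w t x : den w t x -> means w (hleq phi t) (leq_pair x).
Proof.
  intros Ht.
  apply means_iff with (exists y, y < su x /\ exists z, z < su x /\ (x = ⟪y, z⟫ /\
    exists a, a < su x /\ exists b, b < su x /\ exists n, n < su x /\
    exists a', a' < su x /\ exists b', b' < su x /\ exists n', n' < su x /\
    (y = ⟪a, b, n⟫ /\ z = ⟪a', b', n'⟫ /\ in_tree phi (Point a b n) /\
     in_tree phi (Point a' b' n') /\
     (y = z \/ precedes (Point a b n) (Point a' b' n'))))).
  - split.
    + intros (y & _ & z & _ & -> & a & _ & b & _ & n & _ & a' & _ & b' & _ & n' & _ &
        -> & -> & H & H' & K).
      exists ⟪a, b, n⟫, ⟪a', b', n'⟫. split; [reflexivity|].
      exists (Point a b n), (Point a' b' n'). do 4 (split; [auto|]).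
      destruct K as [K|K]; [left; now apply code_inj|now right].
    + intros (y & z & -> & [a b n] & [a' b' n'] & -> & -> & H & H' & K).
      unfold code; cbn [pa pb len].
      set (y := ⟪a, b, n⟫). set (z := ⟪a', b', n'⟫).
      assert (Y : forall u : M, u <= y -> u <= ⟪y, z⟫).
      { intros u Hu. exact (le_trans Hu (le_pr2_l _ _)). }
      assert (Z : forall u : M, u <= z -> u <= ⟪y, z⟫).
      { intros u Hu. exact (le_trans Hu (le_pr2_r _ _)). }
      exists y. split; [apply le_pr2_l|]. exists z. split; [apply le_pr2_r|].
      split; [reflexivity|].
      exists a. split; [apply Y, le_pr2_l|].
      exists b. split; [exact (Y _ (le_trans (le_pr2_l _ _) (le_pr2_r _ _)))|].
      exists n. split; [exact (Y _ (le_trans (le_pr2_r _ _) (le_pr2_r _ _)))|].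
      exists a'. split; [apply Z, le_pr2_l|].
      exists b'. split; [exact (Z _ (le_trans (le_pr2_l _ _) (le_pr2_r _ _)))|].
      exists n'. split; [exact (Z _ (le_trans (le_pr2_r _ _) (le_pr2_r _ _)))|].
      do 4 (split; [auto|]).
      destruct K as [K|K]; [left; exact (f_equal (@code M) K)|now right].
  - unfold hleq.
    repeat match goal with
    | |- means _ (hexb _ _) _ => apply means_exb; [means|];
        let v := fresh in let t := fresh in let y := fresh in let L := fresh in
        intros v t y L ?; lift L
    | |- means _ (_ ∧ _)%fm _ => apply means_and
    | |- means _ (_ ∨ _)%fm _ => apply means_or
    | |- means _ (hin_tree _ _ _ _) _ => apply means_in_tree; assumption
    | |- means _ (hprecedes _ _ _ _ _ _) _ => apply means_precedes; assumption
    | |- means _ (_ ≐ _)%fm _ => means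
    end.
Qed.
End MeaningOfOrder3.

(** *** Boundedness *)

(** A term written with binders does not mention the variables bound after it was
    introduced: one more binder shifts it. *)
Definition stable (d : nat) (t : tm) : Prop :=
  forall e, d <= e -> t (S e) = lift_term (t e).
Definition hbounded (d : nat) (f : fm) : Prop := forall e, d <= e -> bounded (f e).

Lemma stable_mono d e t : d <= e -> stable d t -> stable e t.
Proof. intros H K i Hi. apply K. lia. Qed.

Lemma stable_su d t : stable d t -> stable d (hsucc t).
Proof. intros H e L. unfold hsucc. now rewrite H. Qed.
Lemma stable_ad d t u : stable d t -> stable d u -> stable d (hadd t u).
Proof. intros H K e L. unfold hadd. now rewrite H, K. Qed.
Lemma stable_mu d t u : stable d t -> stable d u -> stable d (hmul t u).
Proof. intros H K e L. unfold hmul. now rewrite H, K. Qed.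
Lemma stable_pair d t u : stable d t -> stable d u -> stable d (hpair t u).
Proof. intros H K. unfold hpair. auto using stable_ad, stable_mu. Qed.
Lemma stable_num d n : stable d (hnum n).
Proof. intros e L. unfold hnum, lift_term. now rewrite map_term_num. Qed.

Lemma stable_pos d k g ts : Forall (stable d) ts -> stable d (hpos k g ts).
Proof.
  intros H. apply stable_pair; [apply stable_num|].
  induction H; simpl; auto using stable_num, stable_pair.
Qed.

Lemma hbounded_equ d t u : hbounded d (hequ t u).
Proof. intros e L. apply bounded_equ. Qed.
Lemma hbounded_less d t u : hbounded d (hless t u).
Proof. intros e L. apply bounded_less. Qed.
Lemma hbounded_imp d f g : hbounded d f -> hbounded d g -> hbounded d (himp f g).
Proof. intros H K e L. apply bounded_imp; auto. Qed.
Lemma hbounded_neg d f : hbounded d f -> hbounded d (hneg f).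
Proof. intros H. apply hbounded_imp; [exact H|intros e L; apply bounded_bot]. Qed.
Lemma hbounded_and d f g : hbounded d f -> hbounded d g -> hbounded d (hand f g).
Proof. intros H K. apply hbounded_neg, hbounded_imp, hbounded_neg; assumption. Qed.
Lemma hbounded_or d f g : hbounded d f -> hbounded d g -> hbounded d (hor f g).
Proof. intros H K. apply hbounded_imp; [now apply hbounded_neg|exact K]. Qed.
Lemma hbounded_iff d f g : hbounded d f -> hbounded d g -> hbounded d (hiff f g).
Proof. intros H K. apply hbounded_and; now apply hbounded_imp. Qed.

Lemma hbounded_allb d t f : stable d t ->
  (forall e x, d <= e -> stable e x -> hbounded e (f x)) -> hbounded d (hallb t f).
Proof.
  intros Ht Hf e L. unfold hallb, hall, himp, hless, level at 1.
  rewrite (Ht e L). replace (S e - S e) with 0 by lia. apply bounded_all.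
  apply (Hf (S e)); [lia| |lia].
  intros i Hi. unfold level, lift_term. simpl. f_equal. lia.
Qed.
Lemma hbounded_exb d t f : stable d t ->
  (forall e x, d <= e -> stable e x -> hbounded e (f x)) -> hbounded d (hexb t f).
Proof. intros Ht Hf. apply hbounded_neg, hbounded_allb; auto using hbounded_neg. Qed.

Lemma hbounded_conj {A} d (l : list A) F : (forall j, hbounded d (F j)) ->
  hbounded d (hconj l F).
Proof.
  intros H. induction l; simpl; [|now apply hbounded_and].
  apply hbounded_neg. intros e L. apply bounded_bot.
Qed.

Lemma hbounded_allbs k : forall d n acc F, stable d n -> Forall (stable d) acc ->
  (forall e ts, d <= e -> Forall (stable e) ts -> hbounded e (F ts)) ->
  hbounded d (hallbs k n acc F).
Proof.
  induction k; intros d n acc F Hn Ha HF; cbn [hallbs]; [now apply HF|].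
  apply hbounded_allb; [exact Hn|]. intros e x L Hx. apply IHk.
  - exact (stable_mono L Hn).
  - constructor; [exact Hx|]. eapply Forall_impl; [|exact Ha].
    intros t. now apply stable_mono.
  - intros i ts Hi. apply HF. lia.
Qed.

(* The analogue of [lift] for numbers of variables in scope. *)
Ltac raise L :=
  match type of L with
  | ?d <= ?e =>
    repeat match goal with
    | H : stable d _ |- _ => apply (stable_mono L) in H
    | H : Forall (stable d) _ |- _ =>
        apply (Forall_impl _ (fun t => @stable_mono d e t L)) in H
    end; clear L
  end.

Ltac bounded_step :=
  match goal with
  | |- stable _ _ => first [assumption | apply stable_num | apply stable_su
      | apply stable_ad | apply stable_mu | apply stable_pos | apply stable_pair]
  | |- Forall _ _ => first [assumption | apply Forall_cons | apply Forall_nil]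
  | |- hbounded _ (hequ _ _) => apply hbounded_equ
  | |- hbounded _ (hless _ _) => apply hbounded_less
  | |- hbounded _ (himp _ _) => apply hbounded_imp
  | |- hbounded _ (hneg _) => apply hbounded_neg
  | |- hbounded _ (hand _ _) => apply hbounded_and
  | |- hbounded _ (hor _ _) => apply hbounded_or
  | |- hbounded _ (hiff _ _) => apply hbounded_iff
  | |- hbounded _ (hallb _ _) => apply hbounded_allb; [|
      let e := fresh in let x := fresh in let L := fresh in
      intros e x L ?; raise L]
  | |- hbounded _ (hexb _ _) => apply hbounded_exb; [|
      let e := fresh in let x := fresh in let L := fresh in
      intros e x L ?; raise L]
  end.
Ltac bounded := repeat bounded_step.

Lemma hbounded_local d a b n k g ts : stable d a -> stable d b -> stable d n ->
  Forall (stable d) ts -> hbounded d (hlocal a b n k g ts).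
Proof.
  intros. unfold hlocal, hat. destruct g; bounded.
  - intros e L. apply bounded_equ.
  - intros e L. apply bounded_less.
  - intros e L. apply bounded_bot.
Qed.

Lemma hbounded_in_tree d phi a b n : stable d a -> stable d b -> stable d n ->
  hbounded d (hin_tree phi a b n).
Proof.
  intros. unfold hin_tree. apply hbounded_and; [|unfold hat; bounded].
  apply hbounded_conj. intros j. apply hbounded_allbs; [assumption|constructor|].
  intros e ts L Hts. apply hbounded_imp; [bounded|].
  apply hbounded_local; eauto using stable_mono.
Qed.

Lemma hbounded_leq d phi x : stable d x -> hbounded d (hleq phi x).
Proof.
  intros Hx. unfold hleq.
  repeat first [bounded_step | apply hbounded_in_tree; assumption
    | progress unfold hprecedes, hsame, hbefore, hat].
Qed.

Lemma bounded_sub f : bounded f -> forall s, bounded (sub s f).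
Proof.
  induction 1 as [t u|t u| |f g _ IHf _ IHg|t f _ IH]; intros s; cbn [sub]; auto using bounded.
  replace (map_term (up s) (lift_term t)) with (lift_term (map_term s t)).
  - apply bounded_all, IH.
  - unfold lift_term. now rewrite !map_term_comp.
Qed.

(** *** The verified order *)

Section Order.
Variable phi : form.
Hypothesis phi_sentence : sentence phi.

Definition order_form : form := cut 1 (hleq phi (level 0) 1).
Definition order : nat := pair (gn order_form) (gn order_form).

Lemma bounded_order : bounded order_form.
Proof.
  unfold order_form, cut. apply bounded_sub.
  apply (@hbounded_leq 1 phi (level 0)); [|lia].
  intros e L. unfold level, lift_term. simpl. f_equal. lia.
Qed.

Section InModel.
Variable M : model.
Local Open Scope m_scope.

Lemma order_form_meaning (r : nat -> M) : tr r order_form <-> leq_pair phi (r 0).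
Proof.
  unfold order_form, cut. rewrite tr_sub. set (s := fun i => ev r _).
  assert (H := @den_level M 1 s 0 ltac:(lia)). change (s (1 - 1)) with (r 0) in H.
  exact (means_leq phi H (later_refl _)).
Qed.

Lemma InSigma_order (x : M) : mInSigma (std (gn order_form)) x <-> leq_pair phi x.
Proof.
  rewrite (InSigma_bounded x (fun _ => ze) bounded_order (closed_cut _ _)).
  apply order_form_meaning.
Qed.

Lemma Le_order (x y : M) : mLe (std order) x y <-> leq phi x y.
Proof.
  unfold mLe, order. rewrite std_pair. split.
  - intros (p & e & E & H). apply pr2_inj in E as [_ <-]. apply InSigma_order in H.
    destruct H as (u & z & E & H). apply pr2_inj in E as [-> ->]. exact H.
  - intros H. do 2 eexists. split; [reflexivity|]. apply InSigma_order. now exists x, y.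
Qed.

Lemma order_is_linear : mLO (@std M order).
Proof.
  split; [|split; [|split; [|split]]].
  - exists (std (gn order_form)), (std (gn order_form)). split; [apply std_pair|]. split.
    + intros n. rewrite InSigma_order.
      rewrite (InPi_bounded n (fun _ => ze) bounded_order (closed_cut _ _)).
      apply order_form_meaning.
    + intros n H. apply InSigma_order in H. destruct H as (x & y & E & _). eauto.
  - intros x y H. unfold mDom. rewrite !Le_order in *.
    destruct H as (p & q & -> & -> & Hp & Hq & _). split.
    + exists p, p. auto 8.
    + exists q, q. auto 8.
  - intros x y z. rewrite !Le_order.
    intros [(p & q & -> & -> & Hp & Hq & H) (q' & r & E & -> & _ & Hr & K)].
    apply code_inj in E as <-. exists p, r. do 4 (split; [auto|]).
    destruct H as [<-|H]; [exact K|]. destruct K as [<-|K]; right; [exact H|].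
    exact (precedes_trans H K).
  - intros x y. rewrite !Le_order.
    intros [(p & q & -> & -> & Hp & Hq & H) (q' & p' & E & E' & _ & _ & K)].
    apply code_inj in E as <-. apply code_inj in E' as <-.
    destruct H as [<-|H]; [reflexivity|]. destruct K as [<-|K]; [reflexivity|].
    exfalso. exact (precedes_irrefl (precedes_trans H K)).
  - intros x y. unfold mDom. rewrite !Le_order.
    intros [(p & p' & -> & _ & Hp & _) (q & q' & -> & _ & Hq & _)].
    destruct (precedes_total p q) as [E|[H|H]].
    + left. exists p, q. auto 8.
    + left. exists p, q. auto 8.
    + right. exists q, p. do 4 (split; [auto|]). auto.
Qed.

Definition true_codes (x : M) : Prop := exists p, x = code p /\ truthful phi p.

Lemma T_sentence (r : nat -> M) : tr r phi <-> @T M [] phi.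
Proof. apply tr_closed with (n := 0); [exact phi_sentence|lia]. Qed.

Definition empty_point : point M := Point ze ze ze.

Lemma code_empty : code empty_point = std 0.
Proof.
  change (⟪ze, ⟪ze, ze⟫⟫ = @ze M). unfold pr2. repeat rewrite ?ad0, ?mu0. reflexivity.
Qed.

Lemma empty_in_order : mDom (std order) (@std M 0).
Proof.
  apply Le_order. rewrite <- code_empty.
  assert (H : in_tree phi empty_point).
  { split; [|intros K; exfalso; exact (@lt_0 M _ K)].
    intros [k g] _. apply allbs_iff. intros ms _ _ K. exfalso. exact (@lt_0 M _ K). }
  exists empty_point, empty_point. auto 8.
Qed.

Lemma true_codes_empty : true_codes (@std M 0).
Proof.
  exists empty_point. split; [symmetry; apply code_empty|].
  apply truthful_iff. intros k g ms y _ _ K. exfalso. exact (@lt_0 M _ K).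
Qed.

Lemma true_codes_down (r : nat -> M) : ~ tr r phi ->
  forall x : M, true_codes x -> exists y, mLt (std order) y x /\ true_codes y.
Proof.
  intros H x (p & -> & Hp). rewrite (T_sentence r) in H.
  destruct (truthful_extend Hp) as (q & Hq & L).
  exists (code q). split; [|exists q; now split]. split.
  - apply Le_order. exists q, p. do 2 (split; [reflexivity|]).
    split; [now apply truthful_in_tree|]. split; [now apply truthful_in_tree|now right].
  - intros E. apply code_inj in E as ->. exact (precedes_irrefl L).
Qed.
End InModel.

(** Truth is expressed by the finitely many subformulas of [phi] themselves. *)
Definition htrue_codes (x : tm) : fm :=
  (∃ a b n, x ≐ ⟨a, b, n⟩ ∧
    hconj (subs 0 phi) (fun j => hallbs (fst j) n [] (fun ts =>
      hpos (fst j) (snd j) ts ⋖ n ⇒ ∀ y, aBeta a b (hpos (fst j) (snd j) ts) y ⇒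
        (y ≐ hnum 0 ⇔ hform (snd j) ts) ∧
        match snd j with
        | All g => ∀ x, y ≐ hsucc x ⇒ ¬ hform g (x :: ts)
        | _ => htrue
        end)))%fm.

Lemma means_true_codes (M : model) (w : world M) t x :
  den w t x -> means w (htrue_codes t) (true_codes x).
Proof.
  intros Ht.
  apply means_iff with (exists a b n, x = code (Point a b n) /\ truthful phi (Point a b n)).
  { split; [intros (a & b & n & H); now exists (Point a b n)|].
    intros ([a b n] & H). now exists a, b, n. }
  unfold htrue_codes. do 3 (apply means_ex; means_step).
  apply means_and; [unfold code; cbn [pa pb len]; means|].
  unfold truthful. apply means_conj. intros [k g] _. cbn [fst snd len].
  apply means_allbs; [assumption|constructor|].
  intros v' ts ms L Hts. lift L. assert (P := den_pos k g Hts).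
  apply means_imp; [means|]. apply means_all. intros u ty y L Hy.
  assert (Hts' := Forall2_den_later L Hts). lift L.
  apply means_imp; [unfold value_at; cbn [pa pb]; apply means_Beta; assumption|].
  unfold right_for. apply means_and.
  - apply means_eqv; [means|now apply means_hform].
  - destruct g as [| | | |g]; try (unfold htrue; means; fail).
    apply means_all. intros u' tx z L Hz. apply means_imp.
    + lift L. means.
    + apply means_neg, means_hform. constructor; [exact Hz|exact (Forall2_den_later L Hts')].
Qed.

Theorem order_verified : PA_verifiable_LO order.
Proof.
  apply model_completeness; [auto|]. intros M r _.
  assert (H := @means_LO M (0, r) (hnum order) (std order) (@den_num M (0, r) order)).
  exact (proj2 (H _ (later_refl _)) (order_is_linear M)).
Qed.
End Order.

(** * The standard model and well-foundedness *)

Definition nat_structure : structure := Structure 0 S Nat.add Nat.mul Peano.lt.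

Lemma ev_nat r t : @ev nat_structure r t = eval r t.
Proof. induction t; simpl; congruence. Qed.

Lemma tr_nat f : forall r, @tr nat_structure r f <-> sat r f.
Proof.
  induction f; intros r; cbn [tr sat]; rewrite ?ev_nat; try reflexivity.
  - rewrite IHf1, IHf2. reflexivity.
  - split; intros H n; apply (IHf (push n r)), H.
Qed.

Lemma nat_PA f r : PA f -> @tr nat_structure r f.
Proof.
  intros [g H|g].
  - simpl in H. repeat (destruct H as [<-|H]); try destruct H; simpl; try lia.
    intros H. apply H.
    + intros L. unfold Ex. intros K. apply (K (r 1 - S (r 0))). simpl in *. lia.
    + intros K. apply NNPP. intros N. apply K. intros n. simpl. lia.
  - intros H0 HS n. cbn [tr] in HS. rewrite tr_inst in H0.
    induction n as [|n IH]; [exact H0|]. apply (@tr_step nat_structure g r n), HS, IH.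
Qed.

Definition nat_model : model := Model nat_PA.

Lemma std_nat n : @std nat_model n = n.
Proof. induction n; [reflexivity|]. exact (f_equal S IHn). Qed.

Section Wellfounded.
Variable phi : form.
Hypothesis phi_sentence : sentence phi.
Hypothesis phi_true : true_in_N phi.

Local Notation point := (point nat_model).
Local Notation leq := (@leq phi nat_model).

Definition entry_at (p : point) (i : nat) : nat := epsilon (inhabits 0) (value_at p i).

Lemma entry_atP p i y : value_at p i y <-> y = entry_at p i.
Proof.
  assert (H : value_at p i (entry_at p i)) by exact (epsilon_spec (inhabits 0) _ (Beta_total _ _ i)).
  split; [intros K; exact (Beta_fun K H)|now intros ->].
Qed.

Lemma nat_least (P : nat -> Prop) n : P n -> exists m, P m /\ forall k, k < m -> ~ P k.
Proof.
  induction n as [n IH] using lt_wf_ind. intros Pn.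
  destruct (classic (exists k, k < n /\ P k)) as [(k & Hk & Pk)|N]; [eauto|].
  exists n. split; [exact Pn|]. intros k Hk Pk. apply N. eauto.
Qed.

(** On an infinite branch the postponed conditions all apply, so the entries are
    right by induction on the subformulas; then the root condition says that
    [phi] is false. *)
Lemma no_branch (s : nat -> nat) : ~ forall n, exists p : point,
  n <= len p /\ in_tree phi p /\ forall i, i < n -> entry_at p i = s i.
Proof.
  intros H.
  assert (V : forall g k ms, In (k, g) (subs 0 phi) -> length ms = k ->
    (s (@pos nat_model k g ms) = 0 <-> @T nat_model ms g)).
  { assert (Loc : forall g k ms m, In (k, g) (subs 0 phi) -> length ms = k ->
      exists p : point, m < len p /\ @pos nat_model k g ms < len p /\
        (forall i y, i <= m -> (value_at p i y <-> y = s i)) /\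
        (forall y, value_at p (@pos nat_model k g ms) y <-> y = s (@pos nat_model k g ms)) /\
        @local nat_model p k g ms).
    { intros g k ms m I L.
      destruct (H (S (m + @pos nat_model k g ms))) as (p & Hp & Tp & Ep).
      assert (A : forall i y, i <= m + @pos nat_model k g ms -> (value_at p i y <-> y = s i)).
      { intros i y Hi. rewrite entry_atP, Ep by lia. reflexivity. }
      exists p. split; [lia|]. split; [lia|]. split; [intros; apply A; lia|].
      split; [intros; apply A; lia|].
      destruct Tp as [Tp _]. specialize (Tp _ I). rewrite allbs_iff in Tp.
      cbn [fst snd] in Tp. specialize (Tp ms L). rewrite app_nil_r in Tp. apply Tp.
      - intros x Hx. eapply (@le_lt_trans nat_model); [apply (le_pos k g Hx)|]. simpl. lia.
      - simpl. lia. }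
    induction g as [t u|t u| |g IHg h IHh|g IHg]; intros k ms I L.
    1-3: match goal with |- context [@T _ _ ?f] =>
      destruct (Loc f k ms 0 I L) as (p & _ & _ & _ & Ap & Lp) end;
      cbn [local] in Lp; rewrite Ap in Lp; rewrite <- Lp; split; auto.
    - destruct (subs_imp I) as [Ig Ih].
      destruct (Loc _ k ms (@pos nat_model k g ms + @pos nat_model k h ms) I L)
        as (p & Hm & _ & A & Ap & Lp).
      cbn [local] in Lp. rewrite Ap in Lp. rewrite !A in Lp by lia.
      assert (Hg : @pos nat_model k g ms < len p) by lia.
      assert (Hh : @pos nat_model k h ms < len p) by lia.
      specialize (Lp Hg Hh).
      specialize (IHg k ms Ig L). specialize (IHh k ms Ih L).
      change (@T nat_model ms (Imp g h)) with (@T nat_model ms g -> @T nat_model ms h).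
      rewrite <- IHg, <- IHh. change (@ze nat_model) with 0 in Lp. split.
      + intros E F. symmetry. apply Lp; auto.
      + intros E. symmetry. apply Lp. intros F. symmetry. apply E. now symmetry.
    - assert (I' := subs_all I).
      assert (Lx : forall x, exists p : point,
        (s (@pos nat_model k (All g) ms) = 0 -> s (@pos nat_model (S k) g (x :: ms)) = 0) /\
        (s (@pos nat_model k (All g) ms) = S x -> s (@pos nat_model (S k) g (x :: ms)) <> 0)).
      { intros x.
        destruct (Loc _ k ms (x + @pos nat_model (S k) g (x :: ms)) I L)
          as (p & Hm & _ & A & Ap & Lp).
        exists p. cbn [local] in Lp.
        assert (Hx : x < len p) by lia.
        assert (Hg : @pos nat_model (S k) g (x :: ms) < len p) by lia.
        specialize (Lp x Hx Hg).
        rewrite !Ap, A in Lp by lia. change (@ze nat_model) with 0 in Lp.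
        change (@su nat_model x) with (S x) in Lp.
        destruct Lp as [L1 L2]. split; intros E.
        - symmetry. apply L1. now symmetry.
        - intros F. apply L2; now symmetry. }
      rewrite T_all. split.
      + intros E x. destruct (Lx x) as [_ [L1 _]].
        apply (IHg (S k) (x :: ms) I'); [exact (f_equal S L)|auto].
      + intros E. destruct (s (@pos nat_model k (All g) ms)) as [|x] eqn:F; [reflexivity|].
        destruct (Lx x) as [_ [_ L2]]. exfalso. apply L2; [reflexivity|].
        apply (IHg (S k) (x :: ms) I'); [exact (f_equal S L)|]. apply E. }
  destruct (H (S (@pos nat_model 0 phi []))) as (p & Hp & [_ Tp] & Ep).
  assert (Hp' : @pos nat_model 0 phi [] < len p) by lia.
  apply Tp; [exact Hp'|]. apply entry_atP. rewrite Ep by lia. symmetry.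
  apply V; [apply subs_self|reflexivity|].
  apply tr_nat, phi_true.
Qed.

Definition below (p q : point) : Prop := in_tree phi p /\ in_tree phi q /\ precedes p q.

(** Otherwise the least entries which keep the sequence an initial segment of
    inaccessible points form an infinite branch: an inaccessible point of least
    code at the end of such a segment has a smaller inaccessible point, which
    cannot be to its left and has to extend it. *)
Lemma below_wf : well_founded below.
Proof.
  intros p0. apply NNPP. intros N0.
  pose (B := fun p : point => ~ Acc below p).
  assert (Bd : forall p, B p -> exists q, B q /\ below q p).
  { intros p Hp. apply NNPP. intros N. apply Hp. constructor. intros q Hq.
    apply NNPP. intros K. apply N. now exists q. }
  assert (Bt : forall p, B p -> in_tree phi p).
  { intros p Hp. destruct (Bd p Hp) as (q & _ & _ & H & _). exact H. }
  pose (agree := fun (l : list nat) (p : point) =>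
    length l <= len p /\ forall i, i < length l -> entry_at p i = nth i l 0).
  pose (good := fun l => exists p, B p /\ agree l p).
  pose (next := fun l => epsilon (inhabits 0)
    (fun v => good (l ++ [v]) /\ forall u, u < v -> ~ good (l ++ [u]))).
  pose (pre := fix pre n := match n with 0 => [] | S n => pre n ++ [next (pre n)] end).
  assert (Lpre : forall n, length (pre n) = n).
  { induction n; simpl; [reflexivity|]. rewrite length_app. simpl. lia. }
  assert (Hnth : forall n i, i < n -> nth i (pre n) 0 = nth i (pre (S i)) 0).
  { induction n; intros i Hi; [lia|]. destruct (Nat.eq_dec i n) as [->|Hn]; [reflexivity|].
    simpl pre at 1. rewrite app_nth1 by (rewrite Lpre; lia). apply IHn. lia. }
  pose (s := fun i => nth i (pre (S i)) 0).
  assert (agreeP : forall n p, agree (pre n) p <->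
    n <= len p /\ forall i, i < n -> entry_at p i = s i).
  { intros n p. unfold agree. rewrite Lpre. split; intros [H K]; (split; [exact H|]);
      intros i Hi; rewrite K by exact Hi; unfold s; [|symmetry]; apply Hnth, Hi. }
  assert (agreeS : forall n v p, agree (pre n ++ [v]) p <->
    agree (pre n) p /\ n < len p /\ entry_at p n = v).
  { intros n v p. unfold agree. rewrite length_app, Lpre. simpl length. split.
    - intros [H K]. split; [split; [lia|]|split; [lia|]].
      + intros i Hi. rewrite K by lia. rewrite app_nth1; [reflexivity|rewrite Lpre; lia].
      + rewrite K by lia. rewrite app_nth2 by (rewrite Lpre; lia).
        now rewrite Lpre, Nat.sub_diag.
    - intros [[H K] [H' E]]. split; [lia|]. intros i Hi.
      destruct (Nat.eq_dec i n) as [->|Hn].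
      + rewrite app_nth2 by (rewrite Lpre; lia). now rewrite Lpre, Nat.sub_diag.
      + rewrite app_nth1 by (rewrite Lpre; lia). apply K. lia. }
  assert (Main : forall n, good (pre n) /\ (forall m, m < n -> forall p, B p ->
    agree (pre m) p -> m < len p -> s m <= entry_at p m)).
  { induction n as [|n [Hg Hl]].
    - split; [|lia]. exists p0. split; [exact N0|]. apply agreeP. split; [lia|]. lia.
    - assert (Hlong : exists p, B p /\ agree (pre n) p /\ n < len p).
      { apply NNPP. intros NL.
        assert (Len : forall p, B p -> agree (pre n) p -> len p = n).
        { intros p Hp Ha. assert (K := proj1 (proj1 (agreeP n p) Ha)).
          destruct (Nat.eq_dec (len p) n); [assumption|]. exfalso. apply NL.
          exists p. split; [exact Hp|]. split; [exact Ha|]. lia. }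
        destruct Hg as (p1 & Hp1 & Ha1).
        destruct (@nat_least (fun c => exists p, B p /\ agree (pre n) p /\ code p = c)
          (code p1)) as (c & (p & Hp & Ha & Ec) & Hmin); [exists p1; auto|].
        destruct (Bd p Hp) as (q & Hq & _ & _ & i & Hi & Sq & Bq).
        assert (Lp := Len p Hp Ha). assert (Ap := proj2 (proj1 (agreeP n p) Ha)).
        assert (Eq : forall j, j < i -> entry_at q j = entry_at p j).
        { intros j Hj. destruct (Sq j Hj) as (_ & _ & z & _ & Qz & Pz).
          apply entry_atP in Qz, Pz. congruence. }
        assert (Aq : forall j, j < i -> j < n -> entry_at q j = s j).
        { intros j Hj Hn. rewrite Eq by exact Hj. apply Ap, Hn. }
        destruct Bq as [(L1 & L2 & z & _ & u & _ & Qz & Pu & L)|[[L1 L2]|(L1 & L2 & L)]].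
        - apply entry_atP in Qz, Pu. change (z < u) in L.
          change (i < len p) in L2. change (i < len q) in L1.
          assert (K : s i <= entry_at q i).
          { apply Hl; [lia|exact Hq| |exact L1]. apply agreeP. split; [lia|].
            intros j Hj. apply Aq; lia. }
          rewrite <- (Ap i) in K by lia. lia.
        - change (i < len q) in L1. apply NL. exists q. split; [exact Hq|].
          split; [|lia]. apply agreeP. split; [lia|]. intros j Hj. apply Aq; lia.
        - change (code q < code p) in L. apply (Hmin (code q)); [lia|].
          exists q. split; [exact Hq|]. split; [|reflexivity]. apply agreeP.
          split; [lia|]. intros j Hj. apply Aq; lia. }
      destruct Hlong as (p & Hp & Ha & Hn).
      assert (Hnext : good (pre n ++ [next (pre n)]) /\
        forall u, u < next (pre n) -> ~ good (pre n ++ [u])).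
      { apply (epsilon_spec (inhabits 0) (fun v => good (pre n ++ [v]) /\
          forall u, u < v -> ~ good (pre n ++ [u]))).
        apply (@nat_least (fun v => good (pre n ++ [v])) (entry_at p n)).
        exists p. split; [exact Hp|]. apply agreeS. auto. }
      destruct Hnext as [Hgood Hleast].
      split; [exact Hgood|]. intros m Hm q Hq Haq Hmq.
      destruct (Nat.eq_dec m n) as [->|Hmn]; [|apply Hl; auto; lia].
      apply Nat.nlt_ge. intros K. apply (Hleast (entry_at q n)).
      + unfold s in K. simpl pre in K. rewrite app_nth2 in K by (rewrite Lpre; lia).
        rewrite Lpre, Nat.sub_diag in K. exact K.
      + exists q. split; [exact Hq|]. apply agreeS. auto. }
  apply (@no_branch s). intros n. destruct (Main n) as [(p & Hp & Ha) _].
  apply agreeP in Ha. exists p. destruct Ha. auto.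
Qed.

Lemma order_lt_wf : well_founded (order_lt (order phi)).
Proof.
  assert (E : forall x y, order_lt (order phi) x y -> exists p q : point,
    x = code p /\ y = code q /\ below p q).
  { intros x y H. specialize (H (fun _ => 0)). apply tr_nat in H.
    assert (Hm := @means_Lt nat_model (0, fun _ => 0) (hnum (order phi)) (hnum x) (hnum y)
      _ _ _ (@den_num _ _ _) (@den_num _ _ _) (@den_num _ _ _)).
    apply (Hm _ (later_refl _)) in H. rewrite !std_nat in H.
    destruct H as [H N]. rewrite <- (std_nat (order phi)) in H. apply Le_order in H.
    destruct H as (p & q & -> & -> & Hp & Hq & [->|H]); [now elim N|].
    exists p, q. do 2 (split; [reflexivity|]). now split. }
  assert (A : forall p : point, Acc (order_lt (order phi)) (code p)).
  { intros p. induction (below_wf p) as [p _ IH]. constructor. intros x H.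
    destruct (E _ _ H) as (q & p' & -> & C & K).
    rewrite <- (@code_inj nat_model _ _ C) in K. auto. }
  intros x. constructor. intros y H. destruct (E _ _ H) as (p & _ & -> & _). apply A.
Qed.

Lemma order_dom_empty : order_dom (order phi) 0.
Proof.
  intros r. apply tr_nat.
  assert (Hm := @means_Le nat_model (0, r) (hnum (order phi)) (hnum 0) (hnum 0)
    _ _ _ (@den_num _ _ _) (@den_num _ _ _) (@den_num _ _ _)).
  exact (proj2 (Hm _ (later_refl _)) (empty_in_order phi nat_model)).
Qed.
End Wellfounded.

Theorem theorem6 (phi : form) (phi_sentence : sentence phi)
    (phi_true : true_in_N phi) :
  exists l : nat,
    PA_verifiable_LO l /\
    well_founded (order_lt l) /\
    provable (RFN_iter PA aAxPA l) phi.
Proof.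
  exists (order phi). split; [apply order_verified|]. split; [now apply order_lt_wf|].
  apply (@reflection_proves (order phi) phi 0 (htrue_codes phi) (true_codes phi)).
  - exact phi_sentence.
  - intros M w t x. apply means_true_codes.
  - intros M. apply order_is_linear.
  - intros M. split; [apply empty_in_order|apply true_codes_empty].
  - intros M r. now apply true_codes_down.
  - apply order_dom_empty.
Qed.
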